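(* Let $e_n(x)=\sqrt{2}\sin(\pi n x)$, $n\ge 1$. Assume there exist constants $C,\alpha>0$ and $s\in[0,1)$ such that $f\in H^{-s}(0,1)$ and $$|\langle f,e_n\rangle|\geq C e^{-\alpha \pi^2n^2}\quad \text{for all integers } n\ge 1.$$ Consider the stochastic heat equation $$dy-\Delta y\,dt=f(x)\,dW_t,\quad x\in(0,1),\ t>0,\qquad y|_{x=0,1}=0,\qquad y(0,\cdot)=y_0\in L^2(0,1),$$ where $W$ is a one-dimensional standard Brownian motion, and let $\{P_t\}_{t\ge 0}$ be the Markov semigroup on $L^2(0,1)$ associated with this equation. Then $\{P_t\}_{t\ge0}$ is strong Feller at any time $T>\alpha$; that is, for every $T>\alpha$ and every bounded measurable function $\varphi\colon L^2(0,1)\to\mathbb{R}$, the function $P_T\varphi$ is continuous on $L^2(0,1)$.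
   Context: The functions $e_n(x)=\sqrt2\sin(\pi n x)$, $n\ge1$, are the $L^2(0,1)$-normalized eigenfunctions of $-\Delta$ on $(0,1)$ with Dirichlet boundary conditions, with eigenvalues $\lambda_n=\pi^2n^2$. For $0\le s<1$, $$H^{-s}(0,1):=\Big\{f=\sum_{n\ge1} f_ne_n:\ \sum_{n\ge1}\lambda_n^{-s}|f_n|^2<\infty\Big\},$$ a space of formal series (for $s=0$ it is $L^2(0,1)$), and $\langle f,e_n\rangle:=f_n$. The solution of the equation is understood in the mild sense: $y(t)=e^{t\Delta}y_0+\int_0^t e^{(t-r)\Delta}f\,dW_r$, where $e^{t\Delta}$ is the Dirichlet heat semigroup, acting by $e^{t\Delta}\sum_n g_ne_n=\sum_n e^{-\lambda_nt}g_ne_n$ (for $t>0$ it maps $H^{-s}(0,1)$ into $L^2(0,1)$). For each $y_0\in L^2(0,1)$ there is a unique mild solution $y\in C([0,\infty);L^2(0,1))$. The associated Markov semigroup is $P_t\varphi(y_0)=\mathbb{E}\,\varphi(y(t))$, where $y$ is the solution with $y(0)=y_0$ and $\varphi\colon L^2(0,1)\to\mathbb{R}$ is bounded measurable. *)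

(* Defs.v *)
From HB Require Import structures.
From mathcomp Require Import all_boot all_order all_algebra.
From mathcomp Require Import all_classical all_reals all_analysis.
From mathcomp Require Import measurable_realfun.

Set Implicit Arguments.
Unset Strict Implicit.
Unset Printing Implicit Defensive.

Import Order.TTheory GRing.Theory Num.Theory.
Import numFieldNormedType.Exports.

Local Open Scope classical_set_scope.
Local Open Scope ring_scope.

(* MathComp-Analysis provides the space [LfunType mu p1] of p-integrable
   functions as a left module, but neither its seminorm nor the resulting
   topology.  Almost everywhere equal functions are at distance 0: they are not
   identified, but no open set, hence no Borel set, separates them.  Thus Borel
   (resp. continuous) functions on this space are exactly the Borel (resp.
   continuous) functions on its quotient by a.e. equality, the Lebesgue space. *)
Section Lp_seminorm.
Context d (T : measurableType d) (R : realType).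
Variables (mu : {measure set T -> \bar R}) (p : \bar R) (p1 : (1 <= p)%E).
Local Notation Lp := (LfunType mu p1).

Definition Lpnorm (u : Lp) : R := fine ('N[mu]_p[EFin \o u])%E.

Definition Lpball (u : Lp) (e : R) : set Lp := [set v | Lpnorm (u - v) < e].

Lemma Lpnorm0 : Lpnorm 0 = 0.
Proof. by rewrite /Lpnorm Lnorm0 // gt_eqF// (lt_le_trans _ p1). Qed.

Lemma LpnormD u v : Lpnorm (u + v) <= Lpnorm u + Lpnorm v.
Proof. exact: ler_LnormD. Qed.

Lemma LpnormN u : Lpnorm (- u) = Lpnorm u.
Proof. exact: LnormrN. Qed.

Let Lpball_center u (e : R) : 0 < e -> Lpball u e u.
Proof. by rewrite /Lpball/= subrr Lpnorm0. Qed.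

Let Lpball_sym u v (e : R) : Lpball u e v -> Lpball v e u.
Proof. by rewrite /Lpball/= -LpnormN opprB. Qed.

Let Lpball_triangle u v w (e1 e2 : R) :
  Lpball u e1 v -> Lpball v e2 w -> Lpball u (e1 + e2) w.
Proof.
rewrite /Lpball/= => uv vw.
have -> : u - w = (u - v) + (v - w) by rewrite addrA subrK.
exact: le_lt_trans (LpnormD _ _) (ltrD uv vw).
Qed.

HB.instance Definition _ := isPointed.Build Lp 0.
HB.instance Definition _ := hasNbhs.Build Lp (nbhs_ (entourage_ Lpball)).
HB.instance Definition _ := @Nbhs_isPseudoMetric.Build R Lp
  (entourage_ Lpball) erefl Lpball
  Lpball_center Lpball_sym Lpball_triangle erefl.

End Lp_seminorm.

Definition leb01 (R : realType) : {measure set (measurableTypeR R) -> \bar R} :=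
  mrestr (@lebesgue_measure R) (measurable_itv `]0, 1[).

Definition L2 (R : realType) : Type := LfunType (@leb01 R) (lee1n 2).
HB.instance Definition _ (R : realType) := GRing.Lmodule.on (L2 R).
HB.instance Definition _ (R : realType) := PseudoPointedMetric.on (L2 R).

Definition L2fun (R : realType) (u : L2 R) : R -> R :=
  (u : LfunType (@leb01 R) (lee1n 2)).
Coercion L2fun : L2 >-> Funclass.

Definition L2borel (R : realType) := g_sigma_algebraType (@open (L2 R)).
HB.instance Definition _ (R : realType) := Measurable.on (L2borel R).

Definition L2norm (R : realType) (u : L2 R) : R := Lpnorm u.

Section dirichlet_basis.
Variable R : realType.

Definition dirichlet_fun (n : nat) (x : R) : R :=
  Num.sqrt 2 * sin (pi * n%:R * x).

Lemma dirichlet_fun_Lfun n :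
  dirichlet_fun n \in Lfun (leb01 R) 2%:R%:E.
Proof.
have mf : measurable_fun [set: measurableTypeR R] (dirichlet_fun n).
  apply: measurable_funM => //.
  apply: (measurableT_comp (continuous_measurable_fun (@continuous_sin R))).
  exact: measurable_funM.
rewrite inE/=; apply/andP; split; rewrite inE//=.
rewrite /finite_norm unlock poweR_lty//=.
apply: (@le_lt_trans _ _ (\int[leb01 R]_x (cst 2%:E x))%E); last first.
  rewrite integral_cst// lte_mul_pinfty//.
  by rewrite /leb01/= /mrestr/= setTI lebesgue_measure_itv/= lte_fin ltr01 ltry.
apply: ge0_le_integral => //.
  apply/measurable_EFinP; apply: (measurableT_comp (measurable_powR _)) => //.
  exact: measurableT_comp.
move=> x _ /=; rewrite lee_fin powR_mulrn// -normrX exprMn sqr_sqrtr//.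
rewrite normrM ger0_norm// ler_piMr// normrX.
by rewrite exprn_ile1// ler_norml sin_geN1 sin_le1.
Qed.

Definition e_ (n : nat) : L2 R := Lfun_Sub (lee1n 2) (dirichlet_fun_Lfun n).

Definition eigenval (n : nat) : R := pi ^+ 2 * n%:R ^+ 2.

Definition coef (u : L2 R) (n : nat) : R := \int[leb01 R]_x (u x * e_ n x).

End dirichlet_basis.

(* A formal series $\sum_{n \ge 1} f_n e_n$ is its coefficient sequence
   [f : nat -> R]; the value [f 0] plays no role. *)
Definition in_Hneg (R : realType) (s : R) (f : nat -> R) : Prop :=
  (\sum_(1 <= n <oo) (eigenval R n `^ (- s) * f n ^+ 2)%:E < +oo)%E.

(* The series is summed in L^2(0,1); for f in H^{-s} it converges for all
   t > 0, and for coefficient sequences of L^2 functions also for t = 0.  When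
   it diverges the value is unspecified. *)
Definition heat (R : realType) (t : R) (g : nat -> R) : L2 R :=
  lim ((fun N => \sum_(1 <= n < N)
          (expR (- eigenval R n * t) * g n) *: e_ R n : L2 R) @ \oo).

Section stochastic_integral.
Context d (Omega : measurableType d) (R : realType) (P : probability Omega R).

Definition increment (W : R -> Omega -> R) (a b : R) : Omega -> R :=
  fun w => W b w - W a w.

(* The last parameter of [normal_prob] is the standard deviation.  Mutual
   independence: factors may be dropped by taking [B i] to be the whole line. *)
Record brownian_motion (W : R -> Omega -> R) : Prop := BrownianMotion {
  bm_measurable : forall t, 0 <= t -> measurable_fun [set: Omega] (W t);
  bm_start : {ae P, forall w, W 0 w = 0};
  bm_continuous :
    {ae P, forall w, {within `[0, +oo[, continuous (W ^~ w)}};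
  bm_gaussian : forall a b, 0 <= a -> a < b ->
    forall A : set (measurableTypeR R), measurable A ->
    P (increment W a b @^-1` A) = normal_prob 0 (Num.sqrt (b - a)) A;
  bm_independent : forall (m : nat) (t : nat -> R), 0 <= t 0%N ->
    {homo t : i j / (i <= j)%N >-> i <= j} ->
    forall B : nat -> set (measurableTypeR R), (forall i, measurable (B i)) ->
    P (\bigcap_(i < m) (increment W (t i) (t i.+1) @^-1` B i)) =
      (\prod_(i < m) P (increment W (t i) (t i.+1) @^-1` B i))%E }.

Record step := Step {
  step_size : nat;
  step_node : nat -> R;
  step_val : nat -> L2 R }.

Definition step_on (t : R) (S : step) : Prop :=
  [/\ step_node S 0 = 0, step_node S (step_size S) = t &
      {homo step_node S : i j / (i <= j)%N >-> i <= j}].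

Definition step_fun (S : step) (r : R) : L2 R :=
  \sum_(i < step_size S)
    (\1_(`[step_node S i, step_node S i.+1[%classic) r : R) *: step_val S i.

Definition step_integral (W : R -> Omega -> R) (S : step) (w : Omega) : L2 R :=
  \sum_(i < step_size S)
    increment W (step_node S i) (step_node S i.+1) w *: step_val S i.

(* [I] is a version of the Wiener integral over [0,t] of the deterministic
   L^2(0,1)-valued integrand [Phi]: the integrals of step functions converging
   to [Phi] in L^2(0,t; L^2(0,1)) converge to [I] in L^2(Omega; L^2(0,1)).  By
   the Ito isometry [I] is determined up to a null set. *)
Definition wiener_integral (W : R -> Omega -> R) (t : R) (Phi : R -> L2 R)
    (I : Omega -> L2 R) : Prop :=
  exists S : nat -> step,
  [/\ forall k, step_on t (S k),
      (\int[@lebesgue_measure R]_(r in `[0%R, t])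
         (L2norm (Phi r - step_fun (S k) r) ^+ 2)%:E)%E @[k --> \oo]
        --> 0%E &
      ('E_P[fun w => (L2norm (I w - step_integral W (S k) w) ^+ 2)%R])%E
        @[k --> \oo] --> 0%E].

Record mild_solution (W : R -> Omega -> R) (f : nat -> R) (y0 : L2 R)
    (y : R -> Omega -> L2 R) : Prop := MildSolution {
  mild_measurable : forall t, 0 <= t ->
    measurable_fun [set: Omega] (y t : Omega -> L2borel R);
  mild_continuous :
    {ae P, forall w, {within `[0, +oo[, continuous (y ^~ w)}};
  mild_eq : forall t, 0 <= t ->
    wiener_integral W t (fun r => heat (t - r) f)
      (fun w => y t w - heat t (coef y0)) }.

Definition markov_semigroup (Y : L2 R -> R -> Omega -> L2 R)
    (t : R) (phi : L2 R -> R) (y0 : L2 R) : R :=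
  fine ('E_P[fun w => phi (Y y0 t w)])%E.

End stochastic_integral.

Definition strong_feller (R : realType) (Q : (L2 R -> R) -> L2 R -> R) : Prop :=
  forall phi : L2 R -> R,
    measurable_fun [set: L2borel R] (phi : L2borel R -> R) ->
    (exists M : R, forall u, `|phi u| <= M) ->
    continuous (Q phi).

(* Main.v *)
Require Import Defs.
From HB Require Import structures.
From mathcomp Require Import all_boot all_order all_algebra.
From mathcomp Require Import all_classical all_reals all_analysis.
From mathcomp Require Import measurable_realfun.
From mathcomp Require Import ring lra zify.

(* Fix y0, y1 in L^2(0,1). Given N, there is a deterministic control u on
   [0,T] with |u| <= K |y0 - y1|, K independent of N, which steers the first N
   modes of y0 - y1 to zero: the solution started at y0 and the one started at
   y1 and driven by dW + u dr have the same first N modes at time T. The lower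
   bound on |f_n| is absorbed by the decay of e^{-lambda_n T} because T > alpha,
   and the control is built from functions biorthogonal to the exponentials
   e^{-lambda_k (T - r)}. After approximating the stochastic integral by a
   finite sum of increments, Girsanov's theorem reduces to a shift of finitely
   many independent Gaussian variables, and bounds P(Y(y0) in O) by
   P(Y(y1) in O) plus a quantity which tends to 0 with y0 - y1, for O open. By
   outer regularity this holds for Borel sets, hence the transition
   probabilities are continuous in total variation. *)

Set Implicit Arguments.
Unset Strict Implicit.
Unset Printing Implicit Defensive.

Import Order.TTheory GRing.Theory Num.Theory.
Import numFieldNormedType.Exports.

Local Open Scope classical_set_scope.
Local Open Scope ring_scope.

(** * Polynomials biorthogonal to exponentials *)

(** Finitely many modes suffice because the laws are first compared on open sets: the modes beyond
    [N] are damped by the heat semigroup and leave an L2 error, which [shrink] absorbs. What must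
    not depend on [N] is the size of the control, through which the Girsanov cost is paid. The
    biorthogonal functions may grow like an exponential of a small multiple of lambda_n, since the
    weights decay like e^{-lambda_n (T - alpha)}. This tolerance permits an elementary construction
    with polynomials in e^{-lambda eta}. The control vanishes on the last [eps] of [0,T], because
    e^{(T - r) Delta} f may blow up as r tends to T and its series is controlled uniformly only for
    T - r >= eps. Measurability shapes the rest: distances between random elements of L2(0,1) are
    not known to be measurable. Their second moments are therefore read as lower integrals, and
    random elements occur in events only through preimages of open, closed or Borel sets, under [Y]
    or under affine maps of finitely many increments. *)

Section l1norm.
Variable R : realFieldType.
Implicit Types p q : {poly R}.

(** With ['X] read as a translation, this bounds the norm of the associated operator on bounded
    functions; it is submultiplicative, so products are estimated factor by factor. *)
Definition l1 p : R := \sum_(i < size p) `|p`_i|.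

Lemma l1E n p : (size p <= n)%N -> l1 p = \sum_(i < n) `|p`_i|.
Proof.
move=> sp; rewrite /l1 (big_ord_widen _ (fun i => `|p`_i|) sp) big_mkcond/=.
apply: eq_bigr => i _; case: ltnP => // /(nth_default 0) ->.
by rewrite normr0.
Qed.

Lemma l1_ge0 p : 0 <= l1 p.
Proof. by apply: sumr_ge0. Qed.

Lemma l1D p q : l1 (p + q) <= l1 p + l1 q.
Proof.
pose n := maxn (size p) (size q).
rewrite (@l1E n (p + q)) ?size_polyD// (@l1E n p) ?leq_maxl//.
rewrite (@l1E n q) ?leq_maxr// -big_split/=.
by apply: ler_sum => i _; rewrite coefD ler_normD.
Qed.

Lemma l1Z a p : l1 (a *: p) = `|a| * l1 p.
Proof.
rewrite (@l1E (size p)) ?size_scale_leq// /l1 mulr_sumr.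
by apply: eq_bigr => i _; rewrite coefZ normrM.
Qed.

Lemma l10 : l1 0 = 0.
Proof. by rewrite /l1 size_poly0 big_ord0. Qed.

Lemma l11 : l1 1 = 1.
Proof. by rewrite /l1 size_poly1 big_ord1 coef1 normr1. Qed.

Lemma l1N p : l1 (- p) = l1 p.
Proof. by rewrite -[- p]scaleN1r l1Z normrN1 mul1r. Qed.

Lemma l1_sum (I : Type) (r : seq I) (P : pred I) (F : I -> {poly R}) :
  l1 (\sum_(i <- r | P i) F i) <= \sum_(i <- r | P i) l1 (F i).
Proof.
elim/big_ind2 : _ => [|p a q b pa qb|//]; first by rewrite l10.
by rewrite (le_trans (l1D _ _))// lerD.
Qed.

Lemma l1_XnM n p : l1 ('X^n * p) = l1 p.
Proof.
rewrite (@l1E (n + size p)) ?big_split_ord/=; last first.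
  by rewrite (leq_trans (size_polyMleq _ _))// size_polyXn.
rewrite big1 ?add0r => [|i _]; last by rewrite coefXnM ltn_ord normr0.
by apply: eq_bigr => i _; rewrite coefXnM ltnNge leq_addr/= addKn.
Qed.

Lemma l1Xn n : l1 'X^n = 1.
Proof. by rewrite -['X^n]mulr1 l1_XnM l11. Qed.

Lemma l1M p q : l1 (p * q) <= l1 p * l1 q.
Proof.
rewrite -[in l1 (_ * _)](coefK p) poly_def mulr_suml.
rewrite (le_trans (l1_sum _ _ _))// [X in _ <= X * _]/l1 mulr_suml.
apply: ler_sum => i _.
by rewrite -scalerAl l1Z l1_XnM.
Qed.

Lemma l1_prod (I : Type) (r : seq I) (P : pred I) (F : I -> {poly R})
    (b : I -> R) : (forall i, P i -> l1 (F i) <= b i) ->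
  l1 (\prod_(i <- r | P i) F i) <= \prod_(i <- r | P i) b i.
Proof.
move=> Fb; elim: r => [|i r ih]; first by rewrite !big_nil l11.
rewrite !big_cons; case: ifPn => // Pi.
by rewrite (le_trans (l1M _ _))// ler_pM ?l1_ge0// Fb.
Qed.

(** Young's inequality for the convolution of coefficients. It lets a single box supply the
    smallness of the final coefficients. *)
Lemma ler_norm_coefM p q a i : (forall j, `|p`_j| <= a) ->
  `|(p * q)`_i| <= a * l1 q.
Proof.
move=> pa; rewrite coefMr (le_trans (ler_norm_sum _ _ _))//.
have a0 : 0 <= a by rewrite (le_trans _ (pa 0))// normr_ge0.
rewrite (@l1E (maxn i.+1 (size q)))// ?leq_maxr//.
apply: (@le_trans _ _ (\sum_(j < i.+1) a * `|q`_j|)).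
  by apply: ler_sum => j _; rewrite normrM ler_wpM2r.
rewrite -mulr_sumr ler_wpM2l//.
rewrite (big_ord_widen (maxn i.+1 (size q)) (fun j => `|q`_j|)) ?leq_maxl//.
by rewrite big_mkcond; apply: ler_sum => j _; case: ifP.
Qed.

(* With 'X read as a translation by eta, [box m] is an average over a window of
   width [m * eta] and 1 - 'X is a difference operator: each box absorbs one
   factor 1 - 'X, at the cost [2 / m]. *)
Definition box m : {poly R} := m%:R^-1 *: \sum_(l < m) 'X^l.

Lemma size_box m : (size (box m) <= m)%N.
Proof.
rewrite (leq_trans (size_scale_leq _ _))//.
apply: (leq_trans (size_sum _ _ _)); apply/bigmax_leqP => i _.
by rewrite size_polyXn.
Qed.

Lemma coef_box m i : `|(box m)`_i| <= m%:R^-1.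
Proof.
rewrite coefZ normrM ger0_norm ?invr_ge0// ler_piMr// ?invr_ge0//.
rewrite -(big_mkord predT (fun l => 'X^l : {poly R}))/= -[X in _`_X]/i.
rewrite big_mkord coef_sum.
have [im|mi] := ltnP i m.
  rewrite (bigD1 (Ordinal im))//= coefXn eqxx big1 ?addr0 ?normr1// => j.
  by rewrite coefXn -val_eqE/= eq_sym => /negbTE ->.
rewrite big1 ?normr0// => j _; rewrite coefXn gtn_eqF//.
exact: leq_trans mi.
Qed.

Lemma l1_box m : l1 (box m) <= 1.
Proof.
rewrite l1Z ger0_norm ?invr_ge0//.
case: m => [|m]; first by rewrite big_ord0 l10 mulr0.
rewrite mulrC ler_pdivrMr// mul1r (le_trans (l1_sum _ _ _))//.
rewrite (eq_bigr (fun=> 1)) => [|i _]; last by rewrite l1Xn.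
by rewrite sumr_const card_ord.
Qed.

(** The geometric sum telescopes: the product is [1 - 'X^m] divided by [m]. *)
Lemma l1_box_diff m : l1 ((1 - 'X) * box m) <= 2 / m%:R.
Proof.
have -> : (1 - 'X) * box m = m%:R^-1 *: (1 - 'X^m).
  rewrite -scalerAr; congr (_ *: _).
  by rewrite -opprB mulNr -subrX1 opprB.
rewrite l1Z ger0_norm ?invr_ge0// mulrC ler_wpM2r ?invr_ge0//.
by rewrite (le_trans (l1D _ _))// l1N l11 l1Xn.
Qed.

(** Each averaged power [x ^+ l], l < m, is at least [x ^+ m] on [0,1]. Hence a box lowers the value
    at x_n by a controlled factor only. *)
Lemma box_horner_ge m x : (0 < m)%N -> 0 <= x <= 1 -> x ^+ m <= (box m).[x].
Proof.
move=> m0 /andP[x0 x1]; rewrite hornerZ mulrC ler_pdivlMr ?ltr0n//.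
rewrite horner_sum (le_trans _ (_ : \sum_(l < m) x ^+ m <= _))//.
  by rewrite sumr_const card_ord mulr_natr.
by apply: ler_sum => l _; rewrite hornerXn ler_wiXn2l// ltnW.
Qed.

End l1norm.

(** * Coefficients of products of linear factors *)

Section coefficients.
Variable R : realType.
Implicit Types (r : seq nat) (y : nat -> R).

Lemma coef_prodD_ge0 r (P : pred nat) y i : (forall k, 0 <= y k) ->
  0 <= (\prod_(k <- r | P k) (1 + y k *: 'X))`_i.
Proof.
move=> y0; elim: r i => [|k r ih] i; first by rewrite big_nil coef1.
rewrite big_cons; case: ifP => // _.
rewrite mulrDl mul1r coefD -scalerAl coefZ mulrC coefXM.
by apply: addr_ge0 => //; apply: mulr_ge0 => //; case: ifP.
Qed.

(** Triangle inequality, factor by factor. The majorant has nonnegative coefficients, so it can be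
    estimated through its values on the positive half-line. *)
Lemma coef_prodB_le r (P : pred nat) y i : (forall k, 0 <= y k) ->
  `|(\prod_(k <- r | P k) (1 - y k *: 'X))`_i| <=
  (\prod_(k <- r | P k) (1 + y k *: 'X))`_i.
Proof.
move=> y0; elim: r i => [|k r ih] i; first by rewrite !big_nil coef1 normr_nat.
rewrite !big_cons; case: ifP => // _.
rewrite mulrBl mulrDl !mul1r coefB coefD -!scalerAl !coefZ !coefXM.
rewrite (le_trans (ler_normB _ _))// lerD// normrM ger0_norm//.
by rewrite ler_wpM2l//; case: ifP => //; rewrite normr0.
Qed.

Lemma coef_le_horner (p : {poly R}) x i : (forall j, 0 <= p`_j) -> 0 <= x ->
  p`_i * x ^+ i <= p.[x].
Proof.
move=> p0 x0; rewrite horner_coef.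
have [ip|pi] := ltnP i (size p).
  rewrite (bigD1 (Ordinal ip))//= lerDl sumr_ge0// => j _.
  by rewrite mulr_ge0// exprn_ge0.
rewrite nth_default// mul0r sumr_ge0// => j _.
by rewrite mulr_ge0// exprn_ge0.
Qed.

(** For k <= i a factor is at most 2 i^2 / k^2, whence the factorials. Beyond i, 1 + i^2 / (k + 1)^2
    <= exp (i^2 / (k (k + 1))), and the exponents telescope. *)
Lemma prod_invsq_le i M : (0 < i)%N ->
  \prod_(1 <= k < (i + M).+1) (1 + i%:R ^+ 2 / k%:R ^+ 2) <=
  2 ^+ i * (i%:R ^+ 2) ^+ i / i`!%:R ^+ 2 *
  expR (i%:R ^+ 2 * (i%:R^-1 - (i + M)%:R^-1)) :> R.
Proof.
move=> i0; elim: M => [|M ih].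
  rewrite addn0 subrr mulr0 expR0 mulr1.
  have -> : 2 ^+ i * (i%:R ^+ 2) ^+ i =
      \prod_(1 <= k < i.+1) (2 * i%:R ^+ 2) :> R.
    by rewrite prodr_const_nat subn1 -exprMn.
  rewrite fact_prod natr_prod.
  rewrite -prodrXl -prodf_div !big_nat.
  apply: ler_prod => k /andP[k1 ki].
  rewrite addr_ge0 ?divr_ge0 ?exprn_ge0//=.
  rewrite ler_pdivlMr ?exprn_gt0 ?ltr0n//.
  rewrite mulrDl mul1r divfK ?expf_neq0 ?pnatr_eq0 -?lt0n//.
  by rewrite mulr2n mulrDl !mul1r lerD2r lerXn2r ?nnegrE// ler_nat.
rewrite addnS big_nat_recr//=.
set e := expR _ in ih; set e' := expR _.
suff e'E : e' = e * (e' / e).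
  rewrite e'E [leRHS]mulrA; apply: ler_pM => //.
  - by apply: prodr_ge0 => k _; rewrite addr_ge0 ?divr_ge0 ?exprn_ge0.
  - rewrite /e' /e -expRN -expRD.
    rewrite (le_trans (expR_ge1Dx _))// ler_expR -mulrN -mulrDr.
    rewrite ler_wpM2l ?exprn_ge0//.
    set a : R := (i + M)%:R; have a0 : 0 < a by rewrite ltr0n addn_gt0 i0.
    have -> : (i + M).+1%:R = a + 1 :> R by rewrite /a natr1.
    have -> : i%:R^-1 - (a + 1)^-1 - (i%:R^-1 - a^-1) = (a * (a + 1))^-1.
      move: a a0 => a a0; field.
      by rewrite gt_eqF ?ltr_wpDr//= gt_eqF//= pnatr_eq0 -lt0n.
    by rewrite lef_pV2 ?posrE ?mulr_gt0 ?exprn_gt0// ?ltr_wpDr//; nra.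
by rewrite mulrCA divff ?mulr1// gt_eqF ?expR_gt0.
Qed.

(** Zeros 1 / y_k growing like k^2 are those of an entire function of order 1/2, whose coefficients
    decay like 1 / (i!)^2 up to geometric factors. Here the power (i^2)^i from [prod_invsq_le]
    cancels against that of the evaluation point, and the exponential is at most e^i. *)
Lemma coef_prod_invsq_le N (P : pred nat) y (c : R) i : 0 < c ->
  (forall k, 0 <= y k) -> (forall k, (1 <= k <= N)%N -> y k <= c / k%:R ^+ 2) ->
  `|(\prod_(1 <= k < N.+1 | P k) (1 - y k *: 'X))`_i| <=
  (c * (2 * expR 1)) ^+ i / i`!%:R ^+ 2.
Proof.
move=> c0 y0 yk; apply: le_trans; first exact: coef_prodB_le.
pose p : {poly R} := \prod_(1 <= k < N.+1 | P k) (1 + y k *: 'X).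
rewrite -/p.
have p0 j : 0 <= p`_j by exact: coef_prodD_ge0.
have [->|i0] := posnP i.
  rewrite expr0 expr1n divr1.
  have := @coef_le_horner p 0 0 p0 (lexx 0).
  rewrite expr0 mulr1 => /le_trans; apply.
  rewrite horner_prod big1// => k _.
  by rewrite hornerD hornerC hornerZ hornerX mulr0 addr0.
have i20 : 0 < (i%:R ^+ 2 / c) ^+ i :> R.
  by rewrite exprn_gt0// divr_gt0// exprn_gt0// ltr0n.
rewrite -(ler_pM2r i20); apply: (le_trans (coef_le_horner i p0 _)).
  by rewrite divr_ge0 ?exprn_ge0// ltW.
rewrite horner_prod.
(* The coefficients are nonnegative; evaluate at i^2 / c. *)
apply: (@le_trans _ _ (\prod_(1 <= k < (i + N).+1) (1 + i%:R ^+ 2 / k%:R ^+ 2))).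
  rewrite (@big_cat_nat _ _ _ N.+1 1 (i + N).+1)//=; last by rewrite ltnS leq_addl.
  rewrite -[leLHS]mulr1 ler_pM//.
  - apply: prodr_ge0 => k _.
    by rewrite hornerD hornerC hornerZ hornerX addr_ge0// mulr_ge0// divr_ge0 ?exprn_ge0// ltW.
  - rewrite big_mkcond/= !big_nat; apply: ler_prod => k kN.
    have ? : 0 <= i%:R ^+ 2 / k%:R ^+ 2 :> R by rewrite divr_ge0 ?exprn_ge0.
    case: ifP => _; last by rewrite ler01/= lerDl.
    rewrite hornerD hornerC hornerZ hornerX addr_ge0 ?mulr_ge0 ?divr_ge0 ?exprn_ge0 ?invr_ge0 ?(ltW c0)//=.
    by rewrite lerD2l mulrC -mulrA ler_wpM2l ?exprn_ge0// mulrC -ler_pdivlMr ?invr_gt0// invrK mulrC yk.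
  - elim/big_ind : _ => // [a b a1 b1|k _].
      by rewrite -[leLHS]mulr1 ler_pM.
    by rewrite lerDl divr_ge0 ?exprn_ge0.
apply: (le_trans (prod_invsq_le _ i0)).
rewrite [leRHS](_ : _ = 2 ^+ i * (i%:R ^+ 2) ^+ i / i`!%:R ^+ 2 * expR i%:R).
  2: rewrite (_ : expR i%:R = expR 1 ^+ i); last by rewrite -expRM_natl mulr1.
  2: rewrite !exprMn exprVn; have : c ^+ i != 0 by rewrite expf_neq0// gt_eqF.
  2: have : i`!%:R != 0 :> R by rewrite pnatr_eq0 -lt0n fact_gt0.
  2: move: (_`!%:R) (c ^+ i) => u v u0 v0; by field; rewrite u0 v0.
rewrite ler_wpM2l ?divr_ge0 ?mulr_ge0 ?exprn_ge0//.
rewrite ler_expR mulrBr expr2 -mulrA divff ?mulr1 ?pnatr_eq0 -?lt0n//.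
by rewrite lerBlDr lerDl !mulr_ge0// invr_ge0.
Qed.

End coefficients.

(** * The finite products of |1 - n^2 / k^2| *)

Section squares_product.
Variable R : realFieldType.

Let normB1_sqr (n k : nat) : (0 < k)%N ->
  `|1 - n%:R ^+ 2 / k%:R ^+ 2 : R| * k%:R ^+ 2 = `|k%:R ^+ 2 - n%:R ^+ 2|.
Proof.
move=> k0; rewrite -[X in _ * X]ger0_norm ?exprn_ge0// -normrM mulrBl mul1r.
by rewrite divfK// expf_neq0// pnatr_eq0 -lt0n.
Qed.

(** Factor k^2 - n^2 as (k - n) (k + n) and collect the factorials; denominators are cleared to suit
    the induction on [j]. *)
Lemma prod_sqr_dist_lt n j : (j < n)%N ->
  \prod_(1 <= k < j.+1) `|1 - n%:R ^+ 2 / k%:R ^+ 2 : R| *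
    (j`!%:R ^+ 2 * (n.-1 - j)`!%:R * n`!%:R) = (n.-1)`!%:R * (n + j)`!%:R.
Proof.
elim: j => [|j ih] jn.
  by rewrite big_geq// mul1r fact0 expr1n mul1r subn0 addn0.
rewrite big_nat_recr//= addnS; have := ih (ltnW jn).
have [m ->] : exists m, n = (m + j.+2)%N by exists (n - j.+2)%N; rewrite subnK.
have -> : ((m + j.+2).-1 - j = m.+1)%N by lia.
have -> : ((m + j.+2).-1 - j.+1 = m)%N by lia.
set p := \prod_(_ <= _ < _) _.
rewrite !(factS j) !(factS m) !(factS (_ + j)) !natrM => e.
have := normB1_sqr (m + j.+2) (ltn0Sn j).
set u := `|1 - _|.
have -> : `|j.+1%:R ^+ 2 - (m + j.+2)%:R ^+ 2| =
    m.+1%:R * (m + j.+2 + j).+1%:R :> R.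
  rewrite distrC ger0_norm; first by rewrite subr_sqr -natrD -natrB; [|lia];
    congr (_%:R * _%:R); lia.
  by rewrite subr_ge0 lerXn2r ?nnegrE// ler_nat; lia.
move=> eu.
have m0 : m.+1%:R != 0 :> R by rewrite pnatr_eq0.
apply: (mulfI m0).
transitivity ((u * j.+1%:R ^+ 2) * (p * (j`!%:R ^+ 2 * (m.+1%:R * m`!%:R) *
    (m + j.+2)`!%:R))).
  by ring.
by rewrite eu e; ring.
Qed.

(** The factors k < n come from [prod_sqr_dist_lt] at j = n - 1, those with k > n are added one at a
    time. Since M! (2n + M)! / (n + M)!^2 tends to 1, the product tends to 1/2. *)
Lemma prod_sqr_dist n M : (0 < n)%N ->
  \prod_(1 <= k < (n + M).+1 | k != n) `|1 - n%:R ^+ 2 / k%:R ^+ 2 : R| *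
    (2 * (n + M)`!%:R ^+ 2) = M`!%:R * (n + n + M)`!%:R.
Proof.
move=> n0; elim: M => [|M ih].
  rewrite !addn0 big_mkcond/= big_nat_recr//= eqxx/= mulr1 -big_mkcond/=.
  have := @prod_sqr_dist_lt n n.-1.
  rewrite prednK// leqnn subnn fact0 mulr1 => /(_ isT).
  rewrite big_nat_cond [in X in _ -> X]big_nat_cond.
  rewrite (eq_bigl (fun k => (1 <= k < n)%N && (k != n))); last first.
    by move=> k; rewrite andbT; case: (ltngtP k n) => _; rewrite ?andbF ?andbT.
  case: n n0 => // n _ /=; set p := \prod_(_ <- _ | _) _.
  rewrite addnS addSn !factS !natrM => e.
  have n0 : n`!%:R != 0 :> R by rewrite pnatr_eq0 -lt0n fact_gt0.
  apply: (mulfI n0).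
  transitivity (2 * n.+1%:R * (p * (n`!%:R ^+ 2 * (n.+1%:R * n`!%:R)))); first by ring.
  rewrite e (_ : (n + n).+2%:R = 2 * n.+1%:R :> R); first by ring.
  by rewrite -natrM; congr _%:R; lia.
have /= := ih; rewrite !addnS => e.
rewrite big_mkcond/= big_nat_recr//= -big_mkcond/= gtn_eqF//=; last by lia.
set p := \prod_(_ <= _ < _ | _) _ in e *.
rewrite !factS !natrM.
have := normB1_sqr n (ltn0Sn (n + M)).
set u := `|1 - _|.
have -> : `|(n + M).+1%:R ^+ 2 - n%:R ^+ 2| = M.+1%:R * (n + n + M).+1%:R :> R.
  rewrite ger0_norm; first by rewrite subr_sqr -natrD -natrB; [|lia];
    congr (_%:R * _%:R); lia.
  by rewrite subr_ge0 lerXn2r ?nnegrE// ler_nat; lia.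
move=> eu.
transitivity ((u * (n + M).+1%:R ^+ 2) * (p * (2 * (n + M)`!%:R ^+ 2))).
  by ring.
by rewrite eu e; ring.
Qed.

(** Log-convexity of the factorial: [n + M] is the midpoint of [M] and [n + n + M]. *)
Lemma fact_sqr_le n M : ((n + M)`! ^ 2 <= M`! * (n + n + M)`!)%N.
Proof.
elim: n => [|n ih]; first by rewrite !add0n mulnn.
have -> : (n.+1 + n.+1 + M = (n + n + M).+2)%N by lia.
rewrite addSn !factS expnMn.
apply: leq_trans (leq_mul (leqnn _) ih) _.
rewrite !mulnA [leqRHS](_ : _ = (n + n + M).+2 * (n + n + M).+1 * (M`! * (n + n + M)`!))%N;
  last by ring.
by rewrite -!mulnA leq_mul// ?leq_mul//; lia.
Qed.

Lemma prod_sqr_dist_ge N n : (1 <= n <= N)%N ->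
  2^-1 <= \prod_(1 <= k < N.+1 | k != n) `|1 - n%:R ^+ 2 / k%:R ^+ 2 : R|.
Proof.
move=> /andP[n0 nN]; rewrite -(subnKC nN).
set M := (N - n)%N; have := prod_sqr_dist M n0; set p := \prod_(_ <= _ < _ | _) _.
have := fact_sqr_le n M; rewrite -(ler_nat R) natrX natrM => le e.
have F0 : 0 < (n + M)`!%:R ^+ 2 :> R by rewrite exprn_gt0// ltr0n fact_gt0.
by rewrite -(ler_pM2r (mulr_gt0 (ltr0n R 2) F0)) e mulrA mulVf ?mul1r.
Qed.

End squares_product.

(** * Limit of a vanishing step *)

Section small_step.
Variable R : realType.

Lemma cvg_prod (T : Type) (F : set_system T) {FF : Filter F} (I : Type)
    (r : seq I) (P : pred I) (f : I -> T -> R) (l : I -> R) :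
  (forall i, P i -> f i @ F --> l i) ->
  (fun t => \prod_(i <- r | P i) f i t) @ F --> \prod_(i <- r | P i) l i.
Proof.
move=> fl; elim: r => [|i r ih].
  by rewrite big_nil; under eq_fun do rewrite big_nil; exact: cvg_cst.
rewrite big_cons; under eq_fun do rewrite big_cons.
by case: ifPn => // Pi; apply: cvgM => //; exact: fl.
Qed.

Lemma onem_expRN_bounds (x : R) : 0 <= x -> x / (1 + x) <= 1 - expR (- x) <= x.
Proof.
move=> x0; have x1 : 0 < 1 + x by rewrite ltr_wpDr.
have -> : x / (1 + x) = 1 - (1 + x)^-1 by field; rewrite gt_eqF.
rewrite lerD2l lerN2 expRN lef_pV2 ?posrE ?expR_gt0// expR_ge1Dx/=.
by rewrite -expRN lerBlDr -lerBlDl expR_ge1Dx.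
Qed.

Lemma cvg_onem_expRN (a : R) : 0 < a ->
  (fun t => (1 - expR (- (a * t))) / t) @ 0^'+ --> a.
Proof.
move=> a0; apply: (@squeeze_cvgr _ _ _ _ (fun t => a / (1 + a * t)) (cst a)).
- near=> t; have t0 : 0 < t by near: t; exact: nbhs_right_gt.
  have at0 : 0 <= a * t by rewrite mulr_ge0 ?ltW.
  have /andP[h1 h2] := onem_expRN_bounds at0.
  rewrite ler_pdivlMr// ler_pdivrMr// mulrAC h2 h1//.
- rewrite -[X in _ --> X](_ : a / (1 + a * 0) = a); last by rewrite mulr0 addr0 divr1.
  apply: cvg_at_right_filter; apply: cvgM; first exact: cvg_cst.
  apply: cvgV; first by rewrite mulr0 addr0 oner_eq0.
  by apply: cvgD; [exact: cvg_cst|apply: cvgM; [exact: cvg_cst|exact: cvg_id]].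
- exact: cvg_cst.
Unshelve. all: by end_near. Qed.

Lemma eigenval_gt0 n : (0 < n)%N -> 0 < eigenval R n.
Proof. by move=> n0; rewrite mulr_gt0// exprn_gt0 ?pi_gt0 ?ltr0n. Qed.

Lemma eigenval_ge0 n : 0 <= eigenval R n.
Proof. by rewrite mulr_ge0// exprn_ge0// pi_ge0. Qed.

Lemma eigenval_ge n : n%:R ^+ 2 *+ 2 <= eigenval R n.
Proof.
rewrite /eigenval -mulr_natl ler_wpM2r ?exprn_ge0//.
have := @pi_ge2 R; nra.
Qed.

(** As t tends to 0 the quotient tends to lambda_n / lambda_k = n^2 / k^2, so the product tends to
    one that is at least 1/2; the value 1/4 leaves room for the limit. The admissible [t] depend on
    [N] and [n], as the step [eta] may. *)
Lemma near_prod_onem_ge N n : (1 <= n <= N)%N ->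
  \forall t \near (0 : R)^'+, 4^-1 <=
    \prod_(1 <= k < N.+1 | k != n)
      `|1 - (1 - expR (- (eigenval R n * t))) / (1 - expR (- (eigenval R k * t)))|.
Proof.
move=> nN; have n0 : (0 < n)%N by case/andP: nN.
(* The dummy value at k = 0, where the eigenvalue is 0, lets the convergence be stated for every k
   != n. *)
pose f k t : R := if (0 < k)%N then
  `|1 - (1 - expR (- (eigenval R n * t))) / t / ((1 - expR (- (eigenval R k * t))) / t)|
  else 1.
pose l k : R := if (0 < k)%N then `|1 - eigenval R n / eigenval R k| else 1.
have fl k : k != n -> f k @ 0^'+ --> l k.
  move=> _; rewrite /f /l; have [_|k0] := posnP k; first exact: cvg_cst.
  apply: cvg_norm; apply: cvgB; first exact: cvg_cst.
  apply: cvgM; first by apply: cvg_onem_expRN; exact: eigenval_gt0.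
  apply: cvgV; first by rewrite gt_eqF// eigenval_gt0.
  by apply: cvg_onem_expRN; exact: eigenval_gt0.
pose L := \prod_(1 <= k < N.+1 | k != n) l k.
have cL : (fun t => \prod_(1 <= k < N.+1 | k != n) f k t) @ 0^'+ --> L.
  exact: cvg_prod.
have L4 : 4^-1 < L.
  apply: (@lt_le_trans _ _ 2^-1); first by rewrite ltf_pV2 ?posrE// ltr_nat.
  apply: (le_trans (prod_sqr_dist_ge R nN)); rewrite /L big_nat_cond [leRHS]big_nat_cond.
  rewrite le_eqVlt; apply/orP; left; apply/eqP; apply: eq_bigr => k /andP[/andP[k1 _] _].
  rewrite /l k1; congr (`|1 - _|).
  rewrite /eigenval -[in RHS]mulf_div divff ?mul1r//.
  by rewrite expf_neq0// gt_eqF// pi_gt0.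
near=> t; have t0 : 0 < t by near: t; exact: nbhs_right_gt.
apply: (@le_trans _ _ (\prod_(1 <= k < N.+1 | k != n) f k t)).
  by apply: ltW; near: t; exact: (cvgr_gt _ cL).
rewrite big_nat_cond [leRHS]big_nat_cond; rewrite le_eqVlt; apply/orP; left; apply/eqP; apply: eq_bigr => k /andP[/andP[k1 _] _]; rewrite /f k1.
congr (`|1 - _|); rewrite invfM mulrACA divff ?mulr1//.
by rewrite invr_neq0// gt_eqF.
Unshelve. all: by end_near. Qed.

End small_step.

Section biorthogonal.
Variable R : realType.

(** The subtracted term closes the induction, because n^{-3/2} <= 4 (n^{-1/2} - (n + 1)^{-1/2}). *)
Lemma sum_inv_sqrt3_le N :
  \sum_(j < N) (j.+1%:R * Num.sqrt j.+1%:R)^-1 <= 4 - 4 / Num.sqrt N.+1%:R :> R.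
Proof.
elim: N => [|N ih]; first by rewrite big_ord0 sqrtr1 divr1 subrr.
rewrite big_ord_recr/=.
have a20 : 0 < Num.sqrt N.+1%:R :> R by rewrite sqrtr_gt0 ltr0n.
have b20 : 0 < Num.sqrt N.+2%:R :> R by rewrite sqrtr_gt0 ltr0n.
have a2 : Num.sqrt N.+1%:R ^+ 2 = N.+1%:R :> R by rewrite sqr_sqrtr.
have b2 : Num.sqrt N.+2%:R ^+ 2 = N.+1%:R + 1 :> R.
  by rewrite sqr_sqrtr// natr1.
have N1 : 1 <= N.+1%:R :> R by rewrite ler1n.
rewrite -{1}a2; move: a20 b20 a2 b2 N1 ih.
set a := Num.sqrt N.+1%:R; set b := Num.sqrt N.+2%:R; set n := N.+1%:R.
move: (\sum_(_ < _) _) a b n => S a b n a0 b0 a2 b2 n1 ih.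
rewrite (le_trans (lerD ih (lexx _)))//.
have ab : a <= b by rewrite leNgt; apply/negP => ba; nra.
have -> : 4 - 4 / b = 4 - 4 / a + 4 * (b - a) / (a * b).
  by field; rewrite !gt_eqF.
rewrite lerD2l ler_pdivlMr ?mulr_gt0// mulrC ler_pdivrMr ?mulr_gt0 ?exprn_gt0//.
have abE : (b - a) * (b + a) = 1 by rewrite -subr_sqr a2 b2; ring.
have -> : 4 * (b - a) * (a ^+ 2 * a) = (b - a) * (4 * a ^+ 2) * a by ring.
rewrite [leLHS]mulrC ler_wpM2r ?(ltW a0)//.
apply: (@le_trans _ _ ((b - a) * ((b + a) * b))); first by rewrite mulrA abE mul1r.
by rewrite ler_wpM2l ?subr_ge0//; nra.
Qed.

(** Write c^i / sqrt (i!) as 2^{-i} (2c)^i / sqrt (i!). The square of (2c)^i / sqrt (i!) is (4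
    c^2)^i / i!, a term of the exponential series. *)
Lemma expr_div_sqrt_fact_le (c : R) N : 0 <= c ->
  \sum_(i < N) c ^+ i / Num.sqrt i`!%:R <= 2 * Num.sqrt (expR (4 * c ^+ 2)).
Proof.
move=> c0.
have S2 : \sum_(i < N) 2^-1 ^+ i <= 2 :> R.
  have : (1 - 2^-1) * \sum_(i < N) 2^-1 ^+ i = 1 - 2^-1 ^+ N :> R.
    by rewrite -opprB mulNr -subrX1 opprB.
  have : 0 <= 2^-1 ^+ N :> R by rewrite exprn_ge0.
  lra.
apply: (@le_trans _ _ (\sum_(i < N) 2^-1 ^+ i * Num.sqrt (expR (4 * c ^+ 2)))).
  apply: ler_sum => i _.
  have i0 : 0 < i`!%:R :> R by rewrite ltr0n fact_gt0.
  have e0 := expR_ge0 (4 * c ^+ 2).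
  have -> : c ^+ i / Num.sqrt i`!%:R = 2^-1 ^+ i * ((2 * c) ^+ i / Num.sqrt i`!%:R).
    by rewrite mulrA -exprMn mulrA mulVf ?mul1r ?pnatr_eq0.
  rewrite ler_wpM2l ?exprn_ge0// ler_pdivrMr ?sqrtr_gt0// -sqrtrM//.
  rewrite -[leLHS]ger0_norm ?exprn_ge0 ?mulr_ge0// -sqrtr_sqr ler_wsqrtr//.
  rewrite -exprM mulnC exprM (_ : (2 * c) ^+ 2 = 4 * c ^+ 2); last by ring.
  rewrite -ler_pdivrMr//.
  have [->|] := posnP i.
    by rewrite expr0 fact0 divr1 -expR0 ler_expR mulr_ge0// exprn_ge0.
  case: (nat_of_ord i) => // n _.
  have c20 : 0 <= 4 * c ^+ 2 by rewrite mulr_ge0// exprn_ge0.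
  by apply: le_trans (expR_ge1Dxn n c20); rewrite lerDr.
by rewrite -mulr_suml ler_wpM2r// sqrtr_ge0.
Qed.

Lemma size_prod_pred (I : Type) (r : seq I) (P : pred I) (F : I -> {poly R}) :
  ((size (\prod_(i <- r | P i) F i)%R).-1 <= \sum_(i <- r | P i) (size (F i)).-1)%N.
Proof.
elim/big_ind2 : _ => [|p m q n pm qn|//]; first by rewrite size_poly1.
have := size_polyMleq m n; lia.
Qed.

(** The power (1 - 'X)^i is paired with the first i boxes, at cost 2 / m_j each; the remaining boxes
    have norm at most 1. There are [N] boxes, enough for the degree of [c]. *)
Lemma l1_comp_box_le (c : {poly R}) (m : nat -> nat) (g : nat -> R) N :
  (size c <= N.+1)%N -> (forall i, `|c`_i| <= g i) ->
  l1 ((c \Po (1 - 'X)) * \prod_(j < N) box R (m j)) <=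
  \sum_(i < N.+1) g i * \prod_(j < i) (2 / (m j)%:R).
Proof.
move=> cN cg; rewrite comp_polyE mulr_suml (le_trans (l1_sum _ _ _))//.
have g0 i : 0 <= g i by rewrite (le_trans _ (cg i)).
have bg0 i : 0 <= g i * \prod_(j < i) (2 / (m j)%:R).
  by rewrite mulr_ge0// prodr_ge0.
apply: (@le_trans _ _ (\sum_(i < size c) g i * \prod_(j < i) (2 / (m j)%:R))).
  apply: ler_sum => i _; rewrite -scalerAl l1Z ler_pM ?l1_ge0//.
  have iN : (i <= N)%N by rewrite -ltnS (leq_trans _ cN).
  rewrite -(big_mkord predT (fun j => box R (m j))) (@big_cat_nat _ _ _ i)//=.
  rewrite mulrA big_mkord.
  have -> : (1 - 'X) ^+ i = \prod_(j < i) (1 - 'X) :> {poly R}.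
    by rewrite prodr_const card_ord.
  rewrite -big_split/= (le_trans (l1M _ _))// -[leRHS]mulr1.
  apply: ler_pM; rewrite ?l1_ge0//.
    by apply: l1_prod => j _; exact: l1_box_diff.
  rewrite [leRHS](_ : 1 = \prod_(i <= j < N) 1); last by rewrite big1.
  by apply: l1_prod => j _; exact: l1_box.
rewrite (big_ord_widen N.+1 (fun i => g i * \prod_(j < i) (2 / (m j)%:R)))//.
by rewrite big_mkcond; apply: ler_sum => i _; case: ifP.
Qed.

End biorthogonal.

Section biorthogonal_poly.
Variable R : realType.

Lemma box_prod_horner_ge (m : nat -> nat) N (x : R) :
  (forall j, (j < N)%N -> (0 < m j)%N) -> 0 <= x <= 1 ->
  x ^+ (\sum_(j < N) m j) <= (\prod_(j < N) box R (m j)).[x].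
Proof.
move=> m0 x01; rewrite horner_prod -prodrXr; apply: ler_prod => j _.
by rewrite exprn_ge0 ?box_horner_ge ?m0//; case/andP: x01.
Qed.

Lemma sum_truncn_le (d : nat -> R) eta N : 0 < eta -> (forall j, 0 <= d j) ->
  (\sum_(j < N) Num.truncn (d j / eta))%N%:R * eta <= \sum_(j < N) d j.
Proof.
move=> eta0 d0; rewrite natr_sum mulr_suml; apply: ler_sum => j _.
by rewrite -ler_pdivlMr// truncn_le divr_ge0// ltW.
Qed.

Lemma truncn_ge_half (x : R) : 1 <= x ->
  (0 < Num.truncn x)%N /\ x <= 2 * (Num.truncn x)%:R.
Proof.
move=> x1; have /andP[_ xt] := truncn_itv (le_trans ler01 x1).
have t1 : (0 < Num.truncn x)%N by rewrite truncn_ge_nat// (le_trans ler01).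
split=> //; apply: (le_trans (ltW xt)).
by rewrite -natrM ler_nat; lia.
Qed.

Lemma size_prod_linear (P : pred nat) (y : nat -> R) N :
  (size (\prod_(1 <= k < N.+1 | P k) (1 - y k *: 'X) : {poly R})%R <= N.+1)%N.
Proof.
have leq_pred1 (a b : nat) : (a.-1 <= b)%N = (a <= b.+1)%N by case: a.
rewrite -leq_pred1.
apply: leq_trans (size_prod_pred _ _ _) _.
apply: (@leq_trans (\sum_(1 <= k < N.+1 | P k) 1)).
  apply: leq_sum => k _; rewrite leq_pred1 (leq_trans (size_polyD _ _))//.
  rewrite geq_max size_poly1 size_polyN/=.
  by rewrite (leq_trans (size_scale_leq _ _))// size_polyX.
by rewrite sum1_count (leq_trans (count_size _ _))// size_iota subn1.
Qed.

Let size_arith (b c s t u m N S : nat) : (b.-1 + N <= S)%N -> (c <= N.+1)%N ->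
  (s <= m)%N -> (t <= (c + b).-1)%N -> (u <= (s + t).-1)%N -> (0 < m)%N ->
  (u <= m + S)%N.
Proof. lia. Qed.

(* Let x_k = exp (- lambda_k eta). The polynomial is a multiple of the product
   over k != n of 1 - (1 - 'X) / (1 - x_k), which vanishes at these x_k, times
   boxes. The coefficient of (1 - 'X)^i in the first product is at most
   (A / eta)^i / (i!)^2, which the boxes of width d_j ~ tau / j^(3/2) turn into
   the summable A'^i / sqrt (i!); the widths themselves add up to O(tau). The
   value at x_n is bounded below because the product over k != n of
   |1 - n^2 / k^2|, the limit as eta -> 0, is at least 1/2. *)
Lemma biorthogonal_poly_exists (tau : R) : 0 < tau -> exists2 K, 0 < K &
  forall N n, (1 <= n <= N)%N -> exists (eta : R) (p : {poly R}),
  [/\ 0 < eta <= tau, (size p)%:R * eta <= tau,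
      forall k, (1 <= k <= N)%N -> p.[expR (- (eigenval R k * eta))] = (k == n)%:R &
      forall l, `|p`_l| <= eta * (K * expR (eigenval R n * tau))].
Proof.
move=> tau0.
(* The bound (2 e / eta)^i / (i!)^2 on the coefficients of [c] meets the product of the 4 eta / d_j,
   which is (32 eta / tau)^i (i!)^{3/2}: [eta] cancels and this constant remains. *)
pose c0 : R := 32 / tau * (2 * expR 1).
pose K0 : R := 2 * Num.sqrt (expR (4 * c0 ^+ 2)).
have K00 : 0 < K0 by rewrite mulr_gt0// sqrtr_gt0 expR_gt0.
(* A factor 4 from the lower bound 1/4 at x_n, a factor 4 / tau from the wide box [ms], and [K0]
   from the [l1] norm of the rest. *)
exists (16 * K0 / tau).
  by rewrite divr_gt0// mulr_gt0.
move=> N n nN.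
have n0 : (0 < n)%N by case/andP: nN.
(* By [sum_inv_sqrt3_le] these widths add up to at most tau / 2; the other half of tau is spent on
   the box [ms]. *)
pose d j : R := tau / 8 / (j.+1%:R * Num.sqrt j.+1%:R).
have sq0 j : 0 < Num.sqrt j.+1%:R :> R by rewrite sqrtr_gt0 ltr0n.
have d0 j : 0 < d j by rewrite !divr_gt0// mulr_gt0.
have d_decr j : (j <= N)%N -> d N <= d j.
  move=> jN; rewrite ler_wpM2l ?divr_ge0 ?(ltW tau0)// lef_pV2 ?posrE ?mulr_gt0//.
  by rewrite ler_pM ?sqrtr_ge0 ?ler0n// ?ler_wsqrtr// ler_nat ltnS.
have lN0 : 0 < eigenval R N by apply: eigenval_gt0; lia.
(* [eta <= d N] keeps every box nonempty, and [eigenval R N * eta <= 1] serves in [y_le] below. *)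
have [eta [eta0 etatau etad etal prod4]] : exists eta : R, [/\ 0 < eta,
    eta <= tau / 2, eta <= d N, eigenval R N * eta <= 1 &
    4^-1 <= \prod_(1 <= k < N.+1 | k != n) `|1 - (1 - expR (- (eigenval R n * eta))) /
        (1 - expR (- (eigenval R k * eta)))|].
  near (0 : R)^'+ => eta.
  exists eta; split.
  - by near: eta; exact: nbhs_right_gt.
  - by near: eta; apply: nbhs_right_le; rewrite divr_gt0.
  - by near: eta; exact: nbhs_right_le.
  - rewrite mulrC -ler_pdivlMr//; near: eta; apply: nbhs_right_le.
    by rewrite divr_gt0.
  - by near: eta; exact: near_prod_onem_ge.
pose m j := Num.truncn (d j / eta).
(* One more box, of width about tau / 2 whatever [N] is: its coefficients are O(eta / tau), which
   gives the factor [eta] in the final bound. *)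
pose ms := Num.truncn (tau / 2 / eta).
have d1 j : (j <= N)%N -> 1 <= d j / eta.
  by move=> jN; rewrite ler_pdivlMr// mul1r (le_trans etad)// d_decr.
have m_gt0 j : (j <= N)%N -> (0 < m j)%N.
  by move=> jN; have [] := truncn_ge_half (d1 _ jN).
have m_ge j : (j <= N)%N -> 2 / (m j)%:R <= 4 * eta / d j.
  move=> jN; have [mj0 dm] := truncn_ge_half (d1 _ jN).
  rewrite ler_pdivrMr ?ltr0n// mulrAC ler_pdivlMr//.
  by move: dm; rewrite ler_pdivrMr//; rewrite -/(m j); nra.
have ms1 : 1 <= tau / 2 / eta by rewrite ler_pdivlMr// mul1r.
have [ms0 msge] := truncn_ge_half ms1; rewrite -/ms in ms0 msge.
pose x k := expR (- (eigenval R k * eta)).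
have x01 k : 0 <= x k <= 1.
  rewrite expR_ge0 expR_le1 oppr_le0 mulr_ge0 ?(ltW eta0)//.
  exact: eigenval_ge0.
pose y k := (1 - x k)^-1.
have y0 k : 0 <= y k by rewrite invr_ge0 subr_ge0; case/andP: (x01 k).
have x1 k : (0 < k)%N -> 0 < 1 - x k.
  by move=> k0; rewrite subr_gt0 expR_lt1 oppr_lt0 mulr_gt0// eigenval_gt0.
(* 1 - e^{-z} >= z / (1 + z) >= z / 2 for 0 <= z <= 1, and lambda_k >= 2 k^2. *)
have y_le k : (1 <= k <= N)%N -> y k <= eta^-1 / k%:R ^+ 2.
  move=> /andP[k1 kN]; rewrite -invfM lef_pV2 ?posrE ?x1 ?mulr_gt0 ?exprn_gt0 ?ltr0n//.
  have l0 := eigenval_gt0 R k1.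
  have le1 : eigenval R k * eta <= 1.
    apply: le_trans etal; rewrite ler_wpM2r ?(ltW eta0)// ler_wpM2l ?exprn_ge0 ?pi_ge0//.
    by rewrite lerXn2r ?nnegrE// ler_nat.
  have le0 : 0 <= eigenval R k * eta by rewrite mulr_ge0 ?ltW.
  have /andP[h _] := onem_expRN_bounds le0.
  apply: le_trans h; rewrite ler_pdivlMr ?ltr_wpDr//.
  have := eigenval_ge R k; rewrite mulr2n => h.
  have q0 : 0 <= eta * k%:R ^+ 2 by rewrite mulr_ge0 ?exprn_ge0// ltW.
  apply: (@le_trans _ _ (eta * k%:R ^+ 2 * 2)).
    by rewrite ler_wpM2l//; lra.
  by rewrite -mulrA [leRHS]mulrC ler_wpM2l ?(ltW eta0)//; lra.
pose c : {poly R} := \prod_(1 <= k < N.+1 | k != n) (1 - y k *: 'X).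
have szc : (size c <= N.+1)%N.
  exact: size_prod_linear.
pose g i := (eta^-1 * (2 * expR 1)) ^+ i / i`!%:R ^+ 2 : R.
have cg i : `|c`_i| <= g i.
  by apply: coef_prod_invsq_le => //; rewrite invr_gt0.
pose B : {poly R} := \prod_(j < N) box R (m j).
pose Q : {poly R} := (c \Po (1 - 'X)) * B.
have l1Q : l1 Q <= K0.
  apply: (le_trans (l1_comp_box_le m szc cg)).
  apply: le_trans (expr_div_sqrt_fact_le N.+1 _); last first.
    by rewrite !mulr_ge0 ?expR_ge0// invr_ge0 ltW.
  apply: ler_sum => i _; have iN : (i <= N)%N by rewrite -ltnS.
  apply: (@le_trans _ _ (g i * \prod_(j < i) (4 * eta / d j))).
    rewrite ler_wpM2l ?(le_trans _ (cg i))//.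
    apply: ler_prod => j _; rewrite divr_ge0//= m_ge//.
    by rewrite (leq_trans _ iN)// ltnW.
  have -> : \prod_(j < i) (4 * eta / d j) =
      (32 / tau * eta) ^+ i * (i`!%:R * Num.sqrt i`!%:R).
    rewrite (eq_bigr (fun j : 'I_i => (32 / tau * eta) * (j.+1%:R * Num.sqrt j.+1%:R))).
      rewrite big_split/= prodr_const card_ord big_split/=; congr (_ * (_ * _)).
        by rewrite fact_prod big_add1/= big_mkord natr_prod.
      elim: (nat_of_ord i) => [|k ih]; first by rewrite big_ord0 sqrtr1.
      by rewrite big_ord_recr/= ih factS natrM mulrC sqrtrM.
    move=> j _; rewrite /d; field.
    by rewrite !gt_eqF// ?sqrtr_gt0 ltr0n.
  rewrite /g /c0.
  have f0 : 0 < i`!%:R :> R by rewrite ltr0n fact_gt0.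
  have s0 : 0 < Num.sqrt i`!%:R :> R by rewrite sqrtr_gt0.
  have s2 : Num.sqrt i`!%:R ^+ 2 = i`!%:R :> R by rewrite sqr_sqrtr ?ltW.
  have -> : 32 / tau * (2 * expR 1) = (eta^-1 * (2 * expR 1)) * (32 / tau * eta).
    by field; rewrite !gt_eqF.
  rewrite [in leRHS]exprMn.
  move: s2 s0; set w := Num.sqrt _ => <- w0.
  move: (_ ^+ i) (_ ^+ i) => u v.
  by rewrite le_eqVlt; apply/orP; left; apply/eqP; field; rewrite gt_eqF.
have xn01 := x01 n.
have VB : x n ^+ (\sum_(j < N) m j) <= B.[x n].
  by apply: box_prod_horner_ge => // j jN; rewrite m_gt0// ltnW.
have Vms : x n ^+ ms <= (box R ms).[x n] by exact: box_horner_ge.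
pose M := (ms + \sum_(j < N) m j)%N.
have Meta : M%:R * eta <= tau.
  rewrite natrD mulrDl [leRHS](splitr tau) lerD//.
    by rewrite -ler_pdivlMr// truncn_le divr_ge0// ?divr_ge0 ?ltW.
  rewrite (le_trans (sum_truncn_le _ eta0 _))//; first by move=> j; rewrite ltW.
  rewrite -mulr_sumr.
  apply: (@le_trans _ _ (tau / 8 * 4)); last by lra.
  rewrite ler_wpM2l ?divr_ge0 ?(ltW tau0)// (le_trans (sum_inv_sqrt3_le _ _))//.
  by rewrite gerBl divr_ge0 ?sqrtr_ge0.
have cv k : (c \Po (1 - 'X)).[x k] =
    \prod_(1 <= j < N.+1 | j != n) (1 - (1 - x k) / (1 - x j)).
  rewrite horner_comp horner_prod; apply: eq_bigr => j _.
  by rewrite !hornerE mulrC.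
pose V := ((box R ms) * Q).[x n].
have VE : V = (box R ms).[x n] * ((c \Po (1 - 'X)).[x n] * B.[x n]).
  by rewrite /V !hornerM.
have V_ge : 4^-1 * expR (- (eigenval R n * tau)) <= `|V|.
  rewrite VE !normrM cv mulrCA normr_prod ler_pM ?expR_ge0//.
  rewrite -normrM.
  apply: (@le_trans _ _ (x n ^+ M)).
    rewrite -expRM_natl ler_expR mulrN lerN2 mulrCA ler_wpM2l//.
    exact: eigenval_ge0.
  rewrite (le_trans _ (ler_norm _))// exprD ler_pM// exprn_ge0//.
    by case/andP: xn01.
  by case/andP: xn01.
have V0 : 0 < `|V|.
  by apply: lt_le_trans V_ge; rewrite mulr_gt0 ?expR_gt0.
exists eta, (V^-1 *: (box R ms * Q)); split.
- by rewrite eta0 (le_trans etatau)// ger_pMr// invf_le1// ler1n.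
- apply: le_trans Meta; rewrite ler_wpM2r ?(ltW eta0)// ler_nat.
  rewrite (leq_trans (size_scale_leq _ _))//.
  (* A box of m_j terms has degree at most m_j - 1; the [N] units gained here pay for the degree of
     [c]. *)
  have h4 : ((size B).-1 + N <= \sum_(j < N) m j)%N.
    apply: leq_trans (leq_add (size_prod_pred _ _ _) (leqnn _)) _.
    rewrite -[X in (_ + X)%N](card_ord N) -sum1_card -big_split/=.
    apply: leq_sum => j _; have := m_gt0 j (ltnW (ltn_ord j)).
    rewrite addn1; have := size_box R (m j).
    case: (m j) => [|b] h //= _.
    by rewrite ltnS -subn1 leq_subLR add1n.
  have h5 : (size (c \Po (1 - 'X)) <= N.+1)%N.
    rewrite (leq_trans (size_comp_poly_leq _ _))// ltnS.
    have s2 : ((size (1 - 'X : {poly R})%R).-1 <= 1)%N.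
      rewrite -subn1 leq_subLR (leq_trans (size_polyD _ _))//.
      by rewrite geq_max size_poly1 size_polyN size_polyX.
    rewrite (leq_trans (leq_mul (leqnn _) s2))// muln1.
    by case: (size c) szc.
  exact: (size_arith h4 h5 (size_box R ms) (size_polyMleq _ _) (size_polyMleq _ _) ms0).
- move=> k kN; rewrite hornerZ; have [->|kn] := eqVneq k n.
    by rewrite -/V mulVf// -normr_gt0.
  rewrite !hornerM -/(x k) cv.
  suff -> : \prod_(1 <= j < N.+1 | j != n) (1 - (1 - x k) / (1 - x j)) = 0.
    by rewrite mul0r !mulr0.
  rewrite big_mkcond (bigD1_seq k) ?iota_uniq//=; last by rewrite mem_index_iota.
  by rewrite kn divff ?subrr ?mul0r// gt_eqF// x1//; case/andP: kN.
- move=> l; rewrite coefZ normrM normfV.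
  have h := ler_norm_coefM Q l (coef_box R ms).
  apply: (@le_trans _ _ (4 * expR (eigenval R n * tau) * (4 * eta / tau * K0))).
    rewrite ler_pM ?invr_ge0//.
      rewrite -[leRHS]invrK lef_pV2 ?posrE//; last by rewrite invr_gt0 mulr_gt0 ?expR_gt0.
      by rewrite invfM -expRN.
    apply: (le_trans h); rewrite ler_pM ?l1_ge0 ?invr_ge0//.
    rewrite -[leLHS]mul1r ler_pdivrMr ?ltr0n// mulrAC ler_pdivlMr// mul1r.
    by move: msge; rewrite ler_pdivrMr//; nra.
  by rewrite le_eqVlt; apply/orP; left; apply/eqP; field; rewrite gt_eqF.
Unshelve. all: by end_near. Qed.

End biorthogonal_poly.

(** * The space L2(0,1) and the heat semigroup *)

Section inner_product.
Variable R : realType.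
Implicit Types u v w : L2 R.

Definition dot u v : R := \int[leb01 R]_x (u x * v x).

Lemma L2_Lfun u : (u : R -> R) \in Lfun (leb01 R) 2%:E.
Proof. exact: LfunP. Qed.

Lemma integrable_dot u v :
  (leb01 R).-integrable setT (fun x => (u x * v x)%:E).
Proof.
by apply/Lfun1_integrable; exact: (Lfun2_mul_Lfun1 (L2_Lfun u) (L2_Lfun v)).
Qed.

Lemma dotC u v : dot u v = dot v u.
Proof. by apply: eq_Rintegral => x _; rewrite mulrC. Qed.

Lemma dotDl u v w : dot (u + v) w = dot u w + dot v w.
Proof.
rewrite /dot -RintegralD//; [|exact: integrable_dot..].
by apply: eq_Rintegral => x _; rewrite -mulrDl.
Qed.

Lemma dotZl a u v : dot (a *: u) v = a * dot u v.
Proof.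
rewrite /dot -RintegralZl//; last exact: integrable_dot.
by apply: eq_Rintegral => x _; rewrite mulrA.
Qed.

Lemma dot0l u : dot 0 u = 0.
Proof. by rewrite -(scale0r (0 : L2 R)) dotZl mul0r. Qed.

Lemma dotNl u v : dot (- u) v = - dot u v.
Proof. by rewrite -scaleN1r dotZl mulN1r. Qed.

Lemma dotBl u v w : dot (u - v) w = dot u w - dot v w.
Proof. by rewrite dotDl dotNl. Qed.

Lemma dotDr u v w : dot w (u + v) = dot w u + dot w v.
Proof. by rewrite dotC dotDl !(dotC _ w). Qed.

Lemma dotZr a u v : dot u (a *: v) = a * dot u v.
Proof. by rewrite dotC dotZl dotC. Qed.

Lemma dot_suml (I : Type) (r : seq I) (P : pred I) (F : I -> L2 R) v :
  dot (\sum_(i <- r | P i) F i) v = \sum_(i <- r | P i) dot (F i) v.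
Proof.
elim/big_ind2 : _ => [|x a y b xa yb|//]; first by rewrite dot0l.
by rewrite dotDl xa yb.
Qed.

Lemma dot_sumr (I : Type) (r : seq I) (P : pred I) (F : I -> L2 R) v :
  dot v (\sum_(i <- r | P i) F i) = \sum_(i <- r | P i) dot v (F i).
Proof. by rewrite dotC dot_suml; apply: eq_bigr => i _; rewrite dotC. Qed.

Lemma L2norm_ge0 u : 0 <= L2norm u.
Proof. by rewrite /L2norm /Lpnorm fine_ge0// Lnorm_ge0. Qed.

Lemma L2normE u : L2norm u ^+ 2 = dot u u.
Proof.
have fn : ('N[leb01 R]_2[EFin \o u])%E = (L2norm u)%:E.
  exact/esym/(@finite_norm_fine _ _ _ (leb01 R) 2 (lee1n 2) u).
have n20 : 2 != 0 :> R by rewrite pnatr_eq0.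
have := powR_Lnorm (leb01 R) (EFin \o u) n20.
rewrite fn poweR_EFin powR_mulrn ?L2norm_ge0// => e.
apply: EFin_inj; rewrite e /dot /Rintegral fineK; last first.
  exact: integrable_fin_num (integrable_dot u u).
apply: eq_integral => x _ /=.
by rewrite powR_mulrn// -normrX ger0_norm ?sqr_ge0.
Qed.

Lemma dot_ge0 u : 0 <= dot u u.
Proof. by rewrite -L2normE sqr_ge0. Qed.

Lemma L2norm0 : L2norm (0 : L2 R) = 0.
Proof. exact: Lpnorm0. Qed.

Lemma L2normD u v : L2norm (u + v) <= L2norm u + L2norm v.
Proof. exact: LpnormD. Qed.

Lemma L2normN u : L2norm (- u) = L2norm u.
Proof. exact: LpnormN. Qed.

Lemma L2_ballE u e : ball u e = [set v | L2norm (u - v) < e].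
Proof. by []. Qed.

Lemma L2normB u v : L2norm (u - v) = L2norm (v - u).
Proof. by rewrite -L2normN opprB. Qed.

Lemma L2norm_sum (I : Type) (r : seq I) (P : pred I) (F : I -> L2 R) :
  L2norm (\sum_(i <- r | P i) F i) <= \sum_(i <- r | P i) L2norm (F i).
Proof.
elim/big_ind2 : _ => [|x a y b xa yb|//]; first by rewrite L2norm0.
by rewrite (le_trans (L2normD _ _))// lerD.
Qed.

Lemma L2normZ a u : L2norm (a *: u) = `|a| * L2norm u.
Proof.
apply/eqP; rewrite -(@eqrXn2 _ 2) ?L2norm_ge0 ?mulr_ge0//.
  by rewrite exprMn !L2normE dotZl dotZr mulrA -expr2 real_normK ?num_real.
exact: L2norm_ge0.
Qed.

Lemma dot_le_norm u v : `|dot u v| <= L2norm u * L2norm v.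
Proof.
rewrite -ler_sqr ?nnegrE ?mulr_ge0 ?L2norm_ge0// exprMn !L2normE.
rewrite real_normK ?num_real//.
have [v0|v0] := eqVneq (dot v v) 0; last first.
  have vp : 0 < dot v v by rewrite lt_neqAle eq_sym v0 dot_ge0.
  have := dot_ge0 (u + (- (dot u v / dot v v)) *: v).
  rewrite dotDl !dotDr !dotZl !dotZr (dotC v u) => h.
  rewrite -subr_ge0; have /(mulr_ge0 (ltW vp)) := h; congr (0 <= _).
  by field; rewrite gt_eqF.
rewrite v0 mulr0 leNgt; apply/negP => uv0.
have uv : dot u v != 0 by apply: contraTneq uv0 => ->; rewrite expr0n ltxx.
(* [dot v v = 0] does not force [v = 0]. The squared norm of [u + t *: v] is then affine in [t], and
   this [t] would make it -1. *)
pose t := - ((dot u u + 1) / (2 * dot u v)).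
have := dot_ge0 (u + t *: v).
rewrite dotDl !dotDr !dotZl !dotZr v0 !mulr0 addr0 (dotC v u).
have -> : t * dot u v = - ((dot u u + 1) / 2) by rewrite /t; field.
lra.
Qed.

End inner_product.

(** * Bounded functions and series in the Dirichlet basis *)

Section L2_bounded.
Variable R : realType.

Lemma L2_measurable (u : L2 R) :
  measurable_fun [set: measurableTypeR R] (u : R -> R).
Proof. by have := L2_Lfun u; rewrite inE => /andP[/[!inE]]. Qed.

Lemma leb01T : leb01 R [set: R] = 1%E.
Proof.
by rewrite /leb01/= /mrestr/= setTI lebesgue_measure_itv/= lte_fin ltr01 oppr0 adde0.
Qed.

Lemma bounded_Lfun2 (h : R -> R) (c : R) :
  measurable_fun [set: measurableTypeR R] h -> (forall x, `|h x| <= c) ->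
  h \in Lfun (leb01 R) 2%:E.
Proof.
move=> mh hc; rewrite inE/=; apply/andP; split; rewrite inE//=.
rewrite /finite_norm unlock poweR_lty//=.
apply: (@le_lt_trans _ _ (\int[leb01 R]_x (cst (c ^+ 2)%:E x))%E); last first.
  by rewrite integral_cst// leb01T mule1 ltry.
apply: ge0_le_integral => //.
  by apply/measurable_EFinP; apply: (measurableT_comp (measurable_powR _));
    exact: measurableT_comp.
move=> x _ /=; rewrite lee_fin powR_mulrn// -normrX ger0_norm ?sqr_ge0//.
by rewrite -[h x ^+ 2]real_normK ?num_real// lerXn2r ?nnegrE// (le_trans _ (hc x)).
Qed.

Lemma L2norm_le_sup (u : L2 R) (c : R) : (forall x, `|u x| <= c) -> L2norm u <= c.
Proof.
move=> uc; have c0 : 0 <= c by rewrite (le_trans _ (uc 0)).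
rewrite -ler_sqr ?nnegrE ?L2norm_ge0// L2normE /dot.
apply: (@le_trans _ _ (\int[leb01 R]_x (c ^+ 2))).
  apply: le_Rintegral => //; first exact: integrable_dot.
    apply/integrableP; split; first exact: measurable_cst.
    by rewrite integral_cst//= leb01T mule1 ltry.
  move=> x _; rewrite -expr2 -[u x ^+ 2]real_normK ?num_real//.
  by rewrite lerXn2r ?nnegrE.
by rewrite Rintegral_cst// leb01T mulr1.
Qed.

Lemma dirichlet_fun_le2 n (x : R) : `|dirichlet_fun n x| <= 2.
Proof.
rewrite /dirichlet_fun normrM ger0_norm ?sqrtr_ge0//.
rewrite (@le_trans _ _ (Num.sqrt 2))//.
  by rewrite ler_piMr ?sqrtr_ge0// ler_norml sin_geN1 sin_le1.
rewrite -[leRHS](@ger0_norm _ 2)// -sqrtr_sqr ler_wsqrtr//; lra.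
Qed.

Definition partial_sum (a : nat -> R) (N : nat) : L2 R :=
  \sum_(1 <= n < N) a n *: e_ R n.

Lemma partial_sumE a N x : partial_sum a N x = \sum_(1 <= n < N) a n * dirichlet_fun n x.
Proof.
rewrite /partial_sum; elim: N => [|N ih]; first by rewrite !big_geq.
have [->|N0] := posnP N; first by rewrite !big_geq.
by rewrite !big_nat_recr//= -ih.
Qed.

Lemma dirichlet_sum_le (a : nat -> R) c N M x : (0 < N <= M)%N -> 0 <= c ->
  (forall n, (0 < n)%N -> `|a n| <= c / (n%:R * n.+1%:R)) ->
  `|\sum_(1 <= n < M) a n * dirichlet_fun n x -
    \sum_(1 <= n < N) a n * dirichlet_fun n x| <= 2 * c * (N%:R^-1 - M%:R^-1).
Proof.
move=> /andP[N0 NM] c0 ac.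
rewrite (@big_cat_nat _ _ _ N 1 M)//= addrAC subrr add0r.
rewrite (le_trans (ler_norm_sum _ _ _))//.
have -> : N%:R^-1 - M%:R^-1 = \sum_(N <= n < M) (n%:R * n.+1%:R)^-1 :> R.
  rewrite -[LHS]opprB -(telescope_sumr (fun n => n%:R^-1) NM) -sumrN.
  rewrite !big_nat; apply: eq_bigr => n /andP[Nn _].
  have n0 : n%:R != 0 :> R by rewrite pnatr_eq0 -lt0n (leq_trans N0).
  by rewrite -natr1; field; rewrite n0 natr1 pnatr_eq0.
rewrite mulr_sumr !big_nat; apply: ler_sum => n /andP[Nn _].
rewrite normrM -mulrA [leRHS]mulrC ler_pM ?dirichlet_fun_le2//.
by rewrite ac// (leq_trans N0).
Qed.

(** The series converges uniformly, by comparison with the telescoping 1 / (n (n + 1)). Its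
    pointwise sum is bounded and measurable, hence an element of L2(0,1) and a limit of the partial
    sums; this takes the place of completeness. *)
Lemma partial_sum_cvg (a : nat -> R) c : 0 <= c ->
  (forall n, (0 < n)%N -> `|a n| <= c / (n%:R * n.+1%:R)) ->
  forall N, (0 < N)%N -> L2norm (lim (partial_sum a @ \oo) - partial_sum a N) <= 2 * c / N%:R.
Proof.
move=> c0 ac.
have le x N M : (0 < N <= M)%N ->
    `|partial_sum a M x - partial_sum a N x| <= 2 * c / N%:R.
  move=> NM; rewrite !partial_sumE (le_trans (dirichlet_sum_le x NM c0 ac))//.
  by rewrite ler_wpM2l ?mulr_ge0// gerBl invr_ge0.
have cvg0 : (fun N => 2 * c / N%:R) @ \oo --> (0 : R).
  rewrite -[X in _ --> X](mulr0 (2 * c)); apply: cvgM; first exact: cvg_cst.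
  rewrite -cvg_shiftS; exact: cvg_harmonic.
have cvgx x : cvgn (fun N => partial_sum a N x).
  apply/cauchy_cvgP/cauchy_exP => e e0.
  have /cvgrPdist_lt/(_ e e0)[N _ hN] := cvg0.
  exists (partial_sum a N.+1 x); exists N.+1 => // M /= NM.
  rewrite /ball/= distrC (le_lt_trans (le x N.+1 M _))//.
  have := hN N.+1 (leqnSn _); rewrite sub0r normrN; apply: le_lt_trans.
  exact: ler_norm.
pose h x := limn (fun N => partial_sum a N x).
have hle x N : (0 < N)%N -> `|h x - partial_sum a N x| <= 2 * c / N%:R.
  move=> N0.
  have : (fun M => `|partial_sum a M x - partial_sum a N x|) @ \oo --> `|h x - partial_sum a N x|.
    by apply: cvg_norm; apply: cvgB; [exact: cvgx|exact: cvg_cst].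
  move/(cvgr_to_le) => /(_ (2 * c / N%:R)); apply.
  by exists N => // M /= NM; apply: le; rewrite N0.
have mh : measurable_fun [set: measurableTypeR R] h.
  apply: (@measurable_fun_cvg _ _ _ _ (fun N => L2fun (partial_sum a N))) => [N|x _].
    exact: L2_measurable.
  exact: cvgx.
have hb x : `|h x| <= 2 * c.
  by have := hle x 1%N isT; rewrite divr1 partial_sumE big_geq// subr0.
pose u : L2 R := Lfun_Sub (lee1n 2) (bounded_Lfun2 mh hb).
have ule N : (0 < N)%N -> L2norm (u - partial_sum a N) <= 2 * c / N%:R.
  by move=> N0; apply: L2norm_le_sup => x; exact: hle.
have cu : partial_sum a @ \oo --> u.
  apply/cvg_ballP => e e0.
  have /cvgrPdist_lt/(_ e e0)[N _ hN] := cvg0.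
  exists N.+1 => // M /= NM; rewrite L2_ballE/= (le_lt_trans (ule M _))//; first exact: leq_trans NM.
  have := hN M (ltnW NM); rewrite sub0r normrN; apply: le_lt_trans.
  exact: ler_norm.
(* Limits are unique only up to norm 0, so [lim] need not be [u]: its distance to [partial_sum a N]
   is estimated through a later partial sum. *)
move=> N N0; apply/ler_addgt0Pr => e e0.
have /cvg_ballP/(_ e e0)[M _ hM] : partial_sum a @ \oo --> lim (partial_sum a @ \oo).
  exact: cvgP cu.
have := hM (maxn M N) (leq_maxl _ _); rewrite L2_ballE/= => lM.
set l := lim _ in lM *.
rewrite (_ : l - _ = (partial_sum a (maxn M N) - partial_sum a N) + (l - partial_sum a (maxn M N))); last first.
  by rewrite [RHS]addrC addrA subrK.
rewrite (le_trans (L2normD _ _))// lerD ?(ltW lM)//.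
apply: L2norm_le_sup => x; apply: le; by rewrite N0 leq_maxr.
Qed.

End L2_bounded.

(** * Estimates on the heat semigroup *)

Section heat_bounds.
Variable R : realType.
Local Notation eigenval := (eigenval R).

Lemma L2norm_e_ n : L2norm (e_ R n) <= 2.
Proof. by apply: L2norm_le_sup => x; exact: dirichlet_fun_le2. Qed.

Lemma normr_coef_le (u : L2 R) n : `|coef u n| <= 2 * L2norm u.
Proof.
rewrite (le_trans (dot_le_norm u (e_ R n)))// mulrC ler_wpM2r ?L2norm_ge0//.
exact: L2norm_e_.
Qed.

Lemma coefB (u v : L2 R) n : coef (u - v) n = coef u n - coef v n.
Proof. exact: dotBl. Qed.

Lemma eigenval_ge1 n : (0 < n)%N -> 1 <= eigenval n.
Proof.
move=> n0; have := eigenval_ge R n; have : 1 <= n%:R :> R by rewrite ler1n.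
nra.
Qed.

(** By e^{-z} <= 6 / z^3 and 1 + lambda <= 2 lambda the left-hand side is at most 12 / (eps^3
    lambda^2), and lambda^2 >= n (n + 1). The factor [1 + eigenval n] allows for coefficients
    growing like the eigenvalues. *)
Lemma expRN_eigenval_le (eps t : R) n : 0 < eps -> eps <= t -> (0 < n)%N ->
  expR (- eigenval n * t) * (1 + eigenval n) <= 12 / eps ^+ 3 / (n%:R * n.+1%:R).
Proof.
move=> eps0 et n0; have lE := eigenval_ge R n.
move: (eigenval_ge1 n0) lE; move: (eigenval n) => l l1 lE.
have l0 : 0 < l by lra.
have le3 : (l * eps) ^+ 3 / 6 <= expR (l * eps).
  have le0 : 0 <= l * eps by rewrite ltW// mulr_gt0.
  by apply: le_trans (expR_ge1Dxn 2 le0); rewrite lerDr.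
have e3 : expR (- l * t) <= 6 / (l * eps) ^+ 3.
  apply: (@le_trans _ _ (expR (- (l * eps)))).
    by rewrite ler_expR mulNr lerN2 ler_wpM2l// ltW.
  rewrite expRN -[leRHS]invrK lef_pV2 ?posrE ?expR_gt0 ?invr_gt0 ?divr_gt0 ?exprn_gt0 ?mulr_gt0//.
  by rewrite invfM invrK mulrC.
apply: (@le_trans _ _ (6 / (l * eps) ^+ 3 * (2 * l))).
  by rewrite ler_pM ?expR_ge0//; lra.
have -> : 6 / (l * eps) ^+ 3 * (2 * l) = 12 / eps ^+ 3 / l ^+ 2.
  by field; rewrite !gt_eqF.
rewrite ler_wpM2l ?divr_ge0 ?exprn_ge0 ?(ltW eps0)//.
rewrite lef_pV2 ?posrE ?exprn_gt0 ?mulr_gt0 ?ltr0n//.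
have n1 : 1 <= n%:R :> R by rewrite ler1n.
move: lE; rewrite -natr1 mulr2n.
by move: n1; set x : R := n%:R; nra.
Qed.

Definition heat_sum (t : R) (g : nat -> R) (N : nat) : L2 R :=
  partial_sum (fun n => expR (- eigenval n * t) * g n) N.

Lemma heat_tail (eps t G : R) (g : nat -> R) N : 0 < eps -> eps <= t ->
  (forall n, (0 < n)%N -> `|g n| <= G * (1 + eigenval n)) -> (0 < N)%N ->
  L2norm (heat t g - heat_sum t g N) <= 24 * G / eps ^+ 3 / N%:R.
Proof.
move=> eps0 et gG N0.
have G0 : 0 <= G.
  have := gG 1%N isT; have := eigenval_ge1 (ltn0Sn 0) => l1 /(le_trans (normr_ge0 _)).
  by rewrite pmulr_lge0//; lra.
have c0 : 0 <= G * 12 / eps ^+ 3 by rewrite divr_ge0 ?mulr_ge0 ?exprn_ge0 ?(ltW eps0).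
have ac n : (0 < n)%N -> `|expR (- eigenval n * t) * g n| <= G * 12 / eps ^+ 3 / (n%:R * n.+1%:R).
  move=> n0; rewrite normrM ger0_norm ?expR_ge0//.
  rewrite (le_trans (ler_wpM2l (expR_ge0 _) (gG _ n0)))// mulrCA -!mulrA ler_wpM2l//.
  by rewrite !mulrA (le_trans (expRN_eigenval_le eps0 et n0))// !mulrA.
have := partial_sum_cvg c0 ac N0; rewrite /heat /heat_sum => /le_trans; apply.
by rewrite le_eqVlt; apply/orP; left; apply/eqP; field;
  rewrite pnatr_eq0 -lt0n N0 gt_eqF.
Qed.

(** One term is at most the sum K, and lambda^{-s} >= lambda^{-1} because lambda >= 1; hence f_n^2
    <= K lambda_n. Coefficients of L2 functions obey a bound of the same form, so one tail estimate
    serves both the noise and the initial data. *)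
Lemma in_Hneg_bound (s : R) (f : nat -> R) : s <= 1 -> in_Hneg s f ->
  exists2 G, 0 <= G & forall n, (0 < n)%N -> `|f n| <= G * (1 + eigenval n).
Proof.
move=> s1 fs.
pose a n := eigenval n `^ (- s) * f n ^+ 2.
have a0 n : 0 <= a n by rewrite mulr_ge0 ?powR_ge0 ?sqr_ge0.
have [K Kfs] : exists K : R, (\sum_(1 <= n <oo) (a n)%:E)%E = K%:E.
  exists (fine (\sum_(1 <= n <oo) (a n)%:E)%E); rewrite fineK//.
  rewrite ge0_fin_numE//; apply: nneseries_ge0 => n _ _.
  by rewrite lee_fin.
have aK n : (0 < n)%N -> a n <= K.
  move=> n0; rewrite -lee_fin -Kfs.
  apply: (@le_trans _ _ (\sum_(1 <= i < n.+1) (a i)%:E)%E).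
    rewrite big_nat_recr//= leeDr// sume_ge0// => i _.
    by rewrite lee_fin.
  by apply: nneseries_lim_ge => i _ _; rewrite lee_fin.
have K0 : 0 <= K by rewrite (le_trans (a0 1%N))// aK.
exists (1 + K); first by rewrite addr_ge0.
move=> n n0; have l1 := eigenval_ge1 n0.
have := aK _ n0; rewrite /a; set l := Defs.eigenval R n in l1 *; set x := f n => h.
have ls : l `^ (- s) >= l^-1.
  by rewrite -powR_inv1 ?(le_trans ler01 l1)// ler_powR// lerN2.
have l0 : 0 < l by lra.
have xK : x ^+ 2 <= K * l.
  rewrite -ler_pdivrMr// mulrC (le_trans _ h)// ler_wpM2r ?sqr_ge0//.
have p0 : 0 <= (1 + K) * (1 + l) by rewrite mulr_ge0//; lra.
by rewrite -ler_sqr ?nnegrE// real_normK ?num_real// (le_trans xK)//; nra.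
Qed.

End heat_bounds.

Section measurability.
Context {R : realType} d (T : measurableType d) (D : set T).

Lemma measurable_dot_sum m m' (c c' : nat -> T -> R) (v v' : nat -> L2 R) :
  (forall i, measurable_fun D (c i)) -> (forall i, measurable_fun D (c' i)) ->
  measurable_fun D (fun r =>
    dot (\sum_(i < m) c i r *: v i) (\sum_(j < m') c' j r *: v' j)).
Proof.
move=> mc mc'.
under eq_fun => r do (rewrite dot_suml; under eq_bigr => i _ do rewrite dotZl dot_sumr).
apply: measurable_sum => i; apply: measurable_funM => //.
apply: measurable_sum => j; under eq_fun do rewrite dotZr.
by apply: measurable_funM.
Qed.

(** Expanding the square leaves finitely many inner products of fixed vectors with measurable scalar
    coefficients; no measurable structure on L2(0,1) enters. *)
Lemma measurable_L2norm_sub m m' (c c' : nat -> T -> R) (v v' : nat -> L2 R) :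
  (forall i, measurable_fun D (c i)) -> (forall i, measurable_fun D (c' i)) ->
  measurable_fun D (fun r =>
    L2norm (\sum_(i < m) c i r *: v i - \sum_(j < m') c' j r *: v' j) ^+ 2).
Proof.
move=> mc mc'.
under eq_fun do rewrite L2normE dotBl (dotC _ (_ - _)) (dotC _ (_ - _)) !dotBl.
by apply: measurable_funB; apply: measurable_funB; exact: measurable_dot_sum.
Qed.

End measurability.

Section heat_measurable.
Variable R : realType.

Lemma L2norm_dist (u v w : L2 R) : `|L2norm (u - w) - L2norm (v - w)| <= L2norm (u - v).
Proof.
have h (x y z : L2 R) : L2norm (x - z) - L2norm (y - z) <= L2norm (x - y).
  by rewrite lerBlDr (le_trans _ (L2normD _ _))// addrA subrK.
by rewrite ler_norml h andbT lerNl opprB (le_trans (h _ _ _))// L2normB.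
Qed.

(** A pointwise limit of the same functions with [heat_sum] in place of [heat]. The time r = t is
    left out: [heat 0 f] is unspecified when its series diverges. *)
Lemma measurable_heat_step (t G : R) (f : nat -> R) (S : step R) :
  (forall n, (0 < n)%N -> `|f n| <= G * (1 + eigenval R n)) ->
  measurable_fun (`[0, t[%classic : set (measurableTypeR R))
    (fun r => L2norm (heat (t - r) f - step_fun S r) ^+ 2).
Proof.
move=> fG; apply: (@measurable_fun_cvg _ (measurableTypeR R) R _
  (fun N r => L2norm (heat_sum (t - r) f N - step_fun S r) ^+ 2)) => [N|r /=].
  rewrite [X in measurable_fun _ X](_ : _ = fun r => L2norm (
      \sum_(i < N.-1) (expR (- eigenval R i.+1 * (t - r)) * f i.+1) *: e_ R i.+1 -
      step_fun S r) ^+ 2); last first.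
    by apply/funext => r; rewrite /heat_sum /partial_sum big_add1 big_mkord.
  rewrite /step_fun.
  apply: (@measurable_L2norm_sub R _ (measurableTypeR R) `[0, t[%classic _ _
    (fun i r => expR (- eigenval R i.+1 * (t - r)) * f i.+1)
    (fun i r => \1_(`[step_node S i, step_node S i.+1[%classic) r)
    (fun i => e_ R i.+1) (step_val S)) => i.
    apply: measurable_funTS; apply: measurable_funM => //.
    apply: (measurableT_comp (@measurable_expR R)).
    by apply: measurable_funM => //; apply: measurable_funB.
  by apply: measurable_funTS; exact: measurable_indic.
rewrite in_itv/= => /andP[r0 rt]; have tr0 : 0 < t - r by rewrite subr_gt0.
under eq_fun do rewrite expr2.
rewrite expr2; suff h : (fun N => L2norm (heat_sum (t - r) f N - step_fun S r)) @ \oo -->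
    L2norm (heat (t - r) f - step_fun S r) by exact: cvgM.
apply/cvgrPdist_le => e e0.
have c0 : (fun N => 24 * G / (t - r) ^+ 3 / N%:R) @ \oo --> (0 : R).
  rewrite -[X in _ --> X](mulr0 (24 * G / (t - r) ^+ 3)); apply: cvgM; first exact: cvg_cst.
  by rewrite -cvg_shiftS; exact: cvg_harmonic.
have /cvgrPdist_le/(_ e e0)[N0 _ hN] := c0.
exists N0.+1 => // N /= NN.
rewrite (le_trans (L2norm_dist _ _ _))//.
rewrite (le_trans (heat_tail tr0 (lexx _) fG _))//; first exact: leq_trans NN.
have := hN N (ltnW NN); rewrite sub0r normrN; apply: le_trans; exact: ler_norm.
Qed.

End heat_measurable.

(** * Shifts of Brownian increments *)

Section density_pushforward.
Context d (T : measurableType d) d' (T' : measurableType d') (R : realType).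
Variables (mu : {measure set T -> \bar R}) (X : T -> T') (h : T -> R).
Variables (nu : {measure set T' -> \bar R}) (c : R).
Hypothesis mX : measurable_fun setT X.
Hypothesis mh : measurable_fun setT h.
Hypothesis h0 : forall x, 0 <= h x.
Hypothesis nuE : forall B, measurable B ->
  (\int[mu]_(x in X @^-1` B) (h x)%:E = c%:E * nu B)%E.

Import HBNNSimple.

(** By [nuE], [X] maps the measure of density [h] to [c] times [nu]. This one change of variables
    serves translations and dilations (h = 1), Gaussian densities (X the identity) and independence
    (h the product of the other factors). *)
Lemma ge0_integral_density (g : T' -> R) : measurable_fun setT g ->
  (forall y, 0 <= g y) ->
  (\int[mu]_x (g (X x) * h x)%:E = c%:E * \int[nu]_y (g y)%:E)%E.
Proof.
move=> mg g0.
have mgE : measurable_fun setT (EFin \o g) by exact/measurable_EFinP.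
pose s := nnsfun_approx measurableT mgE.
have scvg y : (s n y)%:E @[n --> \oo] --> (g y)%:E.
  by apply: cvg_nnsfun_approx => // z _; rewrite lee_fin.
have mXA A : measurable A -> measurable (X @^-1` A).
  by move=> mA; rewrite -[X @^-1` A]setTI; exact: mX.
have step n : (\int[mu]_x (s n (X x) * h x)%:E = c%:E * \int[nu]_y (s n y)%:E)%E.
  have -> : (\int[nu]_y (s n y)%:E =
      \sum_(r \in range (s n)) (r%:E * nu (s n @^-1` [set r])))%E.
    under eq_integral do rewrite fimfunE -fsumEFin//.
    rewrite ge0_integral_fsum//; last 2 first.
      by move=> r; exact/measurable_EFinP/measurable_funM.
      by move=> r y _; exact: nnfun_muleindic_ge0.
    apply: eq_fsbigr => r rs.
    by rewrite integralZl_indic_nnsfun// integral_indic// setIT.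
  transitivity (\int[mu]_x \sum_(r \in range (s n))
      (r * \1_(s n @^-1` [set r]) (X x) * h x)%:E)%E.
    by apply: eq_integral => x _; rewrite fsumEFin// -mulr_fsuml// -fimfunE.
  have r0 r : r \in range (s n) -> 0 <= r by rewrite inE => -[y _ <-].
  rewrite ge0_integral_fsum//; last 2 first.
    move=> r; apply/measurable_EFinP; apply: measurable_funM => //.
    apply: measurable_funM => //.
    by apply: (measurableT_comp (measurable_indic _)).
    move=> r x _; rewrite lee_fin mulr_ge0//.
    by have := nnfun_muleindic_ge0 (s n) r (X x); rewrite lee_fin.
  rewrite ge0_mule_fsumr//; last first.
    move=> r; have [rs|rs] := boolP (r \in range (s n)).
      by rewrite mule_ge0// lee_fin r0.
    rewrite (_ : s n @^-1` [set r] = set0) ?measure0 ?mule0//.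
    by apply/seteqP; split => // y /= yr; move/negP: rs; apply; rewrite inE; exists y.
  apply: eq_fsbigr => r rs.
  transitivity (r%:E * \int[mu]_(x in X @^-1` (s n @^-1` [set r])) (h x)%:E)%E.
    have mD : measurable (X @^-1` (s n @^-1` [set r])) by exact: mXA.
    rewrite -ge0_integralZl//; last 3 first.
      by apply/measurable_EFinP; exact: measurable_funTS.
      by move=> x _; rewrite lee_fin.
      by rewrite lee_fin r0.
    rewrite [RHS]integral_mkcond; apply: eq_integral => x _.
    rewrite patchE indicE; case: ifPn => xr.
      by rewrite (_ : (X x \in _) = true) ?mulr1//; move: xr; rewrite !inE.
    rewrite (_ : (X x \in _) = false) ?mulr0 ?mul0r//.
    by apply/negbTE; apply: contra xr; rewrite !inE.
  by rewrite nuE// muleCA.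
transitivity (limn (fun n => \int[mu]_x (s n (X x) * h x)%:E)%E).
  rewrite -monotone_convergence//.
  - apply: eq_integral => x _; apply/esym/cvg_lim => //.
    under eq_fun do rewrite EFinM.
    by rewrite EFinM; apply: cvgeZr => //; exact: scvg.
  - move=> n; apply/measurable_EFinP; apply: measurable_funM => //.
    exact: measurableT_comp.
  - by move=> n x _; rewrite lee_fin mulr_ge0.
  - move=> x _ m n mn; rewrite lee_fin ler_wpM2r//.
    exact/lefP/nd_nnsfun_approx.
under eq_fun do rewrite step.
have mono := @cvg_monotone_convergence _ _ _ nu setT measurableT (fun n y => (s n y)%:E).
apply/cvg_lim => //; apply: cvgeZl => //.
under [X in _ --> X]eq_integral => y _.
  rewrite -(cvg_lim (@ereal_hausdorff R) (scvg y)).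
  over.
apply: mono => //.
- by move=> n; apply/measurable_EFinP; exact: measurable_funP.
- by move=> n y _; rewrite lee_fin.
- by move=> y _ m n mn; rewrite lee_fin; exact/lefP/nd_nnsfun_approx.
Qed.

End density_pushforward.

(** * Translation of a Gaussian variable *)

Section gaussian.
Variable R : realType.
Local Notation mu := (@lebesgue_measure R).

Lemma lebesgue_measure_shift (a : R) (B : set (measurableTypeR R)) :
  measurable B -> mu ((fun x => x - a) @^-1` B) = mu B.
Proof.
have mX : measurable_fun setT (fun x : measurableTypeR R => x - a : measurableTypeR R).
  exact: measurable_funB.
pose X := (fun x : measurableTypeR R => x - a : measurableTypeR R).
move=> mB; have := @lebesgue_measure_unique R (pushforward mu X).
move=> /(_ mX _ B mB) h; apply/esym; rewrite {}h// => _ [[u v] _ <-]/=.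
rewrite /pushforward/=.
rewrite (_ : (fun x => x - a) @^-1` `]u, v] = `]u + a, v + a]%classic); last first.
  by apply/seteqP; split => x /=; rewrite !in_itv/= ltrBrDr lerBlDr.
rewrite !lebesgue_measure_itv/= !lte_fin ltrD2r -!EFinB.
by rewrite opprD addrACA subrr addr0.
Qed.

Lemma ge0_integral_shift (a : R) (g : R -> R) : measurable_fun setT g ->
  (forall x, 0 <= g x) ->
  (\int[mu]_x (g (x - a))%:E = \int[mu]_x (g x)%:E)%E.
Proof.
move=> mg g0.
rewrite -[RHS]mul1e -(@ge0_integral_density _ (measurableTypeR R) _ (measurableTypeR R) R
  mu (fun x => x - a) (cst 1) mu 1)//.
- by apply: eq_integral => x _; rewrite mulr1.
- exact: measurable_funB.
- move=> B mB.
  have mX : measurable_fun setT (fun x : measurableTypeR R => x - a).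
    exact: measurable_funB.
  rewrite -[LHS]/(\int[mu]_(x in _) cst 1%:E x)%E integral_cst.
    by rewrite !mul1e; exact: lebesgue_measure_shift.
  by rewrite -[X in measurable X]setTI; exact: mX.
Qed.

Lemma ge0_integral_normal_prob (m s : R) (g : R -> R) : measurable_fun setT g ->
  (forall x, 0 <= g x) ->
  (\int[normal_prob m s]_x (g x)%:E = \int[mu]_x (g x * normal_pdf m s x)%:E)%E.
Proof.
move=> mg g0.
rewrite -[LHS]mul1e -(@ge0_integral_density _ (measurableTypeR R) _ (measurableTypeR R) R
  mu idfun (normal_pdf m s) (normal_prob m s) 1)//.
- exact: measurable_id.
- exact: measurable_normal_pdf.
- by move=> x; exact: normal_pdf_ge0.
- by move=> B mB; rewrite mul1e.
Qed.

(** The density of the normal law of mean [a] with respect to the centred one, both with standard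
    deviation [s]. *)
Definition shift_density (s a x : R) : R := expR (a * x / s ^+ 2 - a ^+ 2 / (2 * s ^+ 2)).

Lemma measurable_shift_density s a : measurable_fun setT (shift_density s a).
Proof.
apply: (measurableT_comp (@measurable_expR R)).
by apply: measurable_funB => //; apply: measurable_funM => //; exact: measurable_funM.
Qed.

Lemma shift_densityE s a x : s != 0 ->
  shift_density s a x * normal_pdf 0 s x = normal_pdf 0 s (x - a).
Proof.
move=> s0; rewrite !normal_pdfE// mulrCA; congr (_ * _).
rewrite /normal_fun /shift_density -expRD; congr expR.
by rewrite !subr0; field.
Qed.

(** Up to a constant, the square is again a shift density, for [2 * a]; the second moment
    follows. *)
Lemma shift_density_sqr s a x : s != 0 ->
  shift_density s a x ^+ 2 = expR (a ^+ 2 / s ^+ 2) * shift_density s (2 * a) x.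
Proof.
move=> s0; rewrite /shift_density -expRM_natl -expRD; congr expR.
by field.
Qed.

Lemma integral_shift_density_mul (s a : R) (g : R -> R) : s != 0 ->
  measurable_fun setT g -> (forall x, 0 <= g x) ->
  (\int[normal_prob 0 s]_x (g x * shift_density s a x)%:E =
   \int[normal_prob 0 s]_x (g ((x : R) + a))%:E)%E.
Proof.
move=> s0 mg g0.
have mga : measurable_fun setT (fun x : R => g (x + a)).
  by apply: (measurableT_comp mg); exact: measurable_funD.
rewrite !ge0_integral_normal_prob//; last 2 first.
  by apply: measurable_funM => //; exact: measurable_shift_density.
  by move=> x; rewrite mulr_ge0// expR_ge0.
rewrite -(@ge0_integral_shift a (fun x => g (x + a) * normal_pdf 0 s x)).
- by apply: eq_integral => x _; rewrite subrK -mulrA shift_densityE.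
- by apply: measurable_funM => //; exact: measurable_normal_pdf.
- by move=> x; rewrite mulr_ge0// normal_pdf_ge0.
Qed.

Lemma integral_shift_density s a : s != 0 ->
  (\int[normal_prob 0 s]_x (shift_density s a x)%:E = 1)%E.
Proof.
move=> s0; transitivity (\int[normal_prob 0 s]_x (cst 1 x * shift_density s a x)%:E)%E.
  by apply: eq_integral => x _; rewrite mul1r.
rewrite integral_shift_density_mul//.
rewrite -[LHS]/(\int[normal_prob 0 s]_x cst 1%:E x)%E integral_cst// mul1e.
exact: probability_setT.
Qed.

Lemma integral_shift_density_sqr s a : s != 0 ->
  (\int[normal_prob 0 s]_x (shift_density s a x ^+ 2)%:E = (expR (a ^+ 2 / s ^+ 2))%:E)%E.
Proof.
move=> s0; under eq_integral do rewrite shift_density_sqr// EFinM.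
rewrite ge0_integralZl ?lee_fin ?expR_ge0//.
- by rewrite integral_shift_density// mule1.
- by apply/measurable_EFinP; exact: measurable_shift_density.
- by move=> x _; rewrite lee_fin expR_ge0.
Qed.

End gaussian.

Section gaussian_second_moment.
Variable R : realType.
Local Notation mu := (@lebesgue_measure R).

Lemma lebesgue_measure_scale (s : R) (s0 : 0 < s) (B : set (measurableTypeR R)) :
  measurable B -> mu ((fun x => s * x) @^-1` B) = (s^-1%:E * mu B)%E.
Proof.
have mX : measurable_fun setT (fun x : measurableTypeR R => s * x : measurableTypeR R).
  exact: measurable_funM.
pose X := (fun x : measurableTypeR R => s * x : measurableTypeR R).
move=> mB; have := @lebesgue_measure_unique R (mscale (NngNum (ltW s0)) (pushforward mu X)).
move=> /(_ mX _ B mB) h; rewrite {}h//; last first.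
  move=> _ [[u v] _ <-]/=; rewrite /mscale/= /pushforward/=.
  rewrite (_ : X @^-1` `]u, v] = `]u / s, v / s]%classic); last first.
    apply/seteqP; split => x /=; rewrite !in_itv/= /X.
      by rewrite ltr_pdivrMr// ler_pdivlMr// mulrC.
    by rewrite ltr_pdivrMr// ler_pdivlMr// mulrC.
  rewrite !lebesgue_measure_itv/= !lte_fin ltr_pM2r ?invr_gt0//.
  case: ifPn => _; last by rewrite mule0.
  by rewrite -!EFinB -EFinM -mulrBl mulrC divfK// gt_eqF.
by rewrite /mscale/= muleA -EFinM mulVf ?gt_eqF// mul1e.
Qed.

Lemma ge0_integral_scale (s : R) (g : R -> R) : 0 < s -> measurable_fun setT g ->
  (forall x, 0 <= g x) ->
  (\int[mu]_x (g (s * x))%:E = s^-1%:E * \int[mu]_x (g x)%:E)%E.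
Proof.
move=> s0 mg g0; have si0 : 0 <= s^-1 by rewrite invr_ge0 ltW.
rewrite -(@ge0_integral_density _ (measurableTypeR R) _ (measurableTypeR R) R
  mu (fun x => s * x) (cst 1) mu s^-1)//.
- by apply: eq_integral => x _; rewrite mulr1.
- exact: measurable_funM.
- move=> B mB.
  have mX : measurable_fun setT (fun x : measurableTypeR R => s * x).
    exact: measurable_funM.
  rewrite -[LHS]/(\int[mu]_(x in _) cst 1%:E x)%E integral_cst.
    by rewrite mul1e; exact: lebesgue_measure_scale.
  by rewrite -[X in measurable X]setTI; exact: mX.
Qed.

(** The variance of the standard normal law, that is 1. It enters as a finite nonnegative factor in
    the isometry and is left unevaluated. *)
Definition gaussian_moment2 : R := fine (\int[normal_prob 0 1]_x (((x : R) ^+ 2)%:E))%E.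

Lemma sqr_le_expRD (x : R) : x ^+ 2 <= 2 * (expR x + expR (- x)).
Proof.
have h (y : R) : 0 <= y -> y ^+ 2 <= 2 * expR y.
  move=> y0; have : y ^+ 2 / 2 <= expR y.
    by apply: le_trans (expR_ge1Dxn 1 y0); rewrite lerDr.
  by rewrite ler_pdivrMr// mulrC.
have [x0|x0] := leP 0 x.
  by rewrite (le_trans (h _ x0))// ler_wpM2l// lerDl expR_ge0.
rewrite -sqrrN (le_trans (h _ _)) ?oppr_ge0 ?(ltW x0)//.
by rewrite ler_wpM2l// lerDr expR_ge0.
Qed.

(** x^2 is dominated by a multiple of e^x + e^{-x}, and these two exponentials are multiples of the
    shift densities for a = 1 and a = -1, of integral 1. *)
Lemma gaussian_moment2_fin :
  (\int[normal_prob 0 1]_x (((x : R) ^+ 2)%:E))%E \is a fin_num.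
Proof.
rewrite ge0_fin_numE; last by apply: integral_ge0 => x _; rewrite lee_fin sqr_ge0.
apply: (@le_lt_trans _ _ (\int[normal_prob 0 1]_x
  ((2 * expR (1 / 2))%:E * ((shift_density 1 1 x)%:E + (shift_density 1 (- 1) x)%:E)))%E).
  apply: ge0_le_integral => //.
  - by move=> x _; rewrite lee_fin sqr_ge0.
  - by apply/measurable_EFinP; exact: measurable_funX.
  - apply/measurable_EFinP; apply: measurable_funM => //.
    by apply: measurable_funD; exact: measurable_shift_density.
  - move=> x _; rewrite -EFinD -EFinM lee_fin /shift_density.
    rewrite sqrrN !expr1n !mulr1 !divr1 mul1r mulN1r.
    rewrite (le_trans (sqr_le_expRD x))// -mulrA ler_wpM2l// mulrDr -!expRD.
    by rewrite addrCA subrr addr0 mul1r addrCA subrr addr0.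
have dm a := @measurable_shift_density R 1 a.
have d0 a x : (0 <= (shift_density 1 a x)%:E :> \bar R)%E by rewrite lee_fin expR_ge0.
have k0 : (0 <= (2 * expR (1 / 2) : R)%:E)%E by rewrite lee_fin mulr_ge0 ?expR_ge0.
rewrite ge0_integralZl//.
- rewrite ge0_integralD//; [|by apply/measurable_EFinP; exact: dm..].
  by rewrite !integral_shift_density ?oner_eq0// -EFinD -EFinM ltry.
- apply/measurable_EFinP/measurable_funD; exact: dm.
- by move=> x _; rewrite adde_ge0.
Qed.

Lemma normal_prob_moment2 (s : R) : 0 < s ->
  (\int[normal_prob 0 s]_x (((x : R) ^+ 2)%:E) = (s ^+ 2 * gaussian_moment2)%:E)%E.
Proof.
move=> s0; have sN0 : s != 0 by rewrite gt_eqF.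
have m2 : measurable_fun setT (fun x : R => x ^+ 2) by exact: measurable_funX.
rewrite EFinM /gaussian_moment2 fineK ?gaussian_moment2_fin//.
rewrite !ge0_integral_normal_prob//; [|by move=> x; exact: sqr_ge0..].
pose g (x : R) := x ^+ 2 * normal_pdf 0 s x.
have mg : measurable_fun setT g.
  by apply: measurable_funM => //; exact: measurable_normal_pdf.
have g0 x : 0 <= g x by rewrite mulr_ge0 ?sqr_ge0 ?normal_pdf_ge0.
transitivity (s%:E * \int[mu]_x (g (s * x))%:E)%E.
  by rewrite ge0_integral_scale// muleA -EFinM divff// mul1e.
have mgs : measurable_fun setT (fun x : R => g (s * x)).
  by apply: (measurableT_comp mg); exact: measurable_funM.
have mgE : measurable_fun setT (fun x : R => x ^+ 2 * normal_pdf 0 1 x).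
  by apply: measurable_funM => //; exact: measurable_normal_pdf.
have e1 : s * normal_peak s = normal_peak 1.
  rewrite /normal_peak expr1n mul1r -mulrnAr sqrtrM ?sqr_ge0// sqrtr_sqr gtr0_norm//.
  by rewrite invfM mulrA divff ?mul1r.
transitivity (\int[mu]_x (s * g (s * x))%:E)%E.
  under [RHS]eq_integral do rewrite EFinM.
  rewrite ge0_integralZl//; first exact/measurable_EFinP.
    by move=> x _; rewrite lee_fin.
  by rewrite lee_fin ltW.
transitivity (\int[mu]_x (s ^+ 2 * (x ^+ 2 * normal_pdf 0 1 x))%:E)%E.
  apply: eq_integral => x _; congr EFin; rewrite /g.
  rewrite !normal_pdfE ?oner_eq0// -e1.
  have -> : normal_fun 0 s (s * x) = normal_fun 0 1 x.
    by rewrite /normal_fun !subr0 exprMn expr1n; congr expR; field.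
  by ring.
under eq_integral do rewrite EFinM.
rewrite ge0_integralZl//; first exact/measurable_EFinP.
  by move=> x _; rewrite lee_fin mulr_ge0 ?sqr_ge0 ?normal_pdf_ge0.
by rewrite lee_fin sqr_ge0.
Qed.

Lemma gaussian_moment2_ge0 : 0 <= gaussian_moment2.
Proof. by apply: fine_ge0; apply: integral_ge0 => x _; rewrite lee_fin sqr_ge0. Qed.

End gaussian_second_moment.

(** * Independent factors and the finite-dimensional Girsanov formula *)

Section independent_product.
Context d (T : measurableType d) (R : realType) (P : probability T R).
Variables (m : nat) (X : nat -> T -> R).
Variable nu : nat -> {measure set (measurableTypeR R) -> \bar R}.
Hypothesis mX : forall i, measurable_fun setT (X i).
Hypothesis nuP : forall i (B : set (measurableTypeR R)), measurable B ->
  nu i B = P (X i @^-1` B).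
Hypothesis indep : forall B : nat -> set (measurableTypeR R),
  (forall i, measurable (B i)) ->
  P (\bigcap_(i < m) (X i @^-1` B i)) = (\prod_(i < m) P (X i @^-1` B i))%E.

Let mXA i (B : set (measurableTypeR R)) : measurable B -> measurable (X i @^-1` B).
Proof. by move=> mB; rewrite -[X i @^-1` B]setTI; exact: mX. Qed.

Lemma integral_indep_prod (g : nat -> R -> R) (e : nat -> R) :
  (forall i, measurable_fun setT (g i)) -> (forall i x, 0 <= g i x) ->
  (forall i, \int[nu i]_x (g i x)%:E = (e i)%:E)%E ->
  (\int[P]_w (\prod_(i < m) g i (X i w))%:E = (\prod_(i < m) e i)%:E)%E.
Proof.
(* The factors that are not indicator functions are introduced one at a time;
   as a function of its j-th factor, the left-hand side is the integral against
   a multiple of the law of [X j]. *)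
suff : forall j, (j <= m)%N -> forall (g : nat -> R -> R) (e : nat -> R),
  (forall i, measurable_fun setT (g i)) -> (forall i x, 0 <= g i x) ->
  (forall i, \int[nu i]_x (g i x)%:E = (e i)%:E)%E ->
  (forall i, (j <= i)%N -> exists2 B : set (measurableTypeR R),
    measurable B & g i = \1_B) ->
  (\int[P]_w (\prod_(i < m) g i (X i w))%:E = (\prod_(i < m) e i)%:E)%E.
  move=> /(_ m (leqnn m)) H mg g0 ge.
  pose g' i := if (i < m)%N then g i else \1_(@setT R).
  pose e' i := if (i < m)%N then e i else fine (nu i setT).
  have -> : \prod_(i < m) e i = \prod_(i < m) e' i.
    by apply: eq_bigr => i _; rewrite /e' ltn_ord.
  rewrite -(H g').
  - by apply: eq_integral => w _; congr EFin; apply: eq_bigr => i _; rewrite /g' ltn_ord.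
  - by move=> i; rewrite /g'; case: ifP.
  - by move=> i x; rewrite /g'; case: ifP.
  - move=> i; rewrite /g' /e'; case: ifP => // _.
    rewrite integral_indic// setIT fineK// nuP//.
    by rewrite preimage_setT probability_setT.
  - by move=> i mi; exists setT => //; rewrite /g' ltnNge mi.
elim=> [_|j ih jm] {}g {}e mg g0 ge gB.
  have /boolp.choice[B BE] : forall i, exists Bi : set (measurableTypeR R),
      measurable Bi /\ g i = \1_Bi.
    by move=> i; have [Bi] := gB i (leq0n i); exists Bi.
  have mB i : measurable (B i) by have [] := BE i.
  have gE i : g i = \1_(B i) by have [] := BE i.
  have -> : (\prod_(i < m) e i)%:E = (\prod_(i < m) P (X i @^-1` B i))%E.
    rewrite -prodEFin; apply: eq_bigr => i _.
    by rewrite -ge gE integral_indic// setIT nuP.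
  rewrite -indep//.
  have mI : measurable (\bigcap_(i < m) (X i @^-1` B i)).
    by apply: fin_bigcap_measurable => [|i _]; [exact: finite_II|exact: mXA].
  rewrite -[X in P X]setIT -integral_indic//; apply: eq_integral => w _.
  congr EFin; rewrite indicE; case: (boolP (w \in _)) => [/set_mem wI|wI].
    apply: big1 => i _; rewrite gE indicE mem_set//.
    exact: (wI i (ltn_ord i)).
  apply/eqP/prodf_eq0; apply: contrapT => h.
  move/negP: wI; apply; apply/mem_set => i im.
  apply: contrapT => Bi; apply: h; exists (Ordinal im) => //.
  by rewrite gE indicE memNset.
pose h w := \prod_(i < m | i != Ordinal jm) g i (X i w).
pose c := \prod_(i < m | i != Ordinal jm) e i.
have e0 i : 0 <= e i.
  by rewrite -lee_fin -ge; apply: integral_ge0 => x _; rewrite lee_fin.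
transitivity (\int[P]_w (g j (X j w) * h w)%:E)%E.
  by apply: eq_integral => w _; rewrite (bigD1 (Ordinal jm)).
rewrite (@ge0_integral_density _ _ _ (measurableTypeR R) R P (X j) h (nu j) c)//.
- by rewrite ge -EFinM (bigD1 (Ordinal jm))//= mulrC.
- exact: mX.
- rewrite (_ : h = fun w => \prod_(i <- [seq i <- index_enum 'I_m | i != Ordinal jm])
      g i (X i w)); last by apply/funext => w; rewrite big_filter.
  by apply: measurable_prod => i _; exact: (measurableT_comp (mg i)).
- by move=> w; apply: prodr_ge0.
- move=> B mB.
  pose g' i := if i == j then \1_B else g i.
  pose e' i := if i == j then fine (nu j B) else e i.
  have nujB : nu j B \is a fin_num by rewrite nuP// fin_num_measure//; exact: mXA.
  have := ih (ltnW jm) g' e'.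
  have -> : \prod_(i < m) e' i = fine (nu j B) * c.
    rewrite (bigD1 (Ordinal jm))//= /e' eqxx; congr (_ * _).
    by apply: eq_bigr => i; rewrite -val_eqE/= => /negbTE ->.
  rewrite EFinM fineK// muleC => <-.
  + rewrite integral_mkcond; apply: eq_integral => w _.
    rewrite (bigD1 (Ordinal jm))//= {1}/g' eqxx.
    have -> : \prod_(i < m | i != Ordinal jm) g' i (X i w) = h w.
      by apply: eq_bigr => i; rewrite -val_eqE/= /g' => /negbTE ->.
    rewrite patchE indicE; case: ifPn => xr.
      by rewrite (_ : (X j w \in _) = true) ?mul1r//; move: xr; rewrite !inE.
    rewrite (_ : (X j w \in _) = false) ?mul0r//.
    by apply/negbTE; apply: contra xr; rewrite !inE.
  + by move=> i; rewrite /g'; case: eqVneq => // _; exact: measurable_indic.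
  + by move=> i x; rewrite /g'; case: eqVneq.
  + move=> i; rewrite /g' /e'; case: eqVneq => [->|//].
    by rewrite integral_indic// setIT fineK.
  + move=> i ji; rewrite /g'; case: eqVneq => [_|ij]; first by exists B.
    by apply: gB; rewrite ltn_neqAle eq_sym ij.
- exact: mg.
Qed.

End independent_product.

Section density_measure.
Context d (T : measurableType d) (R : realType) (mu : {measure set T -> \bar R}).
Variable h : T -> R.
Hypothesis mh : measurable_fun setT h.
Hypothesis h0 : forall x, 0 <= h x.

Definition density_measure (A : set T) : \bar R := (\int[mu]_(x in A) (h x)%:E)%E.

Let density_measure0 : density_measure set0 = 0%E.
Proof. by rewrite /density_measure integral_set0. Qed.

Let density_measure_ge0 A : (0 <= density_measure A)%E.
Proof. by apply: integral_ge0 => x _; rewrite lee_fin. Qed.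

Let density_measure_sigma_additive : semi_sigma_additive density_measure.
Proof.
move=> F mF tF mUF; rewrite /density_measure ge0_integral_bigcup//; first last.
- by move=> x _; rewrite lee_fin.
- by apply/measurable_EFinP; exact: measurable_funTS.
apply: is_cvg_ereal_nneg_natsum_cond => n _ _.
by apply: integral_ge0 => x _; rewrite lee_fin.
Qed.

HB.instance Definition _ := isMeasure.Build _ _ _ density_measure
  density_measure0 density_measure_ge0 density_measure_sigma_additive.

End density_measure.

Section tuple_measure.
Context (R : realType) (m : nat).
Local Notation RT := (measurableTypeR R).
Local Notation T := (m.-tuple RT).

Definition box_set (B : nat -> set RT) : set T :=
  [set x | forall i : 'I_m, B i (tnth x i)].

Lemma measurable_box_set B : (forall i, measurable (B i)) -> measurable (box_set B).
Proof.
move=> mB; rewrite (_ : box_set B =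
    \bigcap_(i in [set: 'I_m]) ((fun x : T => tnth x i) @^-1` B i)); last first.
  by apply/seteqP; split => [x xB i _|x xB i]; exact: xB.
apply: fin_bigcap_measurable => [|i _]; first exact: finite_finset.
have mt := @measurable_tnth _ RT m i.
by rewrite -[X in measurable X]setTI; exact: mt.
Qed.

(** Boxes are stable under intersection and generate the sigma-algebra of tuples. Their sides are
    indexed by [nat], as in the independence property of Brownian increments. *)
Lemma box_set_measure_unique (m1 m2 : {measure set T -> \bar R}) :
  (forall B, (forall i, measurable (B i)) -> m1 (box_set B) = m2 (box_set B)) ->
  (m1 setT < +oo)%E -> forall A, measurable A -> m1 A = m2 A.
Proof.
move=> m12 m1T A mA.
pose G : set (set T) := [set A | exists2 B, (forall i, measurable (B i)) & A = box_set B].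
have GT : G setT.
  by exists (fun=> setT) => //; apply/seteqP; split.
apply: (@g_sigma_algebra_measure_unique _ _ _ G _ (fun=> setT)) => //.
- by move=> _ [B mB ->]; exact: measurable_box_set.
- by rewrite bigcup_const.
- move=> _ _ [B mB ->] [C mC ->]; exists (fun i => B i `&` C i).
    by move=> i; exact: measurableI.
  by apply/seteqP; split => [x [xB xC] i|x xBC]; [split; [exact: xB|exact: xC]|];
    split => i; have [] := xBC i.
- by move=> _ [B mB ->]; exact: m12.
- move: A mA; apply: smallest_sub; first exact: smallest_sigma_algebra.
  move=> A; rewrite -bigcup_seq/= => -[i _ [B mB <-]].
  apply: sub_sigma_algebra; exists (fun j : nat => if j == i :> nat then B else setT).
    by move=> j; case: ifP.
  apply/seteqP; split => [x [_ /= xB] j|x xB].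
    by case: eqP => // /val_inj ->.
  by split => //; have := xB i; rewrite eqxx.
Qed.

End tuple_measure.

Section total_variation.
Context d (Omega : measurableType d) (R : realType) (P : probability Omega R).
Variables (m : nat) (X : nat -> Omega -> R) (a : nat -> R) (q : nat -> R).
Variable nu : nat -> {measure set (measurableTypeR R) -> \bar R}.
Variable D : nat -> R -> R.
Hypothesis mX : forall i, measurable_fun setT (X i).
Hypothesis nuP : forall i (B : set (measurableTypeR R)), measurable B ->
  nu i B = P (X i @^-1` B).
Hypothesis indep : forall B : nat -> set (measurableTypeR R),
  (forall i, measurable (B i)) ->
  P (\bigcap_(i < m) (X i @^-1` B i)) = (\prod_(i < m) P (X i @^-1` B i))%E.
Hypothesis mD : forall i, measurable_fun setT (D i).
Hypothesis D0 : forall i x, 0 <= D i x.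
Hypothesis shiftD : forall i (g : R -> R), measurable_fun setT g -> (forall x, 0 <= g x) ->
  (\int[nu i]_x (g x * D i x)%:E = \int[nu i]_x (g ((x : R) + a i))%:E)%E.
Hypothesis D2 : forall i, (\int[nu i]_x (D i x ^+ 2)%:E = (q i)%:E)%E.

Local Notation RT := (measurableTypeR R).
Let Xt (w : Omega) : m.-tuple RT := [tuple X i w | i < m].
Let Xa (w : Omega) : m.-tuple RT := [tuple X i w + a i | i < m].
Let h (w : Omega) : R := \prod_(i < m) D i (X i w).

Let mXt : measurable_fun setT Xt.
Proof.
apply/measurable_fun_tnthP => i; rewrite (_ : _ \o _ = X i); first exact: mX.
by apply/funext => w /=; rewrite tnth_mktuple.
Qed.

Let mXa : measurable_fun setT Xa.
Proof.
apply/measurable_fun_tnthP => i; rewrite (_ : _ \o _ = fun w => X i w + a i).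
  by apply: measurable_funD => //; exact: mX.
by apply/funext => w /=; rewrite tnth_mktuple.
Qed.

Let mh : measurable_fun setT h.
Proof. by apply: measurable_prod => i _; apply: (measurableT_comp (mD i)); exact: mX. Qed.

Let h0 w : 0 <= h w.
Proof. by apply: prodr_ge0 => i _. Qed.

Let nuT i : nu i setT = 1%E.
Proof. by rewrite nuP//; exact: probability_setT. Qed.

(** Girsanov's formula in finite dimension: the shifted tuple has the law of the original one under
    the measure of density [h]. On boxes both sides factor, by independence and by [shiftD] in each
    coordinate. *)
Let integral_hA A : measurable A -> P (Xa @^-1` A) = (\int[P]_(w in Xt @^-1` A) (h w)%:E)%E.
Proof.
move=> mA.
apply: (@box_set_measure_unique R m (pushforward P Xa) (pushforward (density_measure P h) Xt)) => //; last first.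
  by rewrite -[X in (X < _)%E]/(P setT) probability_setT ltry.
move=> B mB; rewrite /pushforward /density_measure.
have mXaB i : measurable ((fun x : RT => x + a i) @^-1` B i).
  have ma : measurable_fun setT (fun x : RT => x + a i : RT) by apply: measurable_funD.
  by rewrite -[X in measurable X]setTI; exact: ma.
have XaE : Xa @^-1` box_set B = \bigcap_(i < m) (X i @^-1` ((fun x => x + a i) @^-1` B i)).
  apply/seteqP; split => [w wB i /= im|w wB i].
    by have := wB (Ordinal im); rewrite tnth_mktuple.
  by rewrite tnth_mktuple; exact: (wB i (ltn_ord i)).
transitivity (P (\bigcap_(i < m) (X i @^-1` ((fun x => x + a i) @^-1` B i)))).
  by rewrite -XaE.
rewrite indep//.
pose g i x := \1_(B i) x * D i x.
have mg i : measurable_fun setT (g i).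
  by apply: measurable_funM => //; exact: mD.
have g0 i x : 0 <= g i x by rewrite mulr_ge0.
have ge i : (\int[nu i]_x (g i x)%:E =
    (fine (P (X i @^-1` ((fun x => x + a i) @^-1` B i))))%:E)%E.
  rewrite (@shiftD i (\1_(B i)))//; last by apply: measurable_indic; exact: mB.
  rewrite fineK; last first.
    rewrite fin_num_measure// -[X in measurable X]setTI; apply: mX => //.
    exact: mXaB.
  transitivity (nu i ((fun x : RT => x + a i) @^-1` B i)); last exact: nuP.
  rewrite -[X in nu i X]setIT -integral_indic//.
transitivity (\int[P]_w (\prod_(i < m) g i (X i w))%:E)%E.
  rewrite (integral_indep_prod mX nuP indep mg g0 ge) -prodEFin.
  apply: eq_bigr => i _; rewrite fineK// fin_num_measure//.
  by rewrite -[X in measurable X]setTI; apply: mX => //; exact: mXaB.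
rewrite [RHS]integral_mkcond; apply: eq_integral => w _.
rewrite big_split/= patchE; case: ifPn => [/set_mem wB|wB].
  rewrite big1 ?mul1r// => i _; rewrite indicE mem_set//.
  by have := wB i; rewrite tnth_mktuple.
rewrite (_ : \prod_(i < m) \1_(B i) (X i w) = 0) ?mul0r//.
apply/eqP/prodf_eq0; apply: contrapT => hi.
move/negP: wB; apply; apply/mem_set => i; rewrite tnth_mktuple.
by apply: contrapT => Bi; apply: hi; exists i => //; rewrite indicE memNset.
Qed.

(** The difference of the two probabilities is the integral of h - 1 over an event, and E (h - 1)^2
    = E h^2 - 1, where E h^2 is the product of the [q i]. The free parameter [theta] replaces the
    square root of Cauchy-Schwarz. *)
Lemma tv_shift_le A (theta : R) : measurable A -> 0 < theta ->
  (P (Xa @^-1` A) <= P (Xt @^-1` A) +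
     (theta / 2 + (\prod_(i < m) q i - 1) / (2 * theta))%:E)%E.
Proof.
move=> mA t0; rewrite integral_hA//.
have mXtA : measurable (Xt @^-1` A) by rewrite -[X in measurable X]setTI; exact: mXt.
have Eh : (\int[P]_w (h w)%:E = 1)%E.
  have ge i : (\int[nu i]_x (D i x)%:E = 1%:E)%E.
    transitivity (\int[nu i]_x (cst 1 x * D i x)%:E)%E.
      by apply: eq_integral => x _; rewrite mul1r.
    rewrite shiftD// -[LHS]/(\int[nu i]_x cst 1%:E x)%E integral_cst//.
    by rewrite mul1e; exact: nuT.
  by rewrite (integral_indep_prod mX nuP indep mD D0 ge) big1.
have Eh2 : (\int[P]_w (h w ^+ 2)%:E = (\prod_(i < m) q i)%:E)%E.
  have mD2 i : measurable_fun setT (fun x => D i x ^+ 2) by exact: measurable_funX.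
  have D20 i x : 0 <= D i x ^+ 2 by rewrite sqr_ge0.
  rewrite -(integral_indep_prod mX nuP indep mD2 D20 D2).
  by apply: eq_integral => w _; rewrite /h prodrXl.
have mhE : measurable_fun setT (EFin \o h) by exact/measurable_EFinP.
pose IA := (\int[P]_(w in Xt @^-1` A) (h w)%:E)%E.
pose i1 (w : Omega) : R := \1_(Xt @^-1` A) w.
have mi1 : measurable_fun setT i1 by exact: measurable_indic.
have i10 w : 0 <= i1 w by [].
have ti0 : 0 < theta^-1 by rewrite invr_gt0.
have IAE : IA = (\int[P]_w (i1 w * h w)%:E)%E.
  rewrite /IA integral_mkcond; apply: eq_integral => w _.
  by rewrite patchE /i1 indicE; case: ifPn => _; rewrite ?mul1r ?mul0r.
(* The term h / theta coming from (h - 1)^2 is moved to the left, so that both integrands are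
   nonnegative and nothing has to be subtracted. *)
have int1 : (\int[P]_w (i1 w * h w + theta^-1 * h w)%:E = IA + (theta^-1)%:E)%E.
  under eq_integral do rewrite EFinD.
  rewrite ge0_integralD//; last 4 first.
  - by move=> w _; rewrite lee_fin mulr_ge0.
  - by apply/measurable_EFinP; exact: measurable_funM.
  - by move=> w _; rewrite lee_fin mulr_ge0// ltW.
  - by apply/measurable_EFinP; exact: measurable_funM.
  rewrite -IAE; congr (_ + _)%E; under eq_integral do rewrite EFinM.
  by rewrite ge0_integralZl ?Eh ?mule1// ?lee_fin ?(ltW ti0)// => w _; rewrite lee_fin.
have mh2 : measurable_fun setT (fun w => h w ^+ 2) by exact: measurable_funX.
pose k := theta / 2 + theta^-1 / 2.
have k0 : 0 <= k by rewrite addr_ge0// divr_ge0// ltW.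
have int2 : (\int[P]_w (i1 w + (k + theta^-1 / 2 * h w ^+ 2))%:E =
    P (Xt @^-1` A) + (k + theta^-1 / 2 * \prod_(i < m) q i)%:E)%E.
  have t20 : 0 <= theta^-1 / 2 by rewrite divr_ge0// ltW.
  under eq_integral do rewrite EFinD.
  rewrite ge0_integralD//; last 3 first.
  - by apply/measurable_EFinP.
  - by move=> w _; rewrite lee_fin addr_ge0// mulr_ge0// sqr_ge0.
  - by apply/measurable_EFinP/measurable_funD => //; exact: measurable_funM.
  rewrite integral_indic// setIT; congr (_ + _)%E.
  under eq_integral do rewrite EFinD.
  rewrite ge0_integralD//; last 2 first.
  - by move=> w _; rewrite lee_fin mulr_ge0// sqr_ge0.
  - by apply/measurable_EFinP; exact: measurable_funM.
  rewrite [RHS]EFinD; congr (_ + _)%E.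
    rewrite -[LHS]/(\int[P]_w cst k%:E w)%E integral_cst// -[RHS]mule1; congr (_ * _)%E.
    exact: probability_setT.
  under eq_integral do rewrite EFinM.
  rewrite ge0_integralZl//; first by rewrite Eh2 EFinM.
  - exact/measurable_EFinP.
  - by move=> w _; rewrite lee_fin sqr_ge0.
  - by move=> w _; rewrite lee_fin.
(* AM-GM: [h - 1 <= theta / 2 + (h - 1)^2 / (2 theta)] *)
have le12 : (IA + (theta^-1)%:E <= P (Xt @^-1` A) + (k + theta^-1 / 2 * \prod_(i < m) q i)%:E)%E.
  rewrite -int1 -int2; apply: ge0_le_integral => //.
  - by move=> w _; rewrite lee_fin addr_ge0// mulr_ge0// ltW.
  - by apply/measurable_EFinP/measurable_funD; exact: measurable_funM.
  - apply/measurable_EFinP/measurable_funD => //; apply/measurable_funD => //.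
    exact: measurable_funM.
  - move=> w _; rewrite lee_fin /k.
    have hw1 := mulr_ge0 (ltW ti0) (sqr_ge0 (h w - 1)).
    have := mulr_ge0 (ltW ti0) (sqr_ge0 (h w - 1 - theta)).
    have -> : theta^-1 * (h w - 1 - theta) ^+ 2 =
        theta^-1 * (h w - 1) ^+ 2 - 2 * (h w - 1) + theta by field; rewrite gt_eqF.
    by rewrite /i1 indicE; case: (_ \in _) => /= hw2; lra.
rewrite -(@leeD2rE _ (theta^-1)%:E)//; apply: (le_trans le12).
rewrite -addeA -EFinD leeD2lE ?fin_num_measure// lee_fin /k le_eqVlt.
by apply/orP; left; apply/eqP; field; rewrite gt_eqF.
Qed.

End total_variation.

Section quadratic_expansion.
Context d (T : measurableType d) (R : realType) (mu : {measure set T -> \bar R}).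

Lemma Rintegral_sum (D : set T) n (F : nat -> T -> R) : measurable D ->
  (forall i, (i < n)%N -> mu.-integrable D (EFin \o F i)) ->
  mu.-integrable D (fun x => (\sum_(i < n) F i x)%:E) /\
  \int[mu]_(x in D) (\sum_(i < n) F i x) = \sum_(i < n) \int[mu]_(x in D) F i x.
Proof.
move=> mD; elim: n => [|n ih] iF.
  under eq_fun do rewrite big_ord0; split; first exact: integrable0.
  under eq_Rintegral do rewrite big_ord0.
  by rewrite big_ord0 /Rintegral integral0.
have [ih1 ih2] := ih (fun i ni => iF i (ltnW ni)).
have iFn := iF n (ltnSn n).
under eq_fun do rewrite big_ord_recr/= EFinD.
split; first by apply: integrableD.
under eq_Rintegral do rewrite big_ord_recr/=.
by rewrite RintegralD// big_ord_recr/= ih2.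
Qed.

Lemma integrable_dot_sum m m' (c c' : nat -> T -> R) (v v' : nat -> L2 R) :
  (forall i j, mu.-integrable setT (fun x => (c i x * c' j x)%:E)) ->
  mu.-integrable setT
    (fun x => (dot (\sum_(i < m) c i x *: v i) (\sum_(j < m') c' j x *: v' j))%:E) /\
  \int[mu]_x (dot (\sum_(i < m) c i x *: v i) (\sum_(j < m') c' j x *: v' j)) =
  \sum_(i < m) \sum_(j < m') dot (v i) (v' j) * \int[mu]_x (c i x * c' j x).
Proof.
move=> icc.
have icd i j : mu.-integrable setT (fun x => (dot (v i) (v' j) * (c i x * c' j x))%:E).
  by under eq_fun do rewrite EFinM; apply: integrableZl => //; exact: icc.
have dE x : dot (\sum_(i < m) c i x *: v i) (\sum_(j < m') c' j x *: v' j) =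
    \sum_(i < m) \sum_(j < m') dot (v i) (v' j) * (c i x * c' j x).
  rewrite dot_suml; apply: eq_bigr => i _; rewrite dotZl dot_sumr mulr_sumr.
  by apply: eq_bigr => j _; rewrite dotZr mulrA mulrC.
have H i := @Rintegral_sum setT m' (fun j x => dot (v i) (v' j) * (c i x * c' j x))
  measurableT (fun j _ => icd i j).
have [i1 i2] := @Rintegral_sum setT m
  (fun i x => \sum_(j < m') dot (v i) (v' j) * (c i x * c' j x)) measurableT (fun i _ => (H i).1).
under eq_fun do rewrite dE.
under eq_Rintegral do rewrite dE.
split => //; rewrite i2; apply: eq_bigr => i _; rewrite (H i).2.
by apply: eq_bigr => j _; rewrite RintegralZl//; exact: icc.
Qed.

(** The expansion sees the measure only through the integrals of products of coefficients. Two
    measures with proportional integrals of this kind therefore yield an isometry. *)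
Lemma integrable_L2norm_sum m m' (c c' : nat -> T -> R) (v v' : nat -> L2 R) :
  (forall i j, mu.-integrable setT (fun x => (c i x * c j x)%:E)) ->
  (forall i j, mu.-integrable setT (fun x => (c i x * c' j x)%:E)) ->
  (forall i j, mu.-integrable setT (fun x => (c' i x * c' j x)%:E)) ->
  (\int[mu]_x (L2norm (\sum_(i < m) c i x *: v i - \sum_(j < m') c' j x *: v' j) ^+ 2)%:E =
   (\sum_(i < m) \sum_(j < m) dot (v i) (v j) * \int[mu]_x (c i x * c j x) -
    2 * (\sum_(i < m) \sum_(j < m') dot (v i) (v' j) * \int[mu]_x (c i x * c' j x)) +
    \sum_(i < m') \sum_(j < m') dot (v' i) (v' j) * \int[mu]_x (c' i x * c' j x))%:E)%E.
Proof.
move=> icc icc' ic'c'.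
have [i1 e1] := integrable_dot_sum m m v v icc.
have [i2 e2] := integrable_dot_sum m m' v v' icc'.
have [i3 e3] := integrable_dot_sum m' m' v' v' ic'c'.
rewrite -e1 -e2 -e3.
set A := fun x => \sum_(i < m) c i x *: v i; set B := fun x => \sum_(j < m') c' j x *: v' j.
have i22 : mu.-integrable setT (fun x => (2 * dot (A x) (B x))%:E).
  by under eq_fun do rewrite EFinM; exact: integrableZl.
have i12 : mu.-integrable setT (fun x => (dot (A x) (A x) - 2 * dot (A x) (B x))%:E).
  by under eq_fun do rewrite EFinB; exact: integrableB.
rewrite -RintegralZl// -RintegralB// -RintegralD// /Rintegral fineK.
  apply: eq_integral => x _; rewrite L2normE -/(A x) -/(B x).
  by rewrite !dotBl dotC dotBl (dotC (B x) (A x - _)) dotBl (dotC (B x) (A x)); congr EFin; ring.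
apply: integrable_fin_num => //.
by under eq_fun do rewrite EFinD; exact: integrableD.
Qed.

End quadratic_expansion.

Lemma lebesgue_measure_co (R : realType) (x y : R) :
  lebesgue_measure (`[x, y[%classic : set (measurableTypeR R)) = (Num.max 0 (y - x))%:E.
Proof.
have := lebesgue_measure_itv `[x, y[; rewrite /= lte_fin => e.
transitivity (if x < y then (y%:E - x%:E)%E else 0%E); first exact: e.
case: ifPn => xy; first by rewrite -EFinB max_r// subr_ge0 ltW.
by rewrite max_l// subr_le0 leNgt.
Qed.

(** * Isometry for integrals of step functions *)

Section brownian_isometry.
Context d (Omega : measurableType d) (R : realType) (P : probability Omega R).
Variable W : R -> Omega -> R.
Hypothesis BM : brownian_motion P W.

Lemma measurable_increment a b : 0 <= a -> 0 <= b ->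
  measurable_fun setT (increment W a b).
Proof. by move=> a0 b0; apply: measurable_funB; exact: (bm_measurable BM). Qed.

Local Notation kappa := (gaussian_moment2 R).

Lemma increment_moment2 a b : 0 <= a -> a <= b ->
  (\int[P]_w ((increment W a b w) ^+ 2)%:E = ((b - a) * kappa)%:E)%E.
Proof.
move=> a0; rewrite le_eqVlt => /predU1P[->|ab].
  under eq_integral do rewrite /increment subrr expr0n/=.
  by rewrite integral0 subrr mul0r.
have b0 : 0 <= b by rewrite (le_trans a0)// ltW.
have m2 : measurable_fun setT (fun x : R => x ^+ 2) by exact: measurable_funX.
transitivity (\int[P]_w ((increment W a b w) ^+ 2 * cst 1 w)%:E)%E.
  by apply: eq_integral => w _; rewrite mulr1.
rewrite (@ge0_integral_density _ _ _ (measurableTypeR R) R P (increment W a b) (cst 1)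
  (normal_prob 0 (Num.sqrt (b - a))) 1 _ _ _ _ (fun x => x ^+ 2))//.
- rewrite mul1e normal_prob_moment2 ?sqrtr_gt0 ?subr_gt0//.
  by rewrite sqr_sqrtr// subr_ge0 ltW.
- exact: measurable_increment.
- move=> B mB; rewrite -[LHS]/(\int[P]_(x in _) cst 1%:E x)%E integral_cst.
    by rewrite !mul1e; exact: (bm_gaussian BM).
  by rewrite -[X in measurable X]setTI; exact: measurable_increment.
- by move=> x; exact: sqr_ge0.
Qed.

Lemma integrable_increment_mul a b a' b' : 0 <= a -> a <= b -> 0 <= a' -> a' <= b' ->
  P.-integrable setT (fun w => (increment W a b w * increment W a' b' w)%:E).
Proof.
move=> a0 ab a'0 a'b'.
have b0 := le_trans a0 ab; have b'0 := le_trans a'0 a'b'.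
have isq c e : 0 <= c -> c <= e ->
    P.-integrable setT (fun w => ((increment W c e w) ^+ 2)%:E).
  move=> c0 ce; apply/integrableP; split.
    apply/measurable_EFinP; apply: measurable_funX; apply: measurable_increment => //.
    exact: le_trans ce.
  under eq_integral do rewrite /= ger0_norm ?sqr_ge0//.
  by rewrite increment_moment2// ltry.
apply: (@le_integrable _ _ _ P setT _ _ (fun w =>
  (((increment W a b w) ^+ 2)%:E + ((increment W a' b' w) ^+ 2)%:E)%E)) => //.
- by apply/measurable_EFinP; apply: measurable_funM; exact: measurable_increment.
- move=> w _; rewrite -EFinD !abse_EFin lee_fin.
  rewrite [leRHS]ger0_norm ?addr_ge0 ?sqr_ge0//.
  set x := increment W a b w; set y := increment W a' b' w.
  have := sqr_ge0 (x - y); have := sqr_ge0 (x + y).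
  have := sqr_ge0 x; have := sqr_ge0 y.
  by rewrite ler_norml; nra.
- by apply: integrableD => //; exact: isq.
Qed.

(** Polarization: with increments taken from time 0, 2 W_s W_t = W_s^2 + W_t^2 - (W_t - W_s)^2, so
    covariances follow from variances. *)
Lemma increment_cov0 s t : 0 <= s -> 0 <= t ->
  \int[P]_w (increment W 0 s w * increment W 0 t w) = Num.min s t * kappa.
Proof.
wlog st : s t / s <= t.
  move=> H s0 t0; have [st|/ltW ts] := leP s t; first by rewrite H// min_l.
  transitivity (Num.min t s * kappa); last by rewrite min_l.
  rewrite -(H _ _ ts t0 s0).
  by apply: eq_Rintegral => w _; rewrite mulrC.
move=> s0 t0; rewrite min_l//.
have i0 u : 0 <= u -> P.-integrable setT (fun w => (increment W 0 u w ^+ 2)%:E).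
  by move=> u0; under eq_fun do rewrite expr2; exact: integrable_increment_mul.
have ist : P.-integrable setT (fun w => (increment W s t w ^+ 2)%:E).
  by under eq_fun do rewrite expr2; exact: integrable_increment_mul.
have E2 a b : 0 <= a -> a <= b -> \int[P]_w (increment W a b w ^+ 2) = (b - a) * kappa.
  by move=> ? ?; rewrite /Rintegral increment_moment2.
transitivity (\int[P]_w (2^-1 * (increment W 0 s w ^+ 2 + increment W 0 t w ^+ 2 -
    increment W s t w ^+ 2))).
  by apply: eq_Rintegral => w _; rewrite /increment; field.
have iD : P.-integrable setT (fun w => (increment W 0 s w ^+ 2 + increment W 0 t w ^+ 2)%:E).
  by under eq_fun do rewrite EFinD; apply: integrableD => //; exact: i0.
have iB : P.-integrable setT (fun w => (increment W 0 s w ^+ 2 + increment W 0 t w ^+ 2 -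
    increment W s t w ^+ 2)%:E).
  by under eq_fun do rewrite EFinB; apply: integrableB.
rewrite RintegralZl// RintegralB// RintegralD//; [|exact: i0..].
by rewrite !E2//; field.
Qed.

(** By bilinearity the covariance is [kappa] times a combination of four minima, which is the length
    of the intersection of the two intervals. *)
Lemma increment_cov a b a' b' : 0 <= a -> a <= b -> 0 <= a' -> a' <= b' ->
  \int[P]_w (increment W a b w * increment W a' b' w) =
  kappa * \int[@lebesgue_measure R]_r
    ((\1_`[a, b[ r : R) * \1_`[a', b'[ r).
Proof.
move=> a0 ab a'0 a'b'.
have b0 := le_trans a0 ab; have b'0 := le_trans a'0 a'b'.
have im s t : 0 <= s -> 0 <= t ->
    P.-integrable setT (fun w => (increment W 0 s w * increment W 0 t w)%:E).
  by move=> s0 t0; exact: integrable_increment_mul.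
transitivity (\int[P]_w
   ((increment W 0 b w * increment W 0 b' w - increment W 0 b w * increment W 0 a' w) -
    (increment W 0 a w * increment W 0 b' w - increment W 0 a w * increment W 0 a' w))).
  by apply: eq_Rintegral => w _; rewrite /increment; ring.
have iB s t u : 0 <= s -> 0 <= t -> 0 <= u -> P.-integrable setT (fun w =>
    (increment W 0 s w * increment W 0 t w - increment W 0 s w * increment W 0 u w)%:E).
  by move=> s0 t0 u0; under eq_fun do rewrite EFinB; apply: integrableB => //; exact: im.
rewrite RintegralB//; [|exact: iB..].
rewrite !RintegralB//; [|exact: im..].
rewrite !increment_cov0//.
have -> : \int[@lebesgue_measure R]_r ((\1_`[a, b[ r : R) * \1_`[a', b'[ r) =
    Num.max 0 (Num.min b b' - Num.max a a').
  transitivity (\int[@lebesgue_measure R]_r (\1_`[Num.max a a', Num.min b b'[ r : R)).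
    apply: eq_Rintegral => r _; rewrite !indicE -natrM mulnb; congr (_%:R).
    rewrite -in_setI; congr (nat_of_bool (_ \in _)).
    apply/seteqP; split => x /=; rewrite !in_itv/= ge_max lt_min.
      by move=> [/andP[-> ->] /andP[-> ->]].
    by move=> /andP[/andP[-> ->] /andP[-> ->]].
  rewrite /Rintegral integral_indic// setIT.
  transitivity (fine ((Num.max 0 (Num.min b b' - Num.max a a'))%:E)) => //.
  congr fine; exact: lebesgue_measure_co.
rewrite -!mulrBl mulrC; congr (_ * _).
rewrite /Num.max /Num.min.
case: (ltP b b'); case: (ltP b a'); case: (ltP a b'); case: (ltP a a') => *;
  case: ltP => *; lra.
Qed.

(** Covariances are known for arbitrary pairs of intervals, so the two subdivisions need no common
    refinement. *)
Lemma step_isometry (t : R) (S S' : step R) : step_on t S -> step_on t S' ->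
  (\int[P]_w (L2norm (step_integral W S w - step_integral W S' w) ^+ 2)%:E =
   kappa%:E * \int[@lebesgue_measure R]_r
     (L2norm (step_fun S r - step_fun S' r) ^+ 2)%:E)%E.
Proof.
move=> [S0 St Sm] [S'0 S't S'm].
have n0 i : 0 <= step_node S i by rewrite -S0 Sm.
have n'0 i : 0 <= step_node S' i by rewrite -S'0 S'm.
have nS i : step_node S i <= step_node S i.+1 by rewrite Sm.
have nS' i : step_node S' i <= step_node S' i.+1 by rewrite S'm.
have iI (I J : set (measurableTypeR R)) : measurable I -> measurable J ->
    (lebesgue_measure I < +oo)%E ->
    (@lebesgue_measure R).-integrable setT (fun r => ((\1_I r : R) * \1_J r)%:E).
  move=> mI mJ Ioo; under eq_fun do rewrite indicE indicE -natrM mulnb -in_setI -indicE.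
  apply/integrableP; split.
    by apply/measurable_EFinP; apply: measurable_indic; exact: measurableI.
  under eq_integral do rewrite /= ger0_norm//.
  rewrite integral_indic ?setIT//; last exact: measurableI.
  by rewrite (le_lt_trans _ Ioo)// le_measure ?inE//; exact: measurableI.
have loo (x y : R) : (lebesgue_measure (`[x, y[%classic : set (measurableTypeR R)) < +oo)%E.
  by rewrite lebesgue_measure_co ltry.
rewrite /step_integral /step_fun.
rewrite (integrable_L2norm_sum (mu := P) _ _
  (c := fun i => increment W (step_node S i) (step_node S i.+1))
  (c' := fun i => increment W (step_node S' i) (step_node S' i.+1))
  (step_val S) (step_val S')); [|by move=> *; exact: integrable_increment_mul..].
rewrite (integrable_L2norm_sum (mu := @lebesgue_measure R) _ _
  (c := fun i => \1_(`[step_node S i, step_node S i.+1[%classic))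
  (c' := fun i => \1_(`[step_node S' i, step_node S' i.+1[%classic))
  (step_val S) (step_val S')); [|by move=> *; apply: iI => //; exact: loo..].
rewrite -EFinM; congr EFin; rewrite mulrDr mulrBr mulrCA; congr (_ - _ * _ + _);
  rewrite mulr_sumr; apply: eq_bigr => i _; rewrite mulr_sumr; apply: eq_bigr => j _;
  by rewrite increment_cov// mulrCA.
Qed.

End brownian_isometry.

Section brownian_shift.
Context d (Omega : measurableType d) (R : realType) (P : probability Omega R).
Variable W : R -> Omega -> R.
Hypothesis BM : brownian_motion P W.
Local Notation RT := (measurableTypeR R).

(** The second moment of the density is the product of the exp (a_i^2 / (t_{i+1} - t_i)); the bound
    on [a] makes each exponent at most B^2 (t_{i+1} - t_i), and these telescope. The estimate is
    thus independent of the fineness of the subdivision. *)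
Lemma increment_tv_le (t : nat -> R) (m : nat) (a : nat -> R) (B theta : R)
    (A : set (m.-tuple RT)) : 0 <= t 0%N -> {homo t : i j / (i <= j)%N >-> i <= j} ->
  (forall i, `|a i| <= B * (t i.+1 - t i)) -> 0 < theta -> measurable A ->
  (P [set w | A [tuple (increment W (t i) (t i.+1) w + a i)%R | i < m]] <=
   P [set w | A [tuple increment W (t i) (t i.+1) w | i < m]] +
   (theta / 2 + (expR (B ^+ 2 * (t m - t 0%N)) - 1) / (2 * theta))%:E)%E.
Proof.
move=> t0 tm aB th0 mA.
have tS i : t i <= t i.+1 by apply: tm.
have t_ge0 i : 0 <= t i by rewrite (le_trans t0)// tm.
pose X i := increment W (t i) (t i.+1).
pose sg i := Num.sqrt (t i.+1 - t i).
have sg0 i : t i < t i.+1 -> sg i != 0.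
  by move=> h; rewrite gt_eqF// sqrtr_gt0 subr_gt0.
have sg2 i : sg i ^+ 2 = t i.+1 - t i by rewrite sqr_sqrtr// subr_ge0.
(* Nodes may coincide. The increment is then 0, its law is a Dirac mass, and the bound on [a] forces
   the shift to vanish. *)
pose nu i : {measure set RT -> \bar R} :=
  if t i < t i.+1 then (normal_prob 0 (sg i) : {measure set RT -> \bar R})
  else (dirac (0 : RT) : {measure set RT -> \bar R}).
pose D i : R -> R := if t i < t i.+1 then shift_density (sg i) (a i) else cst 1.
pose q i : R := if t i < t i.+1 then expR (a i ^+ 2 / sg i ^+ 2) else 1.
have a0 i : ~~ (t i < t i.+1) -> a i = 0.
  rewrite -leNgt => h; have e : t i.+1 = t i by apply/eqP; rewrite eq_le h tS.
  by have := aB i; rewrite e subrr mulr0 normr_le0 => /eqP.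
have mX i : measurable_fun setT (X i) by apply: (measurable_increment BM); exact: t_ge0.
have nuP i (C : set RT) : measurable C -> nu i C = P (X i @^-1` C).
  move=> mC; rewrite /nu; case: ifPn => [h|].
    by rewrite /X (bm_gaussian BM).
  rewrite -leNgt => h; have e : t i.+1 = t i by apply/eqP; rewrite eq_le h tS.
  have X0 w : X i w = 0 by rewrite /X /increment e subrr.
  rewrite /= diracE; case: (boolP (0 \in C)) => C0.
    rewrite (_ : X i @^-1` C = setT); last first.
      by apply/seteqP; split => // w _ /=; rewrite X0; exact: set_mem.
    by apply/esym; exact: probability_setT.
  rewrite (_ : X i @^-1` C = set0) ?measure0//.
  by apply/seteqP; split => // w /=; rewrite X0 => /mem_set; rewrite (negbTE C0).
have indep (C : nat -> set RT) : (forall i, measurable (C i)) ->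
    P (\bigcap_(i < m) (X i @^-1` C i)) = (\prod_(i < m) P (X i @^-1` C i))%E.
  by move=> mC; exact: (bm_independent BM).
have mD i : measurable_fun setT (D i).
  by rewrite /D; case: ifP => _ //; exact: measurable_shift_density.
have D0 i x : 0 <= D i x by rewrite /D; case: ifP => _ //; exact: expR_ge0.
have shiftD i (g : R -> R) : measurable_fun setT g -> (forall x, 0 <= g x) ->
    (\int[nu i]_x (g x * D i x)%:E = \int[nu i]_x (g ((x : R) + a i))%:E)%E.
  move=> mg g0; rewrite /nu /D; case: ifPn => h.
    by rewrite integral_shift_density_mul// sg0.
  by apply: eq_integral => x _; rewrite (a0 _ h) addr0 mulr1.
have D2 i : (\int[nu i]_x (D i x ^+ 2)%:E = (q i)%:E)%E.
  rewrite /nu /D /q; case: ifPn => h; first by rewrite integral_shift_density_sqr// sg0.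
  under eq_integral do rewrite expr1n.
  rewrite -[LHS]/(\int[dirac (0%R : RT)]_x cst 1%:E x)%E integral_cst// mul1e.
  by rewrite /= diracT.
apply: le_trans (tv_shift_le (q := q) mX nuP indep mD D0 shiftD D2 mA th0) _.
rewrite leeD2lE ?fin_num_measure//; last first.
  have mT : measurable_fun setT (fun w => [tuple X i w | i < m] : m.-tuple RT).
    apply/measurable_fun_tnthP => i; rewrite (_ : _ \o _ = X i); first exact: mX.
    by apply/funext => w /=; rewrite tnth_mktuple.
  by rewrite -[X in measurable X]setTI; exact: mT.
rewrite lee_fin lerD2l ler_wpM2r ?invr_ge0 ?mulr_ge0 ?(ltW th0)// lerD2r.
have -> : B ^+ 2 * (t m - t 0%N) = \sum_(i < m) B ^+ 2 * (t i.+1 - t i).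
  rewrite -mulr_sumr -(big_mkord predT (fun i => t i.+1 - t i)).
  by rewrite telescope_sumr.
rewrite expR_sum; apply: ler_prod => i _; rewrite /q.
case: ifPn => h; last first.
  by rewrite ler01 -expR0 ler_expR mulr_ge0 ?sqr_ge0 ?subr_ge0.
rewrite expR_ge0 ler_expR sg2 ler_pdivrMr ?subr_gt0// -mulrA -expr2 -exprMn.
have := aB i; rewrite -ler_sqr ?nnegrE ?real_normK ?num_real//.
by apply: le_trans (aB i).
Qed.

End brownian_shift.

(** * Borel sets of L2(0,1) *)

Section L2_borel.
Variable R : realType.
Implicit Types (x y : L2 R) (O : set (L2 R)).

Lemma L2_openP O : open O <->
  forall x, O x -> exists2 e, 0 < e & forall y, L2norm (x - y) < e -> O y.
Proof.
rewrite openE; split => [oO x /oO|H x /H[e e0 h]].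
  by rewrite /interior => /nbhs_ballP[e /= e0 h]; exists e => // y xy; exact: h.
by apply/nbhs_ballP; exists e => // y; exact: h.
Qed.

Lemma L2normBD x y z : L2norm (x - z) <= L2norm (x - y) + L2norm (y - z).
Proof. by rewrite (le_trans _ (L2normD _ _))// addrA subrK. Qed.

(** These sets are closed and, for open [O], increase to [O] as [r] decreases to 0. Moving a point
    by at most b leads from radius a + b to radius a, which is how L2 errors are accounted for. *)
Definition shrink O (r : R) : set (L2 R) := [set x | forall y, L2norm (x - y) < r -> O y].

Lemma closed_shrink O r : closed (shrink O r).
Proof.
rewrite -openC; apply/L2_openP => x /existsNP[y /not_implyP[xy Oy]].
exists (r - L2norm (x - y)); first by rewrite subr_gt0.
move=> z xz /(_ y) h; apply: Oy; apply: h.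
by rewrite (le_lt_trans (L2normBD _ x _))// L2normB -ltrBrDr.
Qed.

Lemma shrink_sub O r : 0 < r -> shrink O r `<=` O.
Proof. by move=> r0 x; apply; rewrite subrr L2norm0. Qed.

Lemma bigcup_shrink O : open O -> \bigcup_n shrink O n.+1%:R^-1 = O.
Proof.
move=> /L2_openP oO; apply/seteqP; split => [x [n _]|x Ox].
  by apply: shrink_sub; rewrite invr_gt0.
have [e e0 h] := oO _ Ox.
have [n ne] : exists n, n.+1%:R^-1 < e.
  have /cvgrPdist_lt/(_ _ e0)[n _ /(_ n (leqnn _))] := @cvg_harmonic R.
  rewrite sub0r normrN ger0_norm ?harmonic_ge0// => ne.
  by exists n.
by exists n => // y xy; apply: h; exact: lt_trans ne.
Qed.

Lemma shrink_le O r s : r <= s -> shrink O s `<=` shrink O r.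
Proof. by move=> rs x h y xy; apply: h; exact: lt_le_trans rs. Qed.

Lemma L2_measurable_open O : open O -> measurable (O : set (L2borel R)).
Proof. by move=> oO; exact: sub_sigma_algebra. Qed.

Lemma L2_measurable_closed O : closed O -> measurable (O : set (L2borel R)).
Proof.
move=> cO; rewrite -(setCK O); apply: measurableC; apply: L2_measurable_open.
by rewrite openC.
Qed.

Lemma cvg_fin_num_dist (u : nat -> \bar R) (l : \bar R) (e : R) : u @ \oo --> l ->
  l \is a fin_num -> (forall n, u n \is a fin_num) -> 0 < e ->
  exists n, (l - u n <= e%:E)%E.
Proof.
move=> + lf uf e0; rewrite -{1}(fineK lf).
move=> /fine_cvgP[_ /cvgrPdist_le/(_ e e0)[n _ /(_ n (leqnn _))]] /= h.
exists n; rewrite -(fineK lf) -(fineK (uf n)) -EFinB lee_fin.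
by apply: le_trans h; exact: ler_norm.
Qed.

Section outer_regularity.
Variable mu : {finite_measure set (L2borel R) -> \bar R}.

(** Inner approximation by closed sets and outer approximation by open sets are required together,
    so that the class is stable under complement. *)
Let regular (A : set (L2borel R)) := forall e : R, 0 < e -> exists F O : set (L2 R),
  [/\ closed F, open O, F `<=` A, A `<=` O & (mu (O `\` F) <= e%:E)%E].

Let regular_open (A : set (L2 R)) : open A -> regular A.
Proof.
move=> oA e e0.
have mS n : measurable (shrink A n.+1%:R^-1 : set (L2borel R)).
  by apply: L2_measurable_closed; exact: closed_shrink.
have mA : measurable (A : set (L2borel R)) by exact: L2_measurable_open.
have : mu (shrink A n.+1%:R^-1 : set (L2borel R)) @[n --> \oo] --> mu A.
  rewrite -[X in _ --> mu X](bigcup_shrink oA); apply: nondecreasing_cvg_mu => //.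
    by rewrite (bigcup_shrink oA).
  move=> n m nm; apply/subsetPset; apply: shrink_le.
  by rewrite lef_pV2 ?posrE// ler_nat.
move=> cv; have fmu B : measurable B -> mu B \is a fin_num by move=> mB; exact: fin_num_measure.
have [n hn] := cvg_fin_num_dist cv (fmu _ mA) (fun n => fmu _ (mS n)) e0.
exists (shrink A n.+1%:R^-1), A; split => //; first exact: closed_shrink.
  by apply: shrink_sub; rewrite invr_gt0.
rewrite measureD//; last by rewrite -ge0_fin_numE// fmu.
by rewrite setIidr//; apply: shrink_sub; rewrite invr_gt0.
Qed.

Let regularC A : regular A -> regular (~` A).
Proof.
move=> rA e /rA[F [ O [cF oO FA AO le]]]; exists (~` O), (~` F); split.
- by rewrite closedC.
- by rewrite openC.
- exact: subsetC.
- exact: subsetC.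
- by rewrite setDE setCK setIC -setDE.
Qed.

(** A countable union of closed sets need not be closed: it is cut to a finite one by continuity
    from below, at cost e / 2; the other e / 2 is shared out along a geometric series. *)
Let regular_bigcup (A : nat -> set (L2borel R)) :
  (forall n, regular (A n)) -> regular (\bigcup_n A n).
Proof.
move=> rA e e0.
pose en n : R := e / 2 / (2 ^ n.+1)%:R.
have en0 n : 0 < en n by rewrite !divr_gt0// ltr0n expn_gt0.
have /boolp.choice[FO h] : forall n, exists FO : set (L2 R) * set (L2 R),
  [/\ closed FO.1, open FO.2, FO.1 `<=` A n, A n `<=` FO.2 &
     (mu (FO.2 `\` FO.1) <= (en n)%:E)%E].
  by move=> n; have [F [ O ?]] := rA n _ (en0 n); exists (F, O).
pose F n := (FO n).1; pose O n := (FO n).2.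
have mF n : measurable (F n : set (L2borel R)) by apply: L2_measurable_closed; case: (h n).
have mO n : measurable (O n : set (L2borel R)) by apply: L2_measurable_open; case: (h n).
pose U : set (L2borel R) := \bigcup_n O n.
pose V : set (L2borel R) := \bigcup_n F n.
have mU : measurable U by exact: bigcupT_measurable.
have mV : measurable V by exact: bigcupT_measurable.
have UV : (mu (U `\` V) <= (e / 2)%:E)%E.
  apply: (@le_trans _ _ (\sum_(0 <= n <oo) mu (O n `\` F n))%E).
    apply: (@measure_sigma_subadditive _ _ _ mu (U `\` V) (fun n => O n `\` F n)).
    - by move=> n; exact: measurableD.
    - exact: measurableD.
    - by move=> x [[n _ Ox] nV]; exists n => //; split => // Fx; apply: nV; exists n.
  apply: (@le_trans _ _ (\sum_(0 <= n <oo) (en n)%:E)%E).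
    by apply: lee_nneseries => n _ => //; have [] := h n.
  by apply: epsilon_trick0; rewrite divr_ge0// ltW.
pose Vn n : set (L2borel R) := \big[setU/set0]_(i < n.+1) F i.
have mVn n : measurable (Vn n) by exact: bigsetU_measurable.
have cV : mu (Vn n) @[n --> \oo] --> mu V.
  have VE : V = \bigcup_n Vn n by rewrite /V -(bigcup_bigsetU_bigcup F).
  rewrite [X in _ --> mu X]VE; apply: nondecreasing_cvg_mu => //.
    by rewrite -VE.
  move=> n k nk; apply/subsetPset; rewrite /Vn -!bigcup_mkord.
  by move=> x [i /= ni Fx]; exists i => //=; exact: leq_trans nk.
have fmu B : measurable B -> mu B \is a fin_num by move=> mB; exact: fin_num_measure.
have e20 : 0 < e / 2 by rewrite divr_gt0.
have [n hn] := cvg_fin_num_dist cV (fmu _ mV) (fun n => fmu _ (mVn n)) e20.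
exists (Vn n), U; split.
- rewrite /Vn; elim/big_ind : _ => //; [exact: closed0|exact: closedU|].
  by move=> i _; case: (h i).
- by apply: bigcup_open => i _; case: (h i).
- rewrite /Vn => x; rewrite -bigcup_mkord => -[i _ Fx]; exists i => //.
  by have [_ _ + _ _] := h i; exact.
- by move=> x [i _ Ax]; exists i => //; have [_ _ _ + _] := h i; exact.
- have VnV : Vn n `<=` V by rewrite /Vn -bigcup_mkord => x [i _ Fx]; exists i.
  apply: (@le_trans _ _ (mu (U `\` V) + mu (V `\` Vn n))%E).
    rewrite (le_trans _ (measureU2 _ _ _))//; [|exact: measurableD..].
    apply: le_measure; rewrite ?inE; [exact: measurableD|apply: measurableU; exact: measurableD|].
    move=> x [Ux nVn]; have [Vx|nVx] := pselect (V x); by [right|left].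
  rewrite (splitr e) EFinD leeD//.
  rewrite measureD//; last by rewrite -ge0_fin_numE// fmu.
  by rewrite setIidr.
Qed.

Lemma L2_outer_regular (A : set (L2borel R)) (e : R) : measurable A -> 0 < e ->
  exists O : set (L2 R), [/\ open O, A `<=` O & (mu O <= mu A + e%:E)%E].
Proof.
move=> mA e0.
have : regular A.
  move: A mA; apply: smallest_sub => [|O oO]; last exact: regular_open.
  split.
  - by apply: regular_open; exact: open0.
  - by move=> A rA; rewrite setTD; exact: regularC.
  - by move=> A rA; exact: regular_bigcup.
move=> /(_ e e0)[F [ O [cF oO FA AO le]]]; exists O; split => //.
have mO := L2_measurable_open oO; have mF := L2_measurable_closed cF.
rewrite (_ : O = A `|` (O `\` A)); last first.
  by apply/seteqP; split => [x Ox|x [/AO//|[]//]]; have [?|?] := pselect (A x); [left|right].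
rewrite (le_trans (measureU2 _ _ _))//; first exact: measurableD.
rewrite leeD2l// (le_trans _ le)// le_measure ?inE//; [exact: measurableD..|].
by move=> x [Ox nA]; split => // /FA.
Qed.

End outer_regularity.

End L2_borel.

(** * Tails of expectations, lower integrals, affine maps *)

Section expectation_tv.
Context d (Omega : measurableType d) (R : realType) (P : probability Omega R).

(** Layer-cake formula for the variables increased by [M], with values in [0, 2M]: the first tail
    exceeds the second by at most [delta], and only on an interval of length 2M. *)
Lemma expectation_le_tail (u0 u1 : Omega -> R) (M delta : R) :
  measurable_fun setT u0 -> measurable_fun setT u1 ->
  (forall w, `|u0 w| <= M) -> (forall w, `|u1 w| <= M) -> 0 <= delta ->
  (forall c, (P [set w | (c < u0 w)%R] <= P [set w | (c < u1 w)%R] + delta%:E)%E) ->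
  fine 'E_P[u0] <= fine 'E_P[u1] + 2 * M * delta.
Proof.
move=> m0 m1 M0 M1 d0 tail.
have Mge0 : 0 <= M.
  have [[w _]|nO] := pselect (exists w : Omega, True).
    by rewrite (le_trans _ (M0 w)).
  have : P setT = 0%E.
    rewrite (_ : setT = set0) ?measure0//; apply/seteqP; split => // w _.
    by apply: nO; exists w.
  by rewrite probability_setT => /eqP; rewrite onee_eq0.
have ibd (u : Omega -> R) : measurable_fun setT u -> (forall w, `|u w| <= M) ->
    u \in Lfun P 1.
  move=> mu uM; apply/Lfun1_integrable.
  apply: (@le_integrable _ _ _ P setT _ _ (cst M%:E)) => //.
  - exact/measurable_EFinP.
  - by move=> w _; rewrite /= lee_fin [leRHS]ger0_norm.
  - exact: finite_measure_integrable_cst.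
have mX (u : Omega -> R) : measurable_fun setT u -> measurable_fun setT (fun w => u w + M).
  by move=> mu; exact: measurable_funD.
pose X0 : {RV P >-> R} := HB.pack (fun w => u0 w + M)
  (isMeasurableFun.Build _ _ _ _ _ (mX _ m0)).
pose X1 : {RV P >-> R} := HB.pack (fun w => u1 w + M)
  (isMeasurableFun.Build _ _ _ _ _ (mX _ m1)).
have X00 w : 0 <= X0 w by rewrite /= -lerBlDr sub0r; have := M0 w; rewrite ler_norml => /andP[].
have X10 w : 0 <= X1 w by rewrite /= -lerBlDr sub0r; have := M1 w; rewrite ler_norml => /andP[].
have EX (u : Omega -> R) : measurable_fun setT u -> (forall w, `|u w| <= M) ->
    ('E_P[fun w => (u w + M)%R] = (fine 'E_P[u] + M)%:E)%E.
  move=> mu uM; have iu := ibd u mu uM.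
  have -> : (fun w => (u w + M)%R) = (u \+ cst M)%R by [].
  rewrite expectationD//; last exact: Lfun_cst.
  rewrite expectation_cst EFinD fineK//; exact: expectation_fin_num.
have : ('E_P[X0] <= 'E_P[X1] + (2 * M * delta)%:E)%E.
  rewrite !ge0_expectation_ccdf//.
  have mI : measurable_fun (`[0%R, +oo[%classic : set R) (fun r => (delta * \1_`[0, 2 * M[ r)%:E).
    by apply/measurable_EFinP; apply: measurable_funM => //; exact: measurable_indic.
  apply: (@le_trans _ _ (\int[lebesgue_measure]_(r in `[0%R, +oo[)
     (ccdf (P := P) X1 r + (delta * \1_`[0, 2 * M[ r)%:E))%E).
    apply: ge0_le_integral => //.
    - by apply: measurable_funTS; exact: ccdf_measurable.
    - apply: emeasurable_funD => //; apply: measurable_funTS; exact: ccdf_measurable.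
    - move=> r /=; rewrite in_itv/= andbT => r0.
      have ccdfE (u : Omega -> R) (X : {RV P >-> R}) : (forall w, X w = u w + M) ->
          ccdf (P := P) X r = P [set w | r - M < u w].
        move=> XE; rewrite /ccdf /distribution /pushforward/=; congr (P _).
        by apply/seteqP; split => w /=; rewrite in_itv/= andbT XE ltrBlDr.
      rewrite (ccdfE u0 X0)// (ccdfE u1 X1)// indicE.
      have [rM|Mr] := ltP r (2 * M).
        by rewrite mem_set/= ?in_itv/= ?r0// mulr1.
      rewrite (_ : [set w | r - M < u0 w] = set0) ?measure0 ?adde_ge0 ?lee_fin ?mulr_ge0//.
      apply/seteqP; split => // w /=; have := M0 w; rewrite ler_norml => /andP[_ h].
      by rewrite ltNge (le_trans h)//; lra.
  rewrite ge0_integralD//; last 2 first.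
  - by apply: measurable_funTS; exact: ccdf_measurable.
  - by move=> r _; rewrite lee_fin mulr_ge0.
  rewrite leeD2l//; under eq_integral do rewrite EFinM.
  rewrite ge0_integralZl//.
  rewrite integral_indic// (_ : _ `&` _ = `[0, 2 * M[%classic); last first.
    by apply/seteqP; split => [x [] //|x /= h]; split => //; move: h; rewrite !in_itv/= andbT => /andP[].
  rewrite muleC EFinM lee_wpmul2r ?lee_fin//.
  apply: (@le_trans _ _ (Num.max 0 (2 * M - 0))%:E); last first.
    by rewrite subr0 lee_fin max_r// mulr_ge0.
  by rewrite -lebesgue_measure_co; exact: lexx.
  by apply/measurable_EFinP; exact: measurable_indic.
move=> h; have e0 := EX _ m0 M0; have e1 := EX _ m1 M1.
have : ((fine 'E_P[u0] + M)%:E <= (fine 'E_P[u1] + M)%:E + (2 * M * delta)%:E)%E.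
  by rewrite -e0 -e1; exact: h.
by rewrite -EFinD lee_fin addrAC lerD2r.
Qed.

End expectation_tv.

Section lower_integral.
Context d (T : measurableType d) (R : realType) (mu : {measure set T -> \bar R}).

(* No measurability: the integral of a nonnegative function is the supremum of
   the integrals of the simple functions below it. *)
Lemma ge0_le_integral_any (f g : T -> \bar R) : (forall x, (0 <= f x)%E) ->
  (forall x, (f x <= g x)%E) -> (\int[mu]_x f x <= \int[mu]_x g x)%E.
Proof.
move=> f0 fg; have g0 x : (0 <= g x)%E := le_trans (f0 x) (fg x).
rewrite !ge0_integralTE//; apply: le_ereal_sup => _ [h hf <-]; exists h => // x.
exact: le_trans (fg x).
Qed.

(** Markov's inequality for the lower integral of a possibly non-measurable [f]. *)
Lemma le_measure_integral_any (A : set T) (rho : R) (f : T -> \bar R) :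
  measurable A -> 0 <= rho -> (forall x, (0 <= f x)%E) ->
  (forall x, A x -> (rho%:E <= f x)%E) -> (rho%:E * mu A <= \int[mu]_x f x)%E.
Proof.
move=> mA r0 f0 Af.
have -> : (rho%:E * mu A = \int[mu]_x (rho * \1_A x)%:E)%E.
  under eq_integral do rewrite EFinM.
  rewrite ge0_integralZl//; first by rewrite integral_indic// setIT.
  by apply/measurable_EFinP; exact: measurable_indic.
apply: ge0_le_integral_any => x; first by rewrite lee_fin mulr_ge0.
rewrite indicE; case: (boolP (x \in A)) => [/set_mem Ax|_]; last by rewrite mulr0.
by rewrite mulr1; exact: Af.
Qed.

End lower_integral.

Section linear_preimage.
Variable R : realType.
Local Notation RT := (measurableTypeR R).

Definition affine_sum m (H : L2 R) (v : nat -> L2 R) (x : m.-tuple RT) : L2 R :=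
  H + \sum_(i < m) tnth x i *: v i.

Lemma affine_sum_dist m H v (x y : m.-tuple RT) (e : R) :
  (forall i, `|tnth x i - tnth y i| <= e) ->
  L2norm (affine_sum H v x - affine_sum H v y) <= e * \sum_(i < m) L2norm (v i).
Proof.
move=> xy; rewrite /affine_sum opprD addrACA subrr add0r -sumrB mulr_sumr.
rewrite (le_trans (L2norm_sum _ _ _))//; apply: ler_sum => i _.
by rewrite -scalerBl L2normZ ler_wpM2r ?L2norm_ge0.
Qed.

Let near_itv (z a q : R) : z - a < q -> q < z + a -> `|z - q| < a.
Proof. by move=> ? ?; rewrite ltr_norml; apply/andP; split; lra. Qed.

Let near_itvP (z a q : R) : `|z - q| < a -> q - a < z < q + a.
Proof. by rewrite ltr_norml => /andP[? ?]; apply/andP; split; lra. Qed.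

(** By continuity of the affine map, the preimage is the union of the boxes with rational centres
    and radii 1 / (n + 1) that it contains, and there are countably many of these. *)
Lemma measurable_affine_preimage m H (v : nat -> L2 R) (O : set (L2 R)) : open O ->
  measurable (affine_sum H v @^-1` O : set (m.-tuple RT)).
Proof.
move=> /L2_openP oO.
pose box (q : m.-tuple rat * nat) : set (m.-tuple RT) :=
  [set x | forall i, `|tnth x i - ratr (tnth q.1 i)| < q.2.+1%:R^-1].
pose good (q : m.-tuple rat * nat) := box q `<=` affine_sum H v @^-1` O.
have -> : affine_sum H v @^-1` O = \bigcup_q (if `[< good q >] then box q else set0).
  apply/seteqP; split => [x Ox|x [q _]]; last by case: asboolP => // gq; exact: gq.
  have [e e0 h] := oO _ Ox.
  pose S := \sum_(i < m) L2norm (v i) + 1.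
  have S0 : 0 < S by rewrite ltr_wpDl// sumr_ge0// => i _; exact: L2norm_ge0.
  have e2S : 0 < e / (2 * S) by rewrite divr_gt0 ?mulr_gt0.
  have [n ne] : exists n, n.+1%:R^-1 < e / (2 * S).
    have /cvgrPdist_lt/(_ _ e2S)[n _ /(_ n (leqnn _))] := @cvg_harmonic R.
    rewrite sub0r normrN ger0_norm ?harmonic_ge0// => ne.
    by exists n.
  have n0 : 0 < n.+1%:R^-1 :> R by rewrite invr_gt0.
  have /boolp.choice[q hq] : forall i : 'I_m, exists q : rat, `|tnth x i - ratr q| < n.+1%:R^-1.
    move=> i; have /rat_in_itvoo[q] : tnth x i - n.+1%:R^-1 < tnth x i + n.+1%:R^-1.
      by rewrite ltrD2l gtrN.
    by rewrite in_itv/= => /andP[q1 q2]; exists q; exact: (near_itv q1 q2).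
  exists ([tuple q i | i < m], n) => //.
  rewrite ifT; first by move=> i /=; rewrite tnth_mktuple; exact: hq.
  apply/asboolP => y /= yb; apply: h.
  apply: (@le_lt_trans _ _ (2 * n.+1%:R^-1 * \sum_(i < m) L2norm (v i))).
    apply: affine_sum_dist => i.
    have := yb i; rewrite /= tnth_mktuple => /ltW yi; have /ltW xi := hq i.
    rewrite (le_trans (ler_distD (ratr (q i)) _ _))// (distrC _ (tnth y i)).
    by rewrite mulrC mulr_natr mulr2n lerD.
  apply: (@le_lt_trans _ _ (2 * n.+1%:R^-1 * S)).
    by rewrite ler_wpM2l ?mulr_ge0 ?(ltW n0)// /S lerDl.
  by move: ne; rewrite ltr_pdivlMr ?mulr_gt0// mulrCA mulrA.
apply: countable_bigcupT_measurable => // q; case: ifP => // _.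
rewrite (_ : box q = \bigcap_(i in [set: 'I_m])
   ((fun x : m.-tuple RT => tnth x i) @^-1`
     [set z : RT | `|z - ratr (tnth q.1 i)| < q.2.+1%:R^-1])); last first.
  by apply/seteqP; split => [x xB i _|x xB i]; [exact: xB|exact: (xB i I)].
apply: fin_bigcap_measurable => [|i _]; first exact: finite_finset.
have mt := @measurable_tnth _ RT m i.
rewrite -[X in measurable X]setTI; apply: mt => //.
rewrite (_ : [set z | _] = `](ratr (tnth q.1 i) - q.2.+1%:R^-1), (ratr (tnth q.1 i) + q.2.+1%:R^-1)[%classic).
  exact: measurable_itv.
apply/seteqP; split => z /=; rewrite in_itv/=; first exact: near_itvP.
by rewrite distrC => /andP[h1 h2]; exact: (near_itv h1 h2).
Qed.

End linear_preimage.

(** * Approximate null control *)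

Section bounded_integrable.
Context d (T : measurableType d) (R : realType) (mu : {measure set T -> \bar R}).

Lemma bounded_integrable (D : set T) (h : T -> R) (c : R) : measurable D ->
  (mu D < +oo)%E -> measurable_fun D h -> (forall x, D x -> `|h x| <= c) ->
  mu.-integrable D (EFin \o h).
Proof.
move=> mD Doo mh hc; apply: (@le_integrable _ _ _ mu D mD _ (cst c%:E)).
- exact/measurable_EFinP.
- by move=> x Dx; rewrite /= lee_fin (le_trans (hc _ Dx))// ler_norm.
- apply/integrableP; split; first exact: measurable_cst.
  by rewrite integral_cst// lte_mul_pinfty// lee_fin.
Qed.

End bounded_integrable.

Section control.
Variable R : realType.
Local Notation mu := (@lebesgue_measure R).
Local Notation eigenval := (eigenval R).
Local Notation RT := (measurableTypeR R).

Lemma lebesgue_measure_co_lty (x y : R) : (mu (`[x, y[%classic : set RT) < +oo)%E.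
Proof.
apply: (@le_lt_trans _ _ (mu ([set` `[x, y[]))); first exact: lexx.
by rewrite lebesgue_measure_itv/=; case: ifP => _; rewrite ?ltry// -EFinB ltry.
Qed.

Lemma measurable_expR_affine (a b : R) (D : set RT) : measurable_fun D (fun r => expR (a * (b - r))).
Proof.
apply: measurable_funTS; apply: (measurableT_comp (@measurable_expR R)).
by apply: measurable_funM => //; exact: measurable_funB.
Qed.

Lemma Rintegral_expR_co (l T x y : R) : 0 < l -> x < y ->
  \int[mu]_(r in `[x, y[) expR (- l * (T - r)) =
  (expR (- l * (T - y)) - expR (- l * (T - x))) / l.
Proof.
move=> l0 xy.
have lN0 : l != 0 by rewrite gt_eqF.
rewrite Rintegral_itv_bndo_bndc; last first.
  apply: (@bounded_integrable _ RT R mu _ _ (expR (- l * (T - y)))) => //.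
  - exact: lebesgue_measure_co_lty.
  - exact: measurable_expR_affine.
  - move=> r /=; rewrite in_itv/= => /andP[_ ry]; rewrite ger0_norm ?expR_ge0//.
    by rewrite ler_expR !mulNr lerN2 ler_wpM2l ?(ltW l0)// lerD2l lerN2 ltW.
rewrite /Rintegral.
pose F r := expR (- l * (T - r)) / l.
have dF (r : R) : is_derive r (1 : R) F (expR (- l * (T - r))).
  rewrite /F; apply: is_derive_eq.
  by rewrite scaler0 add0r add0r mul1r /GRing.scale/=; field.
rewrite (@continuous_FTC2 R _ F)//.
- by rewrite -EFinB /F -mulrBl.
- apply: continuous_subspaceT => r.
  apply: (@continuous_comp _ _ _ (fun r => - l * (T - r)) expR); last exact: continuous_expR.
  by apply: cvgM; [exact: cvg_cst|apply: cvgB; [exact: cvg_cst|exact: cvg_id]].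
- split.
  + by move=> r _; have [] := dF r.
  + by apply: cvg_at_right_filter; apply: differentiable_continuous; apply/derivable1_diffP; have [] := dF x.
  + by apply: cvg_at_left_filter; apply: differentiable_continuous; apply/derivable1_diffP; have [] := dF y.
- by move=> r _; rewrite derive1E; have [_ ->] := dF r.
Qed.

Lemma sum_indic_adjacent (b h : R) s r : 0 <= h ->
  \sum_(l < s) (\1_(`[b - l.+1%:R * h, b - l%:R * h[%classic) r : R) =
  \1_(`[b - s%:R * h, b[%classic) r.
Proof.
move=> h0; elim: s => [|s ih].
  by rewrite big_ord0 mul0r subr0 indicE memNset//= in_itv/= => /andP[/le_lt_trans h1 /h1]; rewrite ltxx.
rewrite big_ord_recr/= ih !indicE -natrD; congr (_%:R).
have hs : b - s.+1%:R * h <= b - s%:R * h.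
  by rewrite lerD2l lerN2 ler_wpM2r// ler_nat.
have hb : b - s%:R * h <= b by rewrite gerBl mulr_ge0.
rewrite !mem_setE !in_itv/=; case: (leP (b - s%:R * h) r) => h1 /=.
  by rewrite andbF addn0 (le_trans hs h1).
by rewrite add0n andbT (lt_le_trans h1 hb) andbT.
Qed.

(* q is the step function which equals p`_l, up to a factor, on the l-th
   interval of length eta to the left of T - eps: its integral against
   exp (- lambda_k (T - r)) is p.[exp (- lambda_k eta)], up to a factor. *)
Lemma biorthogonal_fun_exists (tau : R) : 0 < tau -> exists2 K, 0 < K &
  forall (eps T : R), 0 < eps -> tau <= T - eps ->
  forall N n, (1 <= n <= N)%N -> exists q : R -> R,
  [/\ measurable_fun [set: RT] q,
      forall r, `|q r| <= K * expR (eigenval n * (eps + 2 * tau)) &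
      forall k, (1 <= k <= N)%N ->
        \int[mu]_(r in `[0, T - eps[) (q r * expR (- eigenval k * (T - r))) = (k == n)%:R].
Proof.
move=> tau0; have [K K0 bio] := biorthogonal_poly_exists tau0.
exists K => // eps T eps0 tauT N n nN.
have [eta [p [/andP[eta0 etatau] sp pk pl]]] := bio N n nN.
have n0 : (0 < n)%N by case/andP: nN.
set b := T - eps.
pose J l : set RT := `[b - l.+1%:R * eta, b - l%:R * eta[%classic.
pose kap k := (1 - expR (- (eigenval k * eta))) / eigenval k.
have l0 := eigenval_gt0 R n0.
have kap0 : 0 < kap n.
  by rewrite divr_gt0// subr_gt0 expR_lt1 oppr_lt0 mulr_gt0.
(* The integral of exp (- lambda_k (T - r)) over the l-th interval is exp (- lambda_k eps) exp (-
   lambda_k eta)^l kap_k; [c] normalises this for k = n. *)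
pose c := expR (eigenval n * eps) / kap n.
have c0 : 0 < c by rewrite divr_gt0// expR_gt0.
(* From 1 + z <= e^z and eta <= tau. The factor [eta] will cancel with the one in the bound on the
   coefficients of [p], at the price of a second e^{lambda_n tau}. *)
have kap_ge : eta * expR (- (eigenval n * tau)) <= kap n.
  have x0 : 0 <= eigenval n * eta by rewrite mulr_ge0 ?ltW.
  have /andP[h _] := onem_expRN_bounds x0.
  rewrite ler_pdivlMr// (le_trans _ h)// mulrAC (mulrC eta) ler_wpM2l//.
  rewrite -[leRHS]div1r; rewrite div1r expRN lef_pV2 ?posrE ?expR_gt0 ?ltr_wpDr//.
  rewrite (le_trans (expR_ge1Dx _))// ler_expR ler_wpM2l// ltW//.
pose q r := c * \sum_(l < size p) p`_l * \1_(J l) r.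
exists q; split.
- apply: measurable_funM => //; apply: measurable_sum => l.
  apply: measurable_funM => //.
  by apply: measurable_indic; exact: measurable_itv.
- move=> r; rewrite /q normrM gtr0_norm//.
  apply: (@le_trans _ _ (c * (eta * (K * expR (eigenval n * tau))))).
    rewrite ler_wpM2l ?(ltW c0)// (le_trans (ler_norm_sum _ _ _))//.
    apply: (@le_trans _ _ (\sum_(l < size p) eta * (K * expR (eigenval n * tau)) * \1_(J l) r)).
      by apply: ler_sum => l _; rewrite normrM (@ger0_norm _ (\1_(J l) r))// ler_wpM2r.
    rewrite -mulr_sumr sum_indic_adjacent ?(ltW eta0)//.
    rewrite ler_piMr//.
    by rewrite !mulr_ge0 ?expR_ge0 ?(ltW eta0) ?(ltW K0).
  rewrite /c; rewrite [leLHS](_ : _ = K * expR (eigenval n * eps) * expR (eigenval n * tau) * (eta / kap n));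
    last by ring.
  have : eta / kap n <= expR (eigenval n * tau).
    by rewrite ler_pdivrMr// -ler_pdivrMl ?expR_gt0// -expRN mulrC.
  move=> h; have h2 : 0 <= K * expR (eigenval n * eps) * expR (eigenval n * tau).
    by rewrite !mulr_ge0 ?expR_ge0 ?(ltW K0).
  rewrite (le_trans (ler_wpM2l h2 h))// -!mulrA -!expRD le_eqVlt; apply/orP; left.
  by apply/eqP; congr (_ * expR _); ring.
- move=> k kN; have k0 : (0 < k)%N by case/andP: kN.
  have lk0 := eigenval_gt0 R k0.
  have JD l : (l < size p)%N -> J l `<=` `[0, b[.
    move=> ls r; rewrite /J /= !in_itv/= => /andP[h1 h2]; apply/andP; split.
      apply: le_trans h1; rewrite subr_ge0 (le_trans _ tauT)// (le_trans _ sp)//.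
      by rewrite ler_wpM2r ?(ltW eta0)// ler_nat.
    by rewrite (lt_le_trans h2)// gerBl mulr_ge0// ltW.
  have iJ l : (l < size p)%N -> \int[mu]_(r in `[0, b[) (\1_(J l) r * expR (- eigenval k * (T - r))) =
      expR (- (eigenval k * eps)) * expR (- (eigenval k * eta)) ^+ l * kap k.
    move=> ls.
    transitivity (\int[mu]_(r in J l) expR (- eigenval k * (T - r))).
      rewrite [RHS]Rintegral_mkcond [LHS]Rintegral_mkcond; apply: eq_Rintegral => r _.
      rewrite !patchE indicE; case: (boolP (r \in J l)) => rJ.
        by rewrite mem_set ?mul1r//; apply: (JD l ls); exact: set_mem.
      by rewrite mul0r; case: ifP.
    rewrite Rintegral_expR_co//; last by rewrite ltrD2l ltrN2 ltr_pM2r// ltr_nat.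
    rewrite /kap mulrA; congr (_ / _); rewrite -expRM_natl [RHS]mulrBr mulr1 -!expRD /b -natr1.
    by congr (expR _ - expR _); ring.
  have bi l : mu.-integrable `[0, b[ (EFin \o (fun r => \1_(J l) r * expR (- eigenval k * (T - r)))).
    apply: (@bounded_integrable _ RT R mu _ _ 1) => //.
    - exact: lebesgue_measure_co_lty.
    - apply: measurable_funM; last exact: measurable_expR_affine.
      by apply: measurable_funTS; apply: measurable_indic; exact: measurable_itv.
    - move=> r; rewrite /= in_itv/= => /andP[_ rb].
      rewrite normrM (@ger0_norm _ (expR _)) ?expR_ge0// -[leRHS]mulr1 ler_pM//.
        by rewrite indicE; case: (_ \in _); rewrite ?normr1 ?normr0.
      rewrite -expR0 ler_expR mulNr oppr_le0 mulr_ge0 ?(ltW lk0)// subr_ge0.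
      by rewrite (le_trans (ltW rb))// gerBl ltW.
  transitivity (c * \sum_(l < size p) p`_l * (expR (- (eigenval k * eps)) * expR (- (eigenval k * eta)) ^+ l * kap k)).
    pose G l r := p`_l * (\1_(J l) r * expR (- eigenval k * (T - r))).
    have iG l : (l < size p)%N -> mu.-integrable `[0, b[ (EFin \o G l).
      move=> _; pose h (r : R) := \1_(J l) r * expR (- eigenval k * (T - r)).
      have -> : EFin \o G l = (fun r => (EFin p`_l * EFin (h r))%E).
        by apply/funext => r /=; rewrite -EFinM.
      by apply: integrableZl => //; exact: bi.
    have [i1 i2] := @Rintegral_sum _ RT R mu (`[0, b[%classic) (size p) G (measurable_itv `[0, b[) iG.
    transitivity (\int[mu]_(r in `[0, b[) (c * \sum_(l < size p) G l r)).
      apply: eq_Rintegral => r _; rewrite /q -mulrA mulr_suml; congr (_ * _).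
      by apply: eq_bigr => l _; rewrite /G mulrA.
    rewrite RintegralZl//; congr (_ * _); rewrite i2; apply: eq_bigr => l _.
    by rewrite /G RintegralZl// iJ.
  rewrite (eq_bigr (fun l : 'I_(size p) => (p`_l * expR (- (eigenval k * eta)) ^+ l) * (expR (- (eigenval k * eps)) * kap k))).
    rewrite -mulr_suml -horner_coef pk//.
    case: eqVneq => [->|_]; last by rewrite mul0r mulr0.
    rewrite mul1r /c expRN; move: (kap n) kap0 (expR _) (expR_gt0 (eigenval n * eps)) => x x0 y y0.
    by rewrite /=; field; rewrite !gt_eqF.
  by move=> l _; ring.
Qed.

End control.

Section null_control.
Variable R : realType.
Local Notation mu := (@lebesgue_measure R).
Local Notation eigenval := (eigenval R).
Local Notation RT := (measurableTypeR R).

Lemma sum_invn_mulnS_le (N : nat) :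
  \sum_(i < N) (i.+1%:R * i.+2%:R)^-1 <= 1 :> R.
Proof.
suff -> : \sum_(i < N) (i.+1%:R * i.+2%:R)^-1 = 1 - N.+1%:R^-1 :> R.
  by rewrite gerBl invr_ge0.
elim: N => [|N ih]; first by rewrite big_ord0 invr1 subrr.
rewrite big_ord_recr/= ih.
have h1 : N.+1%:R != 0 :> R by rewrite pnatr_eq0.
have h2 : N.+2%:R != 0 :> R by rewrite pnatr_eq0.
have h3 : N.+2%:R = N.+1%:R + 1 :> R by rewrite -natr1.
by move: h1 h2; rewrite h3; move: N.+1%:R => x x0 x1; field; rewrite x0 x1.
Qed.

(** The control is the sum of the biorthogonal functions with weights e^{-lambda_n T} c_n / f_n.
    With T - alpha = 6 tau and eps = tau, a weight is O(e^{-6 tau lambda_n}) and a function O(e^{3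
    tau lambda_n}); the remaining e^{-3 tau lambda_n} is summable, uniformly in [N]. *)
Lemma approximate_null_control (C alpha T : R) (f : nat -> R) :
  0 < C -> 0 < alpha -> alpha < T ->
  (forall n : nat, (1 <= n)%N -> C * expR (- alpha * eigenval n) <= `|f n|) ->
  exists K eps, [/\ 0 < K, 0 < eps, eps < T &
    forall L N c, (forall n, `|c n| <= L) ->
    exists u : R -> R, [/\ measurable_fun [set: RT] u,
      forall r, `|u r| <= K * L &
      forall n, (1 <= n <= N)%N ->
        f n * \int[mu]_(r in `[0, T - eps[) (u r * expR (- eigenval n * (T - r))) =
        expR (- eigenval n * T) * c n]].
Proof.
move=> C0 al0 aT flow.
pose tau := (T - alpha) / 6.
have tau0 : 0 < tau by rewrite divr_gt0// subr_gt0.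
have [K K0 bio] := biorthogonal_fun_exists tau0.
have t3 : 0 < 3 * tau by rewrite mulr_gt0.
exists (K / C * (12 / (3 * tau) ^+ 3)), tau; split => //.
- by rewrite mulr_gt0 ?divr_gt0 ?exprn_gt0.
- by rewrite /tau; lra.
move=> L N c cL.
have L0 : 0 <= L by rewrite (le_trans _ (cL 0%N)).
have tauT : tau <= T - tau by rewrite /tau; lra.
have /choice[q hq] : forall i : nat, exists q : R -> R, (i < N)%N ->
  [/\ measurable_fun [set: RT] q,
      forall r, `|q r| <= K * expR (eigenval i.+1 * (tau + 2 * tau)) &
      forall k, (1 <= k <= N)%N ->
        \int[mu]_(r in `[0, T - tau[) (q r * expR (- eigenval k * (T - r))) = (k == i.+1)%:R].
  move=> i; case: (ltnP i N) => iN; last by exists (cst 0).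
  by have [q ?] := bio tau T tau0 tauT N i.+1 iN; exists q.
have f0 n : (1 <= n)%N -> 0 < `|f n|.
  by move=> /flow; apply: lt_le_trans; rewrite mulr_gt0 ?expR_gt0.
pose a i := expR (- eigenval i.+1 * T) * c i.+1 / f i.+1.
exists (fun r => \sum_(i < N) a i * q i r); split.
- apply: measurable_sum => i; apply: measurable_funM => //.
  by have [] := hq i (ltn_ord i).
- move=> r; rewrite (le_trans (ler_norm_sum _ _ _))//.
  have H (i : nat) : (i < N)%N -> `|a i * q i r| <=
      K / C * (12 / (3 * tau) ^+ 3) * L * (i.+1%:R * i.+2%:R)^-1.
    move=> iN; have [_ /(_ r) qK _] := hq i iN.
    have l0 := eigenval_gt0 R (ltn0Sn i).
    have := expRN_eigenval_le t3 (lexx _) (ltn0Sn i).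
    set x := 12 / _ => hx.
    have {}hx : expR (- eigenval i.+1 * (3 * tau)) <= x / (i.+1%:R * i.+2%:R).
      by apply: le_trans hx; rewrite ler_peMr ?expR_ge0// lerDl ltW.
    rewrite normrM.
    have aL : `|a i| <= expR (- eigenval i.+1 * (6 * tau)) * (L / C).
      rewrite /a normrM normfV ler_pdivrMr ?f0// normrM (ger0_norm (expR_ge0 _)).
      rewrite (le_trans (ler_wpM2l (expR_ge0 _) (cL i.+1)))//.
      apply: (@le_trans _ _ (expR (- eigenval i.+1 * (6 * tau)) * (L / C) *
          (C * expR (- alpha * eigenval i.+1)))).
        rewrite [leRHS](_ : _ = (expR (- eigenval i.+1 * (6 * tau)) *
          expR (- alpha * eigenval i.+1)) * L); last by field; rewrite gt_eqF.
        rewrite -expRD [X in expR X * L <= _](_ : _ =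
          - eigenval i.+1 * (6 * tau) + - alpha * eigenval i.+1)//.
        by rewrite /tau; field.
      by rewrite ler_wpM2l ?mulr_ge0 ?expR_ge0 ?invr_ge0 ?(ltW C0)// flow.
    rewrite (le_trans (ler_pM (normr_ge0 _) (normr_ge0 _) aL qK))//.
    have -> : expR (- eigenval i.+1 * (6 * tau)) * (L / C) *
        (K * expR (eigenval i.+1 * (tau + 2 * tau))) =
        K / C * L * expR (- eigenval i.+1 * (3 * tau)).
      rewrite [LHS](_ : _ = K / C * L * (expR (- eigenval i.+1 * (6 * tau)) *
         expR (eigenval i.+1 * (tau + 2 * tau)))); last by ring.
      by rewrite -expRD; congr (_ * expR _); ring.
    have KL : 0 <= K / C * L by rewrite mulr_ge0// divr_ge0// ltW.
    rewrite (le_trans (ler_wpM2l KL hx))// le_eqVlt; apply/orP; left; apply/eqP; ring.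
  apply: (@le_trans _ _ (\sum_(i < N) K / C * (12 / (3 * tau) ^+ 3) * L * (i.+1%:R * i.+2%:R)^-1)).
    by apply: ler_sum => i _; exact: H.
  rewrite -mulr_sumr ler_piMr ?sum_invn_mulnS_le//.
  by rewrite !mulr_ge0// ?invr_ge0 ?exprn_ge0 ?(ltW K0) ?(ltW C0) ?(ltW t3).
- move=> n nN; have n0 : (1 <= n)%N by case/andP: nN.
  have iq i : (i < N)%N -> mu.-integrable `[0, T - tau[
      (EFin \o (fun r => q i r * expR (- eigenval n * (T - r)))).
    move=> iN; have [mq qK _] := hq i iN.
    apply: (@bounded_integrable _ RT R mu _ _ (K * expR (eigenval i.+1 * (tau + 2 * tau)))) => //.
    - exact: lebesgue_measure_co_lty.
    - apply: measurable_funM; first exact: measurable_funTS.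
      exact: measurable_expR_affine.
    - move=> r; rewrite /= in_itv/= => /andP[_ rb].
      rewrite normrM (@ger0_norm _ (expR _)) ?expR_ge0//.
      rewrite -[leRHS]mulr1 ler_pM// ?qK ?expR_ge0//.
      rewrite -expR0 ler_expR mulNr oppr_le0 mulr_ge0 ?(ltW (eigenval_gt0 R n0))// subr_ge0.
      by rewrite (le_trans (ltW rb))// gerBl ltW.
  pose G i r := a i * (q i r * expR (- eigenval n * (T - r))).
  have iG i : (i < N)%N -> mu.-integrable `[0, T - tau[ (EFin \o G i).
    move=> iN; have -> : EFin \o G i =
        (fun r => (EFin (a i) * EFin (q i r * expR (- eigenval n * (T - r)))%R)%E).
      by apply/funext => r /=; rewrite -EFinM.
    by apply: integrableZl => //; exact: iq.
  have [i1 i2] := @Rintegral_sum _ RT R mu (`[0, T - tau[%classic) N G (measurable_itv `[0, T - tau[) iG.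
  transitivity (f n * \int[mu]_(r in `[0, T - tau[) (\sum_(i < N) G i r)).
    congr (_ * _); apply: eq_Rintegral => r _; rewrite mulr_suml.
    by apply: eq_bigr => i _; rewrite /G mulrA.
  rewrite i2.
  have n1N : (n.-1 < N)%N by rewrite prednK//; case/andP: nN.
  rewrite (bigD1 (Ordinal n1N))//= big1 ?addr0.
    rewrite /G RintegralZl//; last exact: iq.
    have [_ _ ->//] := hq _ n1N; rewrite /a prednK// eqxx mulr1.
    by field; rewrite -normr_gt0 f0.
  move=> i; rewrite -val_eqE/= => ine.
  rewrite /G RintegralZl//; last exact: iq.
  have [_ _ ->//] := hq _ (ltn_ord i).
  case: eqP => [ni|_]; last by rewrite mulr0.
  by move: ine; rewrite ni eqxx.
Qed.

End null_control.

Section controlled_drift.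
Variable R : realType.
Local Notation mu := (@lebesgue_measure R).
Local Notation eigenval := (eigenval R).
Local Notation RT := (measurableTypeR R).

Lemma Rintegral_lincomb (D : set RT) n (h : nat -> R -> R) (k : nat -> R) : measurable D ->
  (forall i, mu.-integrable D (EFin \o h i)) ->
  mu.-integrable D (EFin \o (fun r => \sum_(i < n) k i * h i r)) /\
  \int[mu]_(r in D) (\sum_(i < n) k i * h i r) = \sum_(i < n) k i * \int[mu]_(r in D) h i r.
Proof.
move=> mD ih.
have iG i : (i < n)%N -> mu.-integrable D (EFin \o (fun r => k i * h i r)).
  move=> _; have -> : EFin \o (fun r => k i * h i r) = (fun r => (EFin (k i) * EFin (h i r))%E).
    by apply/funext => r /=; rewrite -EFinM.
  by apply: integrableZl => //; exact: ih.
have [i1 i2] := @Rintegral_sum _ RT R mu D n (fun i r => k i * h i r) mD iG.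
split; first exact: i1.
rewrite i2; apply: eq_bigr => i _; rewrite RintegralZl//; exact: ih.
Qed.

Lemma normr_Rintegral_le (D : set RT) (h : R -> R) (c : R) : measurable D ->
  mu.-integrable D (EFin \o h) ->
  (\int[mu]_(r in D) `|h r|%:E <= c%:E)%E -> `|\int[mu]_(r in D) h r| <= c.
Proof.
move=> mD ih hc; apply: le_trans (le_normr_Rintegral mD ih) _.
by rewrite /Rintegral -lee_fin fineK//; apply: integrable_fin_num => //; exact: integrable_norm.
Qed.

Variables (T eps B : R) (u : R -> R) (S : step R).
Hypotheses (eps0 : 0 < eps) (epsT : eps < T).
Hypotheses (meas_u : measurable_fun [set: RT] u) (uB : forall r, `|u r| <= B).
Hypothesis ST : step_on T S.
Local Notation D := (`[0, T - eps[%classic : set RT).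

Let mD : measurable D. Proof. exact: measurable_itv. Qed.
Let B0 : 0 <= B. Proof. exact: le_trans (uB 0). Qed.

(* Replacing dW by dW + u dr shifts the i-th increment by [drift_coef i]. *)
Definition drift_coef i : R :=
  \int[mu]_(r in D) (u r * \1_(`[step_node S i, step_node S i.+1[%classic) r).

Let integrable_u_indic i : mu.-integrable D
  (EFin \o (fun r => u r * \1_(`[step_node S i, step_node S i.+1[%classic) r)).
Proof.
apply: (@bounded_integrable _ RT R mu _ _ B) => //.
- exact: lebesgue_measure_co_lty.
- apply: measurable_funM; first exact: measurable_funTS.
  by apply: measurable_funTS; apply: measurable_indic; exact: measurable_itv.
- move=> r _; rewrite normrM -[leRHS]mulr1 ler_pM//.
  by rewrite indicE; case: (_ \in _); rewrite ?normr1 ?normr0.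
Qed.

Let integrable_u_expR n : mu.-integrable D (EFin \o (fun r => u r * expR (- eigenval n * (T - r)))).
Proof.
apply: (@bounded_integrable _ RT R mu _ _ B) => //.
- exact: lebesgue_measure_co_lty.
- apply: measurable_funM; first exact: measurable_funTS.
  exact: measurable_expR_affine.
- move=> r; rewrite /= in_itv/= => /andP[_ rb].
  rewrite normrM -[leRHS]mulr1 ler_pM// ger0_norm ?expR_ge0//.
  rewrite -expR0 ler_expR mulNr oppr_le0 mulr_ge0 ?eigenval_ge0// subr_ge0.
  by rewrite (le_trans (ltW rb))// gerBl ltW.
Qed.

(** Proportionality to the length of the step is the form that [increment_tv_le] requires. *)
Lemma drift_coef_le i : `|drift_coef i| <= B * (step_node S i.+1 - step_node S i).
Proof.
have [_ _ Sm] := ST.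
have Si : step_node S i <= step_node S i.+1 by rewrite Sm.
set I : set RT := `[step_node S i, step_node S i.+1[%classic.
apply: normr_Rintegral_le => //; rewrite integral_mkcond.
apply: (@le_trans _ _ (\int[mu]_r (B%:E * (\1_I r)%:E))%E).
  apply: ge0_le_integral_any => r; rewrite patchE; case: ifP => _ //=;
    rewrite -?EFinM lee_fin ?mulr_ge0//.
  by rewrite normrM (@ger0_norm _ (\1_I r))// ler_wpM2r.
rewrite ge0_integralZl//.
  rewrite integral_indic ?setIT; [|exact: measurableT|exact: measurable_itv].
  rewrite EFinM lee_wpmul2l ?lee_fin//; apply: (@le_trans _ _ (mu I)); first exact: lexx.
  by rewrite /I lebesgue_measure_co max_r// subr_ge0.
by apply/measurable_EFinP; apply: measurable_indic; exact: measurable_itv.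
Qed.

(** Testing against a fixed [g] reduces the L2-valued time integral of the control times the
    approximation error to a scalar one. *)
Lemma dot_drift_error (f : nat -> R) N g :
  mu.-integrable D (EFin \o (fun r => u r * dot (step_fun S r - heat_sum (T - r) f N.+1) g)) /\
  dot (\sum_(i < step_size S) drift_coef i *: step_val S i -
       \sum_(n < N) (f n.+1 * \int[mu]_(r in D) (u r * expR (- eigenval n.+1 * (T - r)))) *: e_ R n.+1) g =
  \int[mu]_(r in D) (u r * dot (step_fun S r - heat_sum (T - r) f N.+1) g).
Proof.
have [i1 e1] := Rintegral_lincomb (step_size S) (fun i => dot (step_val S i) g) mD
  (h := fun i r => u r * \1_(`[step_node S i, step_node S i.+1[%classic) r) integrable_u_indic.
have [i2 e2] := Rintegral_lincomb N (fun n => f n.+1 * dot (e_ R n.+1) g) mD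
  (h := fun n r => u r * expR (- eigenval n.+1 * (T - r))) (fun n => integrable_u_expR n.+1).
pose hS r := \sum_(i < step_size S) dot (step_val S i) g *
  (u r * \1_(`[step_node S i, step_node S i.+1[%classic) r).
pose hN r := \sum_(n < N) f n.+1 * dot (e_ R n.+1) g * (u r * expR (- eigenval n.+1 * (T - r))).
have E r : u r * dot (step_fun S r - heat_sum (T - r) f N.+1) g = hS r - hN r.
  rewrite dotBl mulrBr.
  rewrite /step_fun /heat_sum /partial_sum big_add1 big_mkord !dot_suml !mulr_sumr.
  by congr (_ - _); apply: eq_bigr => i _; rewrite dotZl; ring.
split.
  rewrite (_ : EFin \o _ = (fun r => (EFin (hS r) - EFin (hN r))%E)); first exact: integrableB.
  by apply/funext => r /=; rewrite -EFinB; congr EFin; exact: E.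
transitivity (\int[mu]_(r in D) (hS r - hN r)); last by apply: eq_Rintegral => r _; rewrite -E.
rewrite RintegralB// e1 e2 dotBl !dot_suml; congr (_ - _); apply: eq_bigr => i _; rewrite dotZl.
  by rewrite mulrC.
by rewrite mulrAC.
Qed.

Lemma drift_error_le (f : nat -> R) (G delta rho j : R) N :
  (forall n, (0 < n)%N -> `|f n| <= G * (1 + eigenval n)) ->
  24 * G / eps ^+ 3 / N.+1%:R <= delta -> 0 < rho ->
  (\int[mu]_(r in `[0%R, T[)
     (L2norm (heat (T - r) f - step_fun S r) ^+ 2)%:E <= j%:E)%E ->
  L2norm (\sum_(i < step_size S) drift_coef i *: step_val S i -
       \sum_(n < N) (f n.+1 * \int[mu]_(r in D) (u r * expR (- eigenval n.+1 * (T - r)))) *: e_ R n.+1)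
  <= B * (T * (delta + rho) + j / rho).
Proof.
move=> fG Ndelta rho0 Sj; set E := _ - _.
set I : set RT := `[0, T[%classic in Sj.
have mI : measurable I by exact: measurable_itv.
have T0 : 0 < T by exact: lt_trans epsT.
pose k (r : R) := L2norm (heat (T - r) f - step_fun S r) ^+ 2.
have mk : measurable_fun I k by exact: measurable_heat_step fG.
have tail r : r < T - eps -> L2norm (heat (T - r) f - heat_sum (T - r) f N.+1) <= delta.
  move=> rT; apply: le_trans Ndelta; apply: heat_tail => //.
  by rewrite lerBrDr -lerBrDl ltW.
have delta0 : 0 <= delta by rewrite (le_trans _ (tail 0 _)) ?L2norm_ge0// subr_gt0.
have j0 : 0 <= j.
  by rewrite -lee_fin (le_trans _ Sj)//; apply: integral_ge0 => r _; rewrite lee_fin sqr_ge0.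
have c0 : 0 <= T * (delta + rho) + j / rho.
  exact: addr_ge0 (mulr_ge0 (ltW T0) (addr_ge0 delta0 (ltW rho0))) (divr_ge0 j0 (ltW rho0)).
(* Test the error E against itself: this only involves the integrand. *)
suff : L2norm E * L2norm E <= L2norm E * (B * (T * (delta + rho) + j / rho)).
  have := L2norm_ge0 E; rewrite le_eqVlt => /predU1P[<- _|E0]; first by rewrite mulr_ge0.
  by rewrite ler_pM2l.
rewrite -expr2 L2normE; have [iE eE] := dot_drift_error f N E.
rewrite {1}/E eE; apply: le_trans (ler_norm _) _.
apply: normr_Rintegral_le => //.
have rho_ge0 : 0 <= rho^-1 by rewrite invr_ge0 ltW.
set BE := B * L2norm E.
have BE0 : 0 <= BE by rewrite mulr_ge0// L2norm_ge0.
apply: (@le_trans _ _ (\int[mu]_(r in I) (BE * (delta + rho + rho^-1 * k r))%:E)%E).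
  rewrite integral_mkcond [leRHS]integral_mkcond; apply: ge0_le_integral_any => r.
    by rewrite patchE; case: ifP => _ //=; rewrite lee_fin.
  rewrite !patchE; case: ifPn => rD; last first.
    case: ifP => _ //; rewrite lee_fin; apply: mulr_ge0 => //.
    exact: addr_ge0 (addr_ge0 delta0 (ltW rho0)) (mulr_ge0 rho_ge0 (sqr_ge0 _)).
  have /andP[r0 rT] : 0 <= r < T - eps by have := set_mem rD; rewrite /= in_itv.
  rewrite ifT; last first.
    by rewrite mem_set// /I /= in_itv/= r0 (lt_trans rT)// gtrBl.
  rewrite lee_fin normrM /BE -mulrA ler_pM//.
  rewrite (le_trans (dot_le_norm _ _))// mulrC ler_wpM2l ?L2norm_ge0//.
  rewrite (le_trans (L2normBD _ (heat (T - r) f) _))// L2normB.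
  have := tail r rT; have := L2norm_ge0 (heat (T - r) f - step_fun S r).
  rewrite /k; set a := L2norm _; set b := L2norm (_ - heat_sum _ _ _) => a0 bd.
  (* Young's inequality in place of Cauchy-Schwarz in time: the integral of a is bounded through
     that of a^2 without a square root. *)
  suff : a <= rho + rho^-1 * a ^+ 2 by lra.
  by rewrite -(ler_pM2l rho0) mulrDr mulVKf ?gt_eqF//; nra.
under eq_integral do rewrite EFinM EFinD (EFinM rho^-1).
have mk' : measurable_fun I (fun r => (k r)%:E) by exact/measurable_EFinP.
have mk'' : measurable_fun I (fun r => (rho^-1%:E * (k r)%:E)%E) by exact: measurable_funeM.
have k0 r : (0 <= (k r)%:E)%E by rewrite lee_fin sqr_ge0.
have rk0 r : (0 <= rho^-1%:E * (k r)%:E)%E by rewrite mule_ge0// lee_fin invr_ge0 ltW.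
have dr0 : (0 <= (delta + rho)%:E)%E by rewrite lee_fin addr_ge0// ltW.
rewrite ge0_integralZl//; last 2 first.
  by apply: emeasurable_funD.
  by move=> r _; apply: adde_ge0 dr0 (rk0 r).
rewrite ge0_integralD//.
rewrite ge0_integralZl// ?lee_fin ?invr_ge0 ?(ltW rho0)//.
rewrite -[X in (X + _)%E]/(\int[mu]_(x in I) cst (delta + rho)%:E x)%E integral_cst//.
have muI : (mu I <= T%:E)%E.
  apply: (@le_trans _ _ (Num.max 0 (T - 0))%:E); last by rewrite subr0 max_r// ltW.
  by rewrite -lebesgue_measure_co; exact: lexx.
apply: (@le_trans _ _ (BE%:E * ((delta + rho)%:E * T%:E + rho^-1%:E * j%:E))%E).
  apply: lee_wpmul2l; first by rewrite lee_fin.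
  apply: leeD; apply: lee_wpmul2l => //; rewrite lee_fin//.
rewrite [leLHS](_ : _ = (BE * ((delta + rho) * T + rho^-1 * j))%:E) // lee_fin /BE le_eqVlt; apply/orP; left; apply/eqP; ring.
Qed.

End controlled_drift.

(** * Comparison of the two laws *)

Section wiener_approximation.
Context d (Omega : measurableType d) (R : realType) (P : probability Omega R).
Variable W : R -> Omega -> R.
Hypothesis BM : brownian_motion P W.
Local Notation mu := (@lebesgue_measure R).
Local Notation RT := (measurableTypeR R).

Lemma cvge0_near_le (u : nat -> \bar R) (e : R) : u @ \oo --> 0%E -> 0 < e ->
  \forall n \near \oo, (u n <= e%:E)%E.
Proof.
move=> u0 e0; have := u0 _ (@nbhs_open_ereal_lt R 0 (cst e) e0).
by move=> [N _ h]; exists N => // n /h /= /ltW.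
Qed.

(** One index serves both limits. The endpoint r = T, where [heat 0 f] may be unspecified, is
    dropped from the integral; [measurable_heat_step] then applies. *)
Lemma wiener_integral_approx (T kap : R) (Phi : R -> L2 R) (I : Omega -> L2 R) :
  wiener_integral P W T Phi I -> 0 < kap -> exists S : step R,
  [/\ step_on T S,
      (\int[mu]_(r in `[0%R, T[) (L2norm (Phi r - step_fun S r) ^+ 2)%:E <= kap%:E)%E &
      (\int[P]_w (L2norm (I w - step_integral W S w) ^+ 2)%:E <= kap%:E)%E].
Proof.
move=> [S [ST S1 S2]] kap0.
have [n [n1 n2]] := filter_ex (filterI (cvge0_near_le S1 kap0) (cvge0_near_le S2 kap0)).
exists (S n); split => //; last by rewrite expectation.unlock in n2.
apply: le_trans n1; rewrite integral_mkcond [leRHS]integral_mkcond.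
apply: ge0_le_integral_any => r; rewrite !patchE.
  by case: ifP => // _; rewrite lee_fin sqr_ge0.
case: ifPn => [|_]; last by case: ifP => // _; rewrite lee_fin sqr_ge0.
rewrite inE/= in_itv/= => /andP[r0 rT].
by rewrite ifT// inE/= in_itv/= r0 ltW.
Qed.

Lemma step_fun_out (T : R) (S : step R) r : step_on T S ->
  ~ (0 <= r < T) -> step_fun S r = 0.
Proof.
move=> [S0 ST Sm] rT; rewrite /step_fun big1// => i _.
rewrite indicE memNset ?scale0r//= in_itv/= => /andP[h1 h2]; apply: rT.
rewrite (le_trans _ h1) -?S0 ?Sm//= (lt_le_trans h2)// -ST Sm//.
Qed.

(** Two Wiener integrals of the same integrand come with unrelated step functions, which are
    compared through that integrand. Both vanish outside [0, T[, hence the integral over the whole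
    line. *)
Lemma step_fun_dist (T G kap : R) (f : nat -> R) (S S' : step R) :
  (forall n, (0 < n)%N -> `|f n| <= G * (1 + eigenval R n)) ->
  step_on T S -> step_on T S' ->
  (\int[mu]_(r in `[0%R, T[) (L2norm (heat (T - r) f - step_fun S r) ^+ 2)%:E <= kap%:E)%E ->
  (\int[mu]_(r in `[0%R, T[) (L2norm (heat (T - r) f - step_fun S' r) ^+ 2)%:E <= kap%:E)%E ->
  (\int[mu]_r (L2norm (step_fun S r - step_fun S' r) ^+ 2)%:E <= (4 * kap)%:E)%E.
Proof.
move=> fG ST ST' Sk Sk'.
set I : set RT := `[0, T[%classic in Sk Sk'.
have mI : measurable I by exact: measurable_itv.
pose k S'' (r : R) := L2norm (heat (T - r) f - step_fun S'' r) ^+ 2.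
have mk S'' : measurable_fun I (fun r => (k S'' r)%:E).
  by apply/measurable_EFinP; exact: measurable_heat_step fG.
have k0 S'' r : (0 <= (k S'' r)%:E)%E by rewrite lee_fin sqr_ge0.
apply: (@le_trans _ _ (\int[mu]_(r in I) (2%:E * ((k S r)%:E + (k S' r)%:E)))%E).
  rewrite [leRHS]integral_mkcond; apply: ge0_le_integral_any => r.
    by rewrite lee_fin sqr_ge0.
  rewrite patchE; case: ifPn => rI; last first.
    have rT : ~ (0 <= r < T) by move=> h; case/negP: rI; rewrite inE /I/= in_itv.
    by rewrite (step_fun_out ST rT) (step_fun_out ST' rT) subrr L2norm0 expr0n.
  rewrite [leRHS](_ : _ = (2 * (k S r + k S' r))%:E)// lee_fin /k.
  have := L2normBD (step_fun S r) (heat (T - r) f) (step_fun S' r).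
  rewrite [X in _ <= X + _]L2normB.
  have := L2norm_ge0 (step_fun S r - step_fun S' r).
  set x := L2norm (step_fun S r - _); set a := L2norm _; set b := L2norm _ => x0 xab.
  have h : x ^+ 2 <= (a + b) ^+ 2 by rewrite ler_sqr ?nnegrE// (le_trans x0).
  apply: le_trans h _; have := sqr_ge0 (a - b); nra.
rewrite ge0_integralZl ?lee_fin//; last 2 first.
- by apply: emeasurable_funD.
- by move=> r _; apply: adde_ge0.
rewrite ge0_integralD//.
apply: (@le_trans _ _ (2%:E * (kap%:E + kap%:E))%E).
  by apply: lee_wpmul2l; [rewrite lee_fin|apply: leeD].
by rewrite [leLHS](_ : _ = (2 * (kap + kap))%:E)// lee_fin; lra.
Qed.

(** Chebyshev's inequality on the part of [A] outside [B]; the distance between [X] and [Z] may fail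
    to be measurable. *)
Lemma measure_le_dist (A B : set Omega) (X Z : Omega -> L2 R) (r kap : R) :
  measurable A -> measurable B -> 0 < r ->
  (forall w, A w -> ~ B w -> r <= L2norm (X w - Z w)) ->
  (\int[P]_w (L2norm (X w - Z w) ^+ 2)%:E <= kap%:E)%E ->
  (P A <= P B + (kap / r ^+ 2)%:E)%E.
Proof.
move=> mA mB r0 AB Xk.
have mAB : measurable (A `\` B) by exact: measurableD.
have h : (P (A `\` B) <= (kap / r ^+ 2)%:E)%E.
  have r2 : 0 < r ^+ 2 by rewrite exprn_gt0.
  have : ((r ^+ 2)%:E * P (A `\` B) <= kap%:E)%E.
    apply: le_trans Xk; apply: le_measure_integral_any => //.
    - exact: sqr_ge0.
    - by move=> w; rewrite lee_fin sqr_ge0.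
    - move=> w [Aw Bw]; rewrite lee_fin ler_sqr ?nnegrE ?L2norm_ge0 ?(ltW r0)//.
      exact: AB.
  rewrite -(@fineK _ (P (A `\` B))) ?fin_num_measure// -EFinM !lee_fin.
  by rewrite ler_pdivlMr// mulrC.
apply: (@le_trans _ _ (P (B `|` (A `\` B)))).
  apply: le_measure; rewrite ?inE//; first exact: measurableU.
  by move=> w Aw; have [Bw|Bw] := pselect (B w); [left|right].
by apply: le_trans (measureU2 _ mB mAB) _; rewrite leeD2l.
Qed.

Lemma measurable_affine_closed m H (v : nat -> L2 R) (t : nat -> R) (O : set (L2 R)) :
  closed O -> (forall i, 0 <= t i) ->
  measurable (affine_sum H v @^-1` O : set (m.-tuple RT)) /\
  measurable [set w | O (affine_sum H v
    ([tuple increment W (t i) (t i.+1) w | i < m] : m.-tuple RT))].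
Proof.
move=> cO t0.
have mO : measurable (affine_sum H v @^-1` O : set (m.-tuple RT)).
  have oO : open (~` O) by rewrite openC.
  rewrite -(setCK O) preimage_setC; apply: measurableC.
  exact: (@measurable_affine_preimage R m H v _ oO).
split => //.
have mT : measurable_fun setT
    (fun w => [tuple increment W (t i) (t i.+1) w | i < m] : m.-tuple RT).
  apply/measurable_fun_tnthP => i; rewrite (_ : _ \o _ = increment W (t i) (t i.+1)).
    by apply: (measurable_increment BM); exact: t0.
  by apply/funext => w /=; rewrite tnth_mktuple.
by rewrite -[X in measurable X]setTI; exact: (mT measurableT _ mO).
Qed.

Lemma affine_sum_step (H : L2 R) (S : step R) w :
  affine_sum H (step_val S) ([tuple increment W (step_node S i) (step_node S i.+1) w | i < step_size S]
    : (step_size S).-tuple RT) = H + step_integral W S w.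
Proof.
by rewrite /affine_sum; congr (_ + _); apply: eq_bigr => i _; rewrite tnth_mktuple.
Qed.

End wiener_approximation.

Lemma shrinkD (R : realType) (O : set (L2 R)) (a b : R) (x z : L2 R) :
  shrink O (a + b) x -> L2norm (x - z) <= b -> shrink O a z.
Proof.
move=> Ox xz y zy; apply: Ox; rewrite (le_lt_trans (L2normBD _ z _))//.
by rewrite addrC ltr_leD.
Qed.

Lemma divn_eventually_le (R : realType) (M x : R) : 0 < x ->
  exists N, forall n, (N <= n)%N -> M / n.+1%:R <= x.
Proof.
move=> x0; have Mx : 0 <= `|M| / x by rewrite divr_ge0// ltW.
exists (Num.bound (`|M| / x)) => n Nn; rewrite ler_pdivrMr//.
apply: le_trans (ler_norm _) _; rewrite -ler_pdivrMl// mulrC.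
apply: le_trans (ltW (archi_boundP Mx)) _.
by rewrite ler_nat (leq_trans Nn).
Qed.

Section open_total_variation.
Context d (Omega : measurableType d) (R : realType) (P : probability Omega R).
Variable W : R -> Omega -> R.
Hypothesis BM : brownian_motion P W.
Local Notation mu := (@lebesgue_measure R).
Local Notation RT := (measurableTypeR R).
Variables (f : nat -> R) (G K eps T : R).
Hypothesis fG : forall n, (0 < n)%N -> `|f n| <= G * (1 + eigenval R n).
Hypotheses (eps0 : 0 < eps) (epsT : eps < T) (K0 : 0 <= K).
Hypothesis control : forall L N c, (forall n, `|c n| <= L) ->
  exists u : R -> R, [/\ measurable_fun [set: RT] u,
    forall r, `|u r| <= K * L &
    forall n, (1 <= n <= N)%N ->
      f n * \int[mu]_(r in `[0, T - eps[) (u r * expR (- eigenval R n * (T - r))) =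
      expR (- eigenval R n * T) * c n].

Let T0 : 0 < T. Proof. exact: lt_trans epsT. Qed.

Variables (y0 y1 : L2 R) (U0 U1 : Omega -> L2borel R).
Hypotheses (mU0 : measurable_fun setT U0) (mU1 : measurable_fun setT U1).
Hypothesis U0W : wiener_integral P W T (fun r => heat (T - r) f)
  (fun w => (U0 w : L2 R) - heat T (coef y0)).
Hypothesis U1W : wiener_integral P W T (fun r => heat (T - r) f)
  (fun w => (U1 w : L2 R) - heat T (coef y1)).

(** [2 * L2norm (y0 - y1)] bounds every coefficient of [y0 - y1], by [normr_coef_le]; [B] is the
    resulting bound on the control. *)
Local Notation B := (K * (2 * L2norm (y0 - y1))).

(** The shift produced by the control makes up for the difference of the deterministic parts. The
    budget is r / 8 for each of the two initial data, r / 4 for the terms in [rho] and r / 8 for the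
    error of [S]. The number of modes can be fixed here, since [B] does not depend on it. *)
Lemma heat_diff_le (S : step R) (r rho : R) : step_on T S -> 0 < r -> 0 < rho ->
  B * (T * rho) <= r / 8 ->
  (\int[mu]_(r in `[0%R, T[) (L2norm (heat (T - r) f - step_fun S r) ^+ 2)%:E <=
     (r * rho / (8 * (B + 1)))%:E)%E ->
  exists a : nat -> R,
    (forall i, `|a i| <= B * (step_node S i.+1 - step_node S i)) /\
    L2norm (heat T (coef y0) - heat T (coef y1) -
      \sum_(i < step_size S) a i *: step_val S i) <= r.
Proof.
move=> ST r0 rho0 Br Sk.
have B0 : 0 <= B by rewrite !mulr_ge0// L2norm_ge0.
have r8 : 0 < r / 8 by rewrite divr_gt0.
have [N1 hN1] := divn_eventually_le (24 * G / eps ^+ 3) rho0.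
have [N2 hN2] := divn_eventually_le (24 * (2 * L2norm y0) / T ^+ 3) r8.
have [N3 hN3] := divn_eventually_le (24 * (2 * L2norm y1) / T ^+ 3) r8.
pose N := maxn N1 (maxn N2 N3).
have {}hN1 := hN1 N (leq_maxl _ _).
have {}hN2 := hN2 N (leq_trans (leq_maxl _ _) (leq_maxr _ _)).
have {}hN3 := hN3 N (leq_trans (leq_maxr _ _) (leq_maxr _ _)).
have tail (y : L2 R) : 24 * (2 * L2norm y) / T ^+ 3 / N.+1%:R <= r / 8 ->
    L2norm (heat T (coef y) - heat_sum T (coef y) N.+1) <= r / 8.
  apply: le_trans; apply: heat_tail => // n n0.
  by rewrite (le_trans (normr_coef_le _ _))// ler_peMr ?mulr_ge0 ?L2norm_ge0// lerDl eigenval_ge0.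
have [u [meas_u uB uc]] := control N (fun n => normr_coef_le (y0 - y1) n).
exists (drift_coef T eps u S); split; first by apply: drift_coef_le.
have := drift_error_le eps0 epsT meas_u uB fG hN1 rho0 Sk.
set V := \sum_(i < step_size S) _; set Z := \sum_(n < N) _ => VZ.
have ZE : heat_sum T (coef y0) N.+1 - heat_sum T (coef y1) N.+1 = Z.
  rewrite /heat_sum /partial_sum !big_add1 !big_mkord -sumrB; apply: eq_bigr => n _.
  by rewrite -scalerBl -mulrBr uc//= coefB.
apply: (@le_trans _ _ (r / 8 + r / 8 + B * (T * (rho + rho) + r * rho / (8 * (B + 1)) / rho))).
  apply: le_trans (lerD (lerD (tail _ hN2) (tail _ hN3)) VZ).
  rewrite (le_trans (L2normBD _ Z _))// lerD//; last by rewrite L2normB.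
  rewrite -ZE [X in L2norm X](_ : _ = (heat T (coef y0) - heat_sum T (coef y0) N.+1) -
    (heat T (coef y1) - heat_sum T (coef y1) N.+1)); last first.
    by rewrite !opprB addrACA [RHS]addrACA; congr (_ + _); rewrite addrC.
  by rewrite (le_trans (L2normD _ _))// L2normN.
have -> : r * rho / (8 * (B + 1)) / rho = r / 8 / (B + 1).
  by field; rewrite !gt_eqF// ltr_wpDl.
have h : B * (r / 8 / (B + 1)) <= r / 8.
  rewrite mulrCA mulrC -[leRHS]mul1r ler_wpM2r ?(ltW r8)//.
  by rewrite ler_pdivrMr ?ltr_wpDl// mul1r lerDl.
rewrite mulrDr; move: h Br; rewrite mulrDr mulrDr; lra.
Qed.

Lemma shrink_tv_le (O : set (L2 R)) (theta r e : R) : open O -> 0 < theta -> 0 < r -> 0 < e ->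
  (P [set w | shrink O (4 * r) (U0 w)] <=
   P [set w | O (U1 w)] +
     (theta / 2 + (expR (B ^+ 2 * T) - 1) / (2 * theta) + e)%:E)%E.
Proof.
move=> oO theta0 r0 e0.
have B0 : 0 <= B by rewrite !mulr_ge0// L2norm_ge0.
have BT1 : 0 < B * T + 1 by rewrite ltr_wpDl// mulr_ge0// ltW.
pose rho := r / 8 / (B * T + 1).
have rho0 : 0 < rho by rewrite !divr_gt0.
have Brho : B * (T * rho) <= r / 8.
  rewrite mulrA /rho mulrCA mulrC -[leRHS]mul1r ler_wpM2r ?divr_ge0 ?(ltW r0)//.
  by rewrite ler_pdivrMr// mul1r lerDl.
have g0 := gaussian_moment2_ge0 R; set g := gaussian_moment2 R in g0.
(* The first bound is what [heat_diff_le] asks for; by the second, the errors kap / r^2, 4 g kap /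
   r^2 and kap / r^2 in probability add up to at most [e]. *)
pose kap := Num.min (r * rho / (8 * (B + 1))) (e * r ^+ 2 / (2 + 4 * g)).
have g4 : 0 < 2 + 4 * g by rewrite ltr_pwDl// mulr_ge0.
have kap0 : 0 < kap.
  rewrite lt_min (divr_gt0 (mulr_gt0 e0 (exprn_gt0 2 r0)) g4) andbT.
  by rewrite (divr_gt0 (mulr_gt0 r0 rho0))// mulr_gt0// ltr_wpDl.
have kap1 : kap <= r * rho / (8 * (B + 1)) by rewrite ge_min lexx.
have kap2 : kap * (2 + 4 * g) <= e * r ^+ 2.
  by rewrite -ler_pdivlMr// ge_min lexx orbT.
have [S0 [ST0 Sk0 SW0]] := wiener_integral_approx U0W kap0.
have [S1 [ST1 Sk1 SW1]] := wiener_integral_approx U1W kap0.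
set H0 := heat T (coef y0) in SW0; set H1 := heat T (coef y1) in SW1.
have [a [aB aV]] := heat_diff_le ST0 r0 rho0 Brho (le_trans Sk0 (lee_tofin kap1)).
have t_ge0 S : step_on T S -> forall i, 0 <= step_node S i.
  by move=> [S00 _ Sm] i; rewrite -S00 Sm.
pose X S w : (step_size S).-tuple RT :=
  [tuple increment W (step_node S i) (step_node S i.+1) w | i < step_size S].
have mcl H S (F : set (L2 R)) : step_on T S -> closed F ->
    measurable (affine_sum H (step_val S) @^-1` F : set ((step_size S).-tuple RT)) /\
    measurable [set w | F (affine_sum H (step_val S) (X S w))].
  by move=> ST cF; exact: (@measurable_affine_closed _ _ _ _ _ BM _ H (step_val S) _ F cF (t_ge0 _ ST)).
have XE H S w : affine_sum H (step_val S) (X S w) = H + step_integral W S w.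
  exact: affine_sum_step.
have mO : measurable [set w | O (U1 w)].
  by rewrite -[X in measurable X]setTI; exact: (mU1 measurableT (L2_measurable_open oO)).
have mO4 : measurable [set w | shrink O (4 * r) (U0 w)].
  rewrite -[X in measurable X]setTI; apply: (mU0 measurableT).
  by apply: L2_measurable_closed; exact: closed_shrink.
(* Replace Y(y0) by H0 + (integral of S0), then shift the increments by the
   control, change the law, and go back to Y(y1) through S1; each approximation
   costs r in the set and O(kap / r^2) in probability. *)
have le1 : (P [set w | shrink O (4 * r) (U0 w)] <=
    P [set w | shrink O (3 * r) (affine_sum H0 (step_val S0) (X S0 w))] + (kap / r ^+ 2)%:E)%E.
  apply: (measure_le_dist _ _ r0 _ SW0) => //.
    by have [] := mcl H0 S0 _ ST0 (@closed_shrink R O (3 * r)).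
  move=> w /= Aw; apply: contra_notP => /negP; rewrite -ltNge => /ltW wr.
  apply: (@shrinkD _ _ _ r (U0 w)); last by rewrite XE opprD addrA.
  by rewrite (_ : 3 * r + r = 4 * r)//; ring.
pose Xa w : (step_size S0).-tuple RT :=
  [tuple (increment W (step_node S0 i) (step_node S0 i.+1) w + a i)%R | i < step_size S0].
have [c1 c2] := mcl H1 S0 _ ST0 (@closed_shrink R O (2 * r)).
have [_ c3] := mcl H1 S1 _ ST1 (@closed_shrink R O r).
have [_ c4] := mcl H0 S0 _ ST0 (@closed_shrink R O (3 * r)).
have XaE w : affine_sum H1 (step_val S0) (Xa w) =
    H1 + (step_integral W S0 w + \sum_(i < step_size S0) a i *: step_val S0 i).
  rewrite /affine_sum -big_split/=; congr (_ + _); apply: eq_bigr => i _.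
  by rewrite tnth_mktuple scalerDl.
have mXa : measurable [set w | shrink O (2 * r) (affine_sum H1 (step_val S0) (Xa w))].
  have mT : measurable_fun setT Xa.
    apply/measurable_fun_tnthP => i.
    rewrite (_ : _ \o _ = fun w => increment W (step_node S0 i) (step_node S0 i.+1) w + a i).
      by apply: measurable_funD => //; apply: (measurable_increment BM); exact: t_ge0.
    by apply/funext => w /=; rewrite tnth_mktuple.
  by rewrite -[X in measurable X]setTI; exact: (mT measurableT _ c1).
(* An inclusion of events: by [aV] the shifted sum around [H1] stays within [r] of the sum around
   [H0], for every outcome. *)
have le2 : (P [set w | shrink O (3 * r) (affine_sum H0 (step_val S0) (X S0 w))] <=
    P [set w | shrink O (2 * r) (affine_sum H1 (step_val S0) (Xa w))])%E.
  apply: le_measure; rewrite ?inE// => w /= Aw.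
  apply: (@shrinkD _ _ _ r (affine_sum H0 (step_val S0) (X S0 w))).
    by rewrite (_ : 2 * r + r = 3 * r)//; ring.
  by rewrite XE XaE opprD addrACA opprD addNKr.
have le3 : (P [set w | shrink O (2 * r) (affine_sum H1 (step_val S0) (Xa w))] <=
    P [set w | shrink O (2 * r) (affine_sum H1 (step_val S0) (X S0 w))] +
    (theta / 2 + (expR (B ^+ 2 * T) - 1) / (2 * theta))%:E)%E.
  have [S00 S0T Sm] := ST0.
  have := @increment_tv_le _ _ _ _ _ BM (step_node S0) (step_size S0) a B theta _ (t_ge0 _ ST0 0%N) Sm aB theta0 c1.
  by rewrite S0T S00 subr0.
have le4 : (P [set w | shrink O (2 * r) (affine_sum H1 (step_val S0) (X S0 w))] <=
    P [set w | shrink O r (affine_sum H1 (step_val S1) (X S1 w))] + (g * (4 * kap) / r ^+ 2)%:E)%E.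
  apply: (measure_le_dist c2 c3 r0 (X := step_integral W S0) (Z := step_integral W S1)).
    move=> w /= Aw; apply: contra_notP => /negP; rewrite -ltNge => /ltW wr.
    apply: (@shrinkD _ _ _ r (affine_sum H1 (step_val S0) (X S0 w))).
      by rewrite (_ : r + r = 2 * r)//; ring.
    by rewrite !XE opprD addrACA subrr add0r.
  rewrite (step_isometry BM ST0 ST1) EFinM; apply: lee_wpmul2l; first by rewrite lee_fin.
  exact: step_fun_dist fG ST0 ST1 Sk0 Sk1.
have le5 : (P [set w | shrink O r (affine_sum H1 (step_val S1) (X S1 w))] <=
    P [set w | O (U1 w)] + (kap / r ^+ 2)%:E)%E.
  apply: (measure_le_dist c3 mO r0 (X := fun w => U1 w - H1) (Z := step_integral W S1)) => //.
  move=> w /= Aw; apply: contra_notP => /negP; rewrite -ltNge => wr; apply: Aw.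
  by rewrite XE L2normB opprD addrA.
apply: le_trans le1 _; apply: le_trans (leeD2r _ le2) _.
apply: le_trans (leeD2r _ le3) _; apply: le_trans (leeD2r _ (leeD2r _ le4)) _.
apply: le_trans (leeD2r _ (leeD2r _ (leeD2r _ le5))) _.
rewrite -!addeA leeD2l// -!EFinD lee_fin.
set D := theta / 2 + _.
suff : kap / r ^+ 2 + g * (4 * kap) / r ^+ 2 + kap / r ^+ 2 <= e by lra.
rewrite -!mulrDl ler_pdivrMr ?exprn_gt0//; lra.
Qed.

End open_total_variation.

Section borel_total_variation.
Context d (Omega : measurableType d) (R : realType) (P : probability Omega R).
Variables (U0 U1 : Omega -> L2borel R) (delta : R).
Hypotheses (mU0 : measurable_fun setT U0) (mU1 : measurable_fun setT U1).

(** Continuity from below along the sets [shrink O r], with [delta] the same for all [r]. *)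
Lemma open_le_of_shrink_le (O : set (L2 R)) : open O ->
  (forall r e, 0 < r -> 0 < e -> (P [set w | shrink O (4 * r) (U0 w)] <=
     P [set w | O (U1 w)] + (delta + e)%:E)%E) ->
  (P [set w | O (U0 w)] <= P [set w | O (U1 w)] + delta%:E)%E.
Proof.
move=> oO H.
pose F n := [set w | shrink O n.+1%:R^-1 (U0 w)].
have mF n : measurable (F n).
  rewrite -[X in measurable X]setTI; apply: (mU0 measurableT).
  by apply: L2_measurable_closed; exact: closed_shrink.
have UF : \bigcup_n F n = [set w | O (U0 w)].
  rewrite -[in RHS](bigcup_shrink oO).
  by apply/seteqP; split => w [n _ h]; exists n.
have ndF : {homo F : n m / (n <= m)%N >-> (n <= m)%O}.
  move=> n m nm; apply/subsetPset => w; apply: shrink_le.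
  by rewrite lef_pV2 ?posrE// ler_nat.
have cF := nondecreasing_cvg_mu (mu := P) mF (bigcupT_measurable _ mF) ndF.
rewrite UF in cF.
apply: (cvge_to_le cF); apply: nearW => n.
apply/lee_addgt0Pr => e e0; rewrite -addeA -EFinD [X in (X <= _)%E]/(P (F n)).
have -> : F n = [set w | shrink O (4 * (n.+1%:R^-1 / 4)) (U0 w)].
  by rewrite mulrCA divff// mulr1.
by apply: H => //; rewrite divr_gt0.
Qed.

(** Enlarging [A] to an open set can only increase the left-hand side, so outer regularity is
    applied to the law of [U1] alone. *)
Lemma borel_le_of_open_le (A : set (L2borel R)) : measurable A ->
  (forall O : set (L2 R), open O -> (P [set w | O (U0 w)] <= P [set w | O (U1 w)] + delta%:E)%E) ->
  (P (U0 @^-1` A) <= P (U1 @^-1` A) + delta%:E)%E.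
Proof.
move=> mA H; apply/lee_addgt0Pr => e e0.
pose X1 : {RV P >-> L2borel R} := mfun_Sub (mem_set mU1).
have [ O [oO AO OA]] := L2_outer_regular (distribution P X1) mA e0.
have mO := L2_measurable_open oO.
have h0 : (P (U0 @^-1` A) <= P [set w | O (U0 w)])%E.
  apply: le_measure; rewrite ?inE; last by move=> w; exact: AO.
    by rewrite -[X in measurable X]setTI; exact: (mU0 measurableT mA).
  by rewrite -[X in measurable X]setTI; exact: (mU0 measurableT mO).
apply: le_trans h0 _; apply: le_trans (H _ oO) _.
by rewrite addeAC leeD2r//; exact: OA.
Qed.

End borel_total_variation.

Lemma expR_sub1_le (R : realType) (z : R) : 0 <= z -> z <= 2^-1 -> expR z - 1 <= 2 * z.
Proof.
move=> z0 z1; have h := expR_ge1Dx (- z); have e0 := expR_gt0 z.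
have : expR z * expR (- z) = 1 by rewrite -expRD subrr expR0.
nra.
Qed.

Theorem theorem1p2 (R : realType) (C alpha s : R) (f : nat -> R)
  (C_gt0 : 0 < C) (alpha_gt0 : 0 < alpha) (s_ge0 : 0 <= s) (s_lt1 : s < 1)
  (f_Hneg : in_Hneg s f)
  (f_lower : forall n : nat, (1 <= n)%N ->
     C * expR (- alpha * pi ^+ 2 * n%:R ^+ 2) <= `|f n|)
  (d : measure_display) (Omega : measurableType d) (P : probability Omega R)
  (W : R -> Omega -> R) (W_brownian : brownian_motion P W)
  (Y : L2 R -> R -> Omega -> L2 R)
  (Y_mild : forall y0 : L2 R, mild_solution P W f y0 (Y y0))
  (T : R) (T_gt : alpha < T) :
  strong_feller (markov_semigroup P Y T).
Proof.
have T0 : 0 <= T by rewrite (le_trans (ltW alpha_gt0))// ltW.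
have [G G0 fG] := in_Hneg_bound (ltW s_lt1) f_Hneg.
have f_lower' n : (1 <= n)%N -> C * expR (- alpha * eigenval R n) <= `|f n|.
  by move=> n1; rewrite /eigenval mulrA; exact: f_lower.
have [K [eps [K0 eps0 epsT control]]] := approximate_null_control C_gt0 alpha_gt0 T_gt f_lower'.
pose D theta y0 y1 := theta / 2 +
  (expR ((K * (2 * L2norm (y0 - y1))) ^+ 2 * T) - 1) / (2 * theta).
move=> phi mphi [M0 M0phi].
(* The added 1 makes [M] positive, so that [theta] can be obtained by division. *)
pose M := `|M0| + 1.
have M1 : 0 < M by rewrite ltr_wpDl.
have Mphi u : `|phi u| <= M.
  by rewrite (le_trans (M0phi u))// (le_trans (ler_norm _))// lerDl.
have mY y : measurable_fun setT (Y y T : Omega -> L2borel R) := mild_measurable (Y_mild y) T0.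
have main theta y0 y1 : 0 < theta ->
    markov_semigroup P Y T phi y0 <= markov_semigroup P Y T phi y1 + 2 * M * D theta y0 y1.
  move=> theta0; apply: expectation_le_tail => //.
  - exact: (measurableT_comp mphi (mY y0)).
  - exact: (measurableT_comp mphi (mY y1)).
  - rewrite addr_ge0 ?divr_ge0 ?mulr_ge0 ?(ltW theta0)// subr_ge0 -expR0 ler_expR.
    by rewrite mulr_ge0// sqr_ge0.
  - move=> c; have mA : measurable ([set u | c < phi u] : set (L2borel R)).
      rewrite -[X in measurable X]setTI (_ : [set u | _] = phi @^-1` `]c, +oo[%classic).
        by apply: (mphi measurableT); exact: measurable_itv.
      by apply/seteqP; split => u /=; rewrite in_itv/= andbT.
    apply: (borel_le_of_open_le (mY y0) (mY y1) mA) => O oO.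
    apply: (open_le_of_shrink_le (mY y0) oO) => r e r0 e0.
    exact: (shrink_tv_le W_brownian fG eps0 epsT (ltW K0) control (mY y0) (mY y1)
      (mild_eq (Y_mild y0) T0) (mild_eq (Y_mild y1) T0) oO theta0 r0 e0).
move=> y0 A /nbhs_ballP[e' /= e'0 eA].
pose e := e' / 2; have e0 : 0 < e by rewrite divr_gt0.
have [theta theta0 eE] : exists2 theta, 0 < theta & e = 2 * M * theta.
  exists (e / (2 * M)); first by rewrite divr_gt0// mulr_gt0.
  by rewrite mulrC divfK// gt_eqF// mulr_gt0.
(* For z <= 1/2 one has e^z - 1 <= 2 z, and z <= theta^2 / 2 then makes the second term of [D] at
   most theta / 2; hence D <= theta. *)
pose m := Num.min 2^-1 (theta ^+ 2 / 2).
have m0 : 0 < m by rewrite lt_min invr_gt0 ltr0n divr_gt0 ?exprn_gt0.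
pose q := (K * 2) ^+ 2 * T.
have q0 : 0 <= q by rewrite mulr_ge0// sqr_ge0.
have q1 : 0 < q + 1 by rewrite ltr_wpDl.
have Dle y1 y2 : L2norm (y1 - y2) <= Num.min 1 (m / (q + 1)) -> 2 * M * D theta y1 y2 <= e.
  rewrite le_min => /andP[]; set x := L2norm _ => x1 xm.
  have x0 : 0 <= x := L2norm_ge0 _.
  rewrite /D -/x (_ : (K * (2 * x)) ^+ 2 * T = q * x ^+ 2); last by rewrite /q; ring.
  have qx : q * x ^+ 2 <= m.
    (* As x <= 1, q x^2 <= q x <= (q + 1) x <= m; the denominator q + 1 is positive even when q =
       0. *)
    have h : 0 <= q * x * (1 - x) by apply: mulr_ge0; [exact: mulr_ge0|rewrite subr_ge0].
    by move: xm; rewrite ler_pdivlMr// => xm; lra.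
  have /andP[z1 z2] : (q * x ^+ 2 <= 2^-1) && (q * x ^+ 2 <= theta ^+ 2 / 2).
    by rewrite -le_min.
  have z0 : 0 <= q * x ^+ 2 by rewrite mulr_ge0// sqr_ge0.
  have h := expR_sub1_le z0 z1.
  have hD : (expR (q * x ^+ 2) - 1) / (2 * theta) <= theta / 2.
    by rewrite ler_pdivrMr ?mulr_gt0//; nra.
  rewrite [leRHS]eE ler_wpM2l ?mulr_ge0 ?(ltW M1)//; lra.
apply: (@nbhs_ballP R (L2 R) y0 _).2; exists (Num.min 1 (m / (q + 1))) => /=.
  by rewrite lt_min ltr01 divr_gt0.
move=> y1 /ltW y01; apply: eA; rewrite /= /ball/=.
have h1 := main theta y0 y1 theta0; have h2 := main theta y1 y0 theta0.
have d1 := Dle _ _ y01.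
have d2 : 2 * M * D theta y1 y0 <= e by apply: Dle; rewrite L2normB.
by rewrite ltr_norml; apply/andP; split; rewrite /e in d1 d2; lra.
Qed.
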